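(* Let $X$ be a compact Hausdorff space, $\mu$ a regular Borel probability measure on $X$, and $T:X\to X$ an ergodic automorphism of $(X,\mu)$ (invertible and measure-preserving; $T$ is not assumed continuous). Let $C(X,\mathrm{SL}(2,\mathbb{R}))$ be the space of continuous maps $A:X\to\mathrm{SL}(2,\mathbb{R})$ with the topology of uniform convergence. Then there is a residual set $\mathcal{R}\subset C(X,\mathrm{SL}(2,\mathbb{R}))$ such that every $A\in\mathcal{R}$ either is uniformly hyperbolic or satisfies $\mathrm{LE}(A)=0$.
   Context: For a cocycle $A$ write $A^n(x)=A(T^{n-1}x)\cdots A(x)$ for $n>0$, $A^0=I$, and $A^n(x)=[A(T^nx)]^{-1}\cdots[A(T^{-1}x)]^{-1}$ for $n<0$. The limit $\lambda^+(x)=\lim_{n\to\infty}\frac1n\log\|A^n(x)\|\ge0$ exists $\mu$-a.e., and $\mathrm{LE}(A)=\int_X\lambda^+\,d\mu$. The cocycle $A$ (over $T$) is uniformly hyperbolic if for $\mu$-a.e. $x$ there is a splitting $\mathbb{R}^2=E^u(x)\oplus E^s(x)$, measurable in $x$, with $A(x)E^u(x)=E^u(Tx)$, $A(x)E^s(x)=E^s(Tx)$ a.e., and constants $C>0$, $0<\tau<1$ such that $\|A^n(x)v^s\|\le C\tau^n\|v^s\|$ and $\|A^{-n}(x)v^u\|\le C\tau^n\|v^u\|$ for a.e. $x$, all $v^s\in E^s(x)$, $v^u\in E^u(x)$ and $n\ge0$. *)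

(* Defs.v *)
From HB Require Import structures.
From mathcomp Require Import all_boot all_order all_algebra.
From mathcomp Require Import all_classical all_reals all_analysis.
Set Implicit Arguments. Unset Strict Implicit. Unset Printing Implicit Defensive.
Import Order.TTheory GRing.Theory Num.Theory.
Import numFieldNormedType.Exports.
Local Open Scope classical_set_scope.
Local Open Scope ring_scope.

Definition Borel (X : ptopologicalType) := g_sigma_algebraType (@open X).

Section Defs.
Context {R : realType} {X : ptopologicalType}.

Definition regular_measure (mu : set (Borel X) -> \bar R) :=
  forall E : set (Borel X), measurable E ->
    mu E = ereal_sup [set mu K | K in [set K : set X | compact K /\ K `<=` E]] /\
    mu E = ereal_inf [set mu U | U in [set U : set X | open U /\ E `<=` U]].

Definition ergodic_automorphism (mu : set (Borel X) -> \bar R)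
    (T Tinv : Borel X -> Borel X) :=
  [/\ cancel T Tinv /\ cancel Tinv T,
      measurable_fun setT T, measurable_fun setT Tinv,
      (forall E : set (Borel X), measurable E -> mu (T @^-1` E) = mu E) &
      (forall E : set (Borel X), measurable E -> T @^-1` E = E ->
          mu E = 0%E \/ mu E = 1%E)].

Fixpoint cocycle_pos (A : X -> 'M[R]_2) (T : X -> X) (n : nat) (x : X) : 'M[R]_2 :=
  match n with
  | 0 => 1%:M
  | k.+1 => A (iter k T x) *m cocycle_pos A T k x
  end.

Fixpoint cocycle_neg (A : X -> 'M[R]_2) (Tinv : X -> X) (n : nat) (x : X) : 'M[R]_2 :=
  match n with
  | 0 => 1%:M
  | k.+1 => invmx (A (iter k.+1 Tinv x)) *m cocycle_neg A Tinv k x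
  end.

(* action of a matrix on a (column) vector, vectors being stored as rows *)
Definition act (M : 'M[R]_2) (v : 'rV[R]_2) : 'rV[R]_2 := (M *m v^T)^T.

(* lambda^+(x) = lim (1/n) log ||A^n(x)|| (limsup, which equals the limit
   wherever it exists, in particular mu-a.e.) *)
Definition lyap_plus (A : X -> 'M[R]_2) (T : X -> X) (x : X) : \bar R :=
  limn_esup (fun n : nat => ((n%:R)^-1 * ln `|cocycle_pos A T n x|)%:E).

Definition LE (mu : {measure set (Borel X) -> \bar R}) (T : X -> X)
    (A : X -> 'M[R]_2) : \bar R :=
  (\int[mu]_(x in [set: Borel X]) lyap_plus A T x)%E.

(* Uniform hyperbolicity.  The subspaces E^u(x), E^s(x) are the row spaces
   of matrices Eu x, Es x, depending measurably on x (entrywise). *)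
Definition uniformly_hyperbolic (mu : {measure set (Borel X) -> \bar R})
    (T Tinv : X -> X) (A : X -> 'M[R]_2) :=
  exists Eu Es : X -> 'M[R]_2,
    (forall i j, measurable_fun setT (fun x : Borel X => Eu x i j)) /\
    (forall i j, measurable_fun setT (fun x : Borel X => Es x i j)) /\
    exists C tau : R, [/\ 0 < C, 0 < tau, tau < 1 &
      {ae mu, forall x : Borel X,
        [/\ mxdirect (Eu x + Es x) /\ (Eu x + Es x == 1%:M)%MS,
            (Eu x *m (A x)^T == Eu (T x))%MS,
            (Es x *m (A x)^T == Es (T x))%MS,
            (forall (n : nat) (v : 'rV[R]_2), (v <= Es x)%MS ->
               `|act (cocycle_pos A T n x) v| <= C * tau ^+ n * `|v|) &
            (forall (n : nat) (v : 'rV[R]_2), (v <= Eu x)%MS ->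
               `|act (cocycle_neg A Tinv n x) v| <= C * tau ^+ n * `|v|)]}].

Definition SL2C (A : X -> 'M[R]_2) := continuous A /\ forall x, \det (A x) = 1.

Definition unif_close (A B : X -> 'M[R]_2) (e : R) :=
  exists2 d : R, d < e & forall x, `|A x - B x| <= d.

Definition unif_open_in (S U : set (X -> 'M[R]_2)) :=
  U `<=` S /\
  forall A, U A -> exists2 e : R, 0 < e & forall B, S B -> unif_close A B e -> U B.

Definition unif_dense_in (S U : set (X -> 'M[R]_2)) :=
  forall A, S A -> forall e : R, 0 < e -> exists B, U B /\ unif_close A B e.

Definition residual_in (S Rs : set (X -> 'M[R]_2)) :=
  Rs `<=` S /\
  exists U : nat -> set (X -> 'M[R]_2),
    (forall n, unif_open_in S (U n) /\ unif_dense_in S (U n)) /\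
    \bigcap_n U n `<=` Rs.

End Defs.

(* Main.v *)
Require Import Defs.
From HB Require Import structures.
From mathcomp Require Import all_boot all_order all_algebra.
From mathcomp Require Import all_classical all_reals all_analysis.
From mathcomp Require Import measurable_realfun.
From mathcomp Require Import ring lra zify.
Set Implicit Arguments.
Unset Strict Implicit.
Unset Printing Implicit Defensive.
Import Order.TTheory GRing.Theory Num.Theory.
Import numFieldNormedType.Exports.
Local Open Scope classical_set_scope.
Local Open Scope ring_scope.

(** The exponent LE is half of the infimum over n of the averages of
    ln |A^n|^2 / n (Hilbert-Schmidt norm), hence upper semicontinuous. It therefore
    suffices to approximate every A that is not uniformly hyperbolic by cocycles
    with arbitrarily small exponent: the open dense sets are then the unions of the
    interior of the uniformly hyperbolic cocycles with {LE < 1/n}.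

    If LE(A) > 0, let E^u, E^s be the Oseledets directions and rotate E^u(x) by a
    small angle at each step of the orbit of x. If for almost every x the rotated
    direction never reaches E^s, then its slope in the frame (E^u, E^s) stays
    bounded although it increases by a fixed amount at each step; this bounds the
    sums over j < m of |s_m|^2 / |s_j|^2, where s_j = A^j s_0 with s_0 in E^s, and
    such a bound forces exponential decay at a uniform rate, so that A is uniformly
    hyperbolic. Otherwise E^u(x) reaches E^s for x in a set D of positive measure.
    The orbit of almost every y visits D at some large time k, and the product over
    2k + O(1) steps whose perturbation sends E^u to E^s in the middle has
    subexponential norm, since the expansion before time k is undone afterwards.
    Such words of rotations, with rational parameters, are read one after the other
    along orbits, starting afresh at the visits to a set of small measure; this
    gives a measurable perturbation with small exponent, which regularity of the
    measure turns into a continuous one. If there are no sets of small positive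
    measure, nonuniform hyperbolicity is already uniform. *)

(** * Ergodic automorphisms *)

(** A cancelling word pays two fixed prices: a constant for the few perturbed steps in its middle,
    and the inverse square of the angle between E^u(y) and E^s(y). Both are known before the time k
    is chosen, so recurrence at arbitrarily large times lets k outweigh them; the two unperturbed
    blocks must have equal length because E^u and E^s have opposite exponents. Since such words
    exist at almost every point, a new one may begin wherever the last one ends. The obstacle is
    measurability: the word in use at x depends on the past of x, which has no beginning. Forced
    restarts at a set E supply one, and the smallness of E makes interruptions rare. Rational
    letters make the words countable, hence their choice measurable. Keeping only finitely many
    words bounds their lengths and leaves finitely many angles, so the perturbation is a simple
    function and each of its level sets can be approximated by a continuous function. Rotations
    preserve the Hilbert-Schmidt norm, so every perturbation obeys the same bound K per step, and
    exceptional sets cost at most K times their measure, up to constants. *)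

Section Ergodic.
Context {R : realType} {d : measure_display} {Om : measurableType d}.
Variable mu : probability Om R.
Implicit Types (T Tinv : Om -> Om) (E : set Om).

Definition ergodic_aut T Tinv :=
  [/\ cancel T Tinv /\ cancel Tinv T,
      measurable_fun setT T, measurable_fun setT Tinv,
      (forall E, measurable E -> mu (T @^-1` E) = mu E) &
      (forall E, measurable E -> T @^-1` E = E -> mu E = 0%E \/ mu E = 1%E)].

Lemma ergodic_aut_sym T Tinv : ergodic_aut T Tinv -> ergodic_aut Tinv T.
Proof.
move=> [[TK TiK] mT mTi pT eT]; split => //.
  move=> E mE; rewrite -(pT (Tinv @^-1` E)).
    congr (mu _); apply/seteqP; split => x /=; first by rewrite TK.
    by rewrite TK.
  by rewrite -[X in measurable X]setTI; exact: mTi.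
move=> E mE TE; apply: eT => //; rewrite -[in LHS]TE.
by apply/seteqP; split => x /=; rewrite TK.
Qed.

Lemma measurable_preim (U : Om -> Om) E : measurable_fun setT U ->
  measurable E -> measurable (U @^-1` E).
Proof. by move=> mU mE; rewrite -[X in measurable X]setTI; exact: mU. Qed.

Lemma measurable_iter (U : Om -> Om) n : measurable_fun setT U ->
  measurable_fun setT (iter n U).
Proof.
move=> mU; elim: n => [|n IH]; first exact: measurable_id.
by apply: (measurableT_comp mU).
Qed.

Lemma preserved_iter T Tinv n E : ergodic_aut T Tinv -> measurable E ->
  mu (iter n T @^-1` E) = mu E.
Proof.
move=> [_ mT _ pT _]; elim: n E => [//|n IH] E mE.
rewrite -(IH E mE) -(pT (iter n T @^-1` E)); last first.
  by apply: measurable_preim => //; exact: measurable_iter.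
by congr (mu _); apply/seteqP; split => x /=; rewrite -iterSr.
Qed.

Lemma ae_full E : measurable E -> mu E = 1%E -> \forall x \ae mu, E x.
Proof.
move=> mE E1; exists (~` E); split => //; first exact: measurableC.
by rewrite probability_setC// E1 subee.
Qed.

Lemma ae_iter T Tinv n (P : Om -> Prop) : ergodic_aut T Tinv ->
  (\forall x \ae mu, P x) -> \forall x \ae mu, P (iter n T x).
Proof.
move=> eT [A [mA A0 sA]]; exists (iter n T @^-1` A); split.
- by case: eT => _ mT _ _ _; apply: measurable_preim => //; exact: measurable_iter.
- by rewrite (preserved_iter n eT).
- by move=> x /= nP; exact: sA.
Qed.

Lemma ae_exists E (P : Om -> Prop) : measurable E -> mu E != 0%E ->
  (\forall x \ae mu, P x) -> exists2 x, E x & P x.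
Proof.
move=> mE E0 [A [mA A0 sA]]; apply: contrapT => h; move/eqP: E0; apply.
apply: (subset_measure0 _ mA) => //.
by move=> x Ex; apply: sA => /= Px; apply: h; exists x.
Qed.

(** The sets [U k] of points that meet E at some time at least k satisfy [U k.+1] = T^{-1}([U k]),
    so all have the measure of [U 0]. Their decreasing intersection [V] keeps this positive measure
    and is exactly invariant, hence full by ergodicity. *)
Theorem recurrence T Tinv E : ergodic_aut T Tinv ->
  measurable E -> mu E != 0%E ->
  \forall x \ae mu, forall N : nat, exists2 n, (N <= n)%N & E (iter n T x).
Proof.
move=> eT mE E0.
pose U k := \bigcup_(n in [set n | (k <= n)%N]) (iter n T @^-1` E).
case: (eT) => _ mT _ pT erg.
have mU k : measurable (U k).
  by apply: bigcup_measurable => n _; apply: measurable_preim => //; exact: measurable_iter.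
have US k : U k.+1 = T @^-1` (U k).
  apply/seteqP; split => x /= [n /= kn Enx].
    by case: n kn Enx => // n kn Enx; exists n => //=; rewrite -iterSr.
  by exists n.+1 => //=; rewrite -iterS iterSr.
have muU k : mu (U k) = mu (U 0%N).
  by elim: k => // k <-; rewrite US pT.
have leU : nonincreasing_seq U.
  apply/nonincreasing_seqP => k; apply/subsetPset => x [n /= kn Enx].
  by exists n => //=; exact: ltnW.
pose V := \bigcap_k U k.
have mV : measurable V by exact: bigcapT_measurable.
have muV : mu V = mu (U 0%N).
  have U0y : (mu (U 0%N) < +oo)%E by rewrite (le_lt_trans (probability_le1 _ _))// ltry.
  have := nonincreasing_cvg_mu U0y mU mV leU.
  rewrite (_ : mu \o U = cst (mu (U 0%N))); last by apply/funext => k /=.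
  move=> h; apply: (cvg_unique _ h); [exact: ereal_hausdorff|exact: cvg_cst].
have V1 : mu V = 1%E.
  have [|V0|//] := erg V mV; last first.
    exfalso; move/eqP: E0; apply; apply: (subset_measure0 _ (mU 0%N)) => //.
    - by move=> x Ex; exists 0%N.
    - exact: (etrans (esym muV) V0).
  apply/seteqP; split => x /= Vx k _.
    have [|n /= kn En] := Vx k.-1 => //.
    exists n.+1; last by rewrite /= -iterS iterSr.
    by rewrite /=; move: kn; lia.
  have [|n /= kn En] := Vx k.+1 => //.
  by case: n kn En => // n kn En; exists n => //=; rewrite -iterSr.
apply: filterS (ae_full mV V1) => x Vx N.
by have [|n] := Vx N => //; exists n.
Qed.

Definition bmf (f : Om -> R) :=
  measurable_fun setT f /\ exists K : R, forall x, `|f x| <= K.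

Definition avg (f : Om -> R) : R := Rintegral mu setT f.

Lemma bmf_integrable f : bmf f -> mu.-integrable setT (EFin \o f).
Proof.
move=> [mf [K fK]]; apply: measurable_bounded_integrable => //.
  by rewrite (le_lt_trans (probability_le1 _ _))// ltry.
by exists K; split; [exact: num_real|move=> M KM x _; apply: le_trans (fK x) (ltW KM)].
Qed.

Lemma bmf_cst (c : R) : bmf (fun=> c).
Proof. by split => //; exists `|c|. Qed.

Lemma bmfD f g : bmf f -> bmf g -> bmf (fun x => f x + g x).
Proof.
move=> [mf [K fK]] [mg [L gL]]; split; first exact: measurable_funD.
by exists (K + L) => x; rewrite (le_trans (ler_normD _ _))// lerD.
Qed.

Lemma bmfZ (c : R) f : bmf f -> bmf (fun x => c * f x).
Proof.
move=> [mf [K fK]]; split; first exact: measurable_funM.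
by exists (`|c| * K) => x; rewrite normrM ler_wpM2l.
Qed.

Lemma bmf_sum (f : nat -> Om -> R) n : (forall i, bmf (f i)) ->
  bmf (fun x => \sum_(i < n) f i x).
Proof.
move=> hf; elim: n => [|n IH].
  under [X in bmf X]eq_fun do rewrite big_ord0.
  exact: bmf_cst.
under [X in bmf X]eq_fun do rewrite big_ord_recr.
exact: bmfD.
Qed.

Lemma bmf_comp (U : Om -> Om) f : measurable_fun setT U -> bmf f ->
  bmf (fun x => f (U x)).
Proof.
by move=> mU [mf [K fK]]; split; [exact: (measurableT_comp mf)|exists K].
Qed.

Lemma bmf_indic E : measurable E -> bmf (\1_E).
Proof.
move=> mE; split; first exact: measurable_indic.
by exists 1 => x; rewrite indicE; case: (x \in E); rewrite ?normr1 ?normr0.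
Qed.

Lemma avg_cst (c : R) : avg (fun=> c) = c.
Proof.
rewrite /avg Rintegral_cst// /=.
by rewrite probability_setT mulr1.
Qed.

Lemma avgD f g : bmf f -> bmf g -> avg (fun x => f x + g x) = avg f + avg g.
Proof. by move=> bf bg; apply: RintegralD => //; exact: bmf_integrable. Qed.

Lemma avgZ (c : R) f : bmf f -> avg (fun x => c * f x) = c * avg f.
Proof. by move=> bf; apply: RintegralZl => //; exact: bmf_integrable. Qed.

Lemma avg_sum (f : nat -> Om -> R) n : (forall i, bmf (f i)) ->
  avg (fun x => \sum_(i < n) f i x) = \sum_(i < n) avg (f i).
Proof.
move=> hf; elim: n => [|n IH].
  rewrite big_ord0 (_ : (fun _ => _) = fun=> 0) ?avg_cst//.
  by apply/funext => x; rewrite big_ord0.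
rewrite big_ord_recr/= -IH -avgD//; last exact: bmf_sum.
by congr avg; apply/funext => x; rewrite big_ord_recr.
Qed.

(** Replacing g by max(f, g), which agrees with g almost everywhere, reduces the claim to pointwise
    monotonicity. *)
Lemma avg_le_ae f g : bmf f -> bmf g -> (\forall x \ae mu, f x <= g x) ->
  avg f <= avg g.
Proof.
move=> bf bg fg.
have bm : bmf (fun x => Num.max (f x) (g x)).
  case: bf bg => mf [K fK] [mg [L gL]]; split; first exact: measurable_maxr.
  exists (Num.max K L) => x; have := fK x; have := gL x.
  by rewrite !maxEle; case: ifP; case: ifP => /=; move: (f x) (g x) => a b *; lra.
have -> : avg g = avg (fun x => Num.max (f x) (g x)).
  congr fine; apply: ae_eq_integral => //.
  - by apply: measurable_int (bmf_integrable bg).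
  - by apply: measurable_int (bmf_integrable bm).
  by apply: filterS fg => x fgx _; rewrite /= (max_idPr fgx).
apply: le_Rintegral => //; try exact: bmf_integrable.
by move=> x _; rewrite le_max lexx.
Qed.

Lemma avg_indic E : measurable E -> avg (\1_E) = fine (mu E).
Proof. by move=> mE; rewrite /avg /Rintegral integral_indic// setIT. Qed.

Lemma avg_comp T Tinv f : ergodic_aut T Tinv -> bmf f ->
  avg (fun x => f (T x)) = avg f.
Proof.
move=> [_ mT _ pT _] bf; congr fine.
have mf : measurable_fun setT (EFin \o f) by apply: measurable_int (bmf_integrable bf).
have := @integral_pushforward _ _ _ _ _ T mT mu setT (EFin \o f) mf.
rewrite preimage_setT => /(_ _ measurableT) => h.
rewrite -[LHS]/((\int[mu]_x (EFin \o f \o T) x)%E) -h; last first.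
  by apply: (@bmf_integrable (fun x => f (T x))); exact: bmf_comp.
by apply: eq_measure_integral => A mA _; exact: pT.
Qed.

Lemma avg_iter T Tinv n f : ergodic_aut T Tinv -> bmf f ->
  avg (fun x => f (iter n T x)) = avg f.
Proof.
move=> eT bf; elim: n => [//|n IH]; rewrite -[RHS]IH.
rewrite -[RHS](avg_comp eT); last first.
  apply: bmf_comp => //; apply: measurable_iter; by case: eT.
by congr avg; apply/funext => x; rewrite -iterSr.
Qed.

End Ergodic.

(** * Subadditive ergodic theorem *)

Section Subadditive.
Context {R : realType} {d : measure_display} {Om : measurableType d}.
Implicit Types (T Tinv : Om -> Om) (g : nat -> Om -> R) (psi : Om -> R).

Definition bsum T psi n x : R := \sum_(i < n) psi (iter i T x).

Lemma bsumD T psi n m x :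
  bsum T psi (n + m) x = bsum T psi n x + bsum T psi m (iter n T x).
Proof.
rewrite /bsum big_split_ord /=; congr (_ + _).
by apply: eq_bigr => i _; rewrite -iterD addnC.
Qed.

Lemma bsum1 T psi x : bsum T psi 1 x = psi x.
Proof. by rewrite /bsum big_ord1. Qed.

Lemma bsum_ge0 T psi n x : (forall y, 0 <= psi y) -> 0 <= bsum T psi n x.
Proof. by move=> h; exact: sumr_ge0. Qed.

(** Greedy covering of an orbit segment: from a point of P one jumps at most L steps to another
    point of P, each jump being paid for by [psi]. The last incomplete jump costs at most K(L + 1).
    It serves both the subadditive ergodic theorem, with P everything, and the reading of words,
    with P the points where a new word starts. *)
Lemma cover_bound T g (K : R) psi (P : set Om) (L : nat) :
  (forall n m x, g (n + m)%N x <= g n x + g m (iter n T x)) ->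
  (forall n x, g n x <= K * n.+1%:R) -> 0 <= K -> (forall x, 0 <= psi x) ->
  (forall x, P x -> exists l, [/\ (0 < l <= L)%N, P (iter l T x) &
     g l x <= bsum T psi l x]) ->
  forall n x, P x -> g n x <= bsum T psi n x + K * L.+1%:R.
Proof.
move=> sub gK K0 psi0 step; elim/ltn_ind => n IH x Px.
have [nL|Ln] := leqP n L.
  rewrite (le_trans (gK n x))// -[leLHS]add0r lerD ?bsum_ge0//.
  by rewrite ler_wpM2l// ler_nat.
have [l [/andP[l0 lL] Pl gl]] := step x Px.
have -> : n = (l + (n - l))%N by lia.
rewrite bsumD -addrA (le_trans (sub _ _ _))// lerD//.
by apply: IH => //; lia.
Qed.

Variable mu : probability Om R.

(** Turns a threshold that depends on the point into a common one, outside a set of small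
    measure. *)
Lemma ae_increasing_cover (G : nat -> set Om) (k : R) :
  (forall n, measurable (G n)) -> (forall n m, (n <= m)%N -> G n `<=` G m) ->
  (\forall x \ae mu, exists n, G n x) -> 0 < k ->
  exists N, forall n, (N <= n)%N -> fine (mu (~` G n)) < k.
Proof.
move=> mG inc cov k0.
pose F n := ~` G n.
have mF n : measurable (F n) by exact: measurableC.
have mcapF : measurable (\bigcap_n F n) by exact: bigcapT_measurable.
have F0 : mu (\bigcap_n F n) = 0%E.
  apply/negligibleP => //; apply: negligibleS cov => x Fx /= [n Gn].
  exact: (Fx n I).
have niF : nonincreasing_seq F.
  by move=> n m nm; apply/subsetPset; apply: subsetC; exact: inc.
have F0y : (mu (F 0%N) < +oo)%E.
  by rewrite (le_lt_trans (probability_le1 _ _))// ltry.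
have : mu \o F @ \oo --> 0%:E.
  by rewrite -[X in _ --> X]F0; exact: nonincreasing_cvg_mu F0y mF mcapF niF.
move=> /fine_cvgP[_ /cvgr0Pnorm_lt /(_ k k0) [N _ hN]].
exists N => n Nn; have := hN n Nn; apply: le_lt_trans.
by rewrite /= ler_norm.
Qed.

(** The bound has [n.+1] rather than n because g 0 need not vanish: for [lnN] it is ln 2. *)
Definition subadd_process T (K : R) g :=
  [/\ forall n, measurable_fun setT (g n),
      forall n m x, g (n + m)%N x <= g n x + g m (iter n T x) &
      forall n x, `|g n x| <= K * n.+1%:R].

Lemma subadd_bmf T K g n : subadd_process T K g -> bmf (g n).
Proof. by move=> [mg _ gK]; split => //; exists (K * n.+1%:R). Qed.

Lemma bsum_bmf T Tinv psi n : ergodic_aut mu T Tinv -> bmf psi ->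
  bmf (bsum T psi n).
Proof.
move=> [_ mT _ _ _] bpsi; apply: (bmf_sum (f := fun i x => psi (iter i T x))).
by move=> i; apply: bmf_comp => //; exact: measurable_iter.
Qed.

Lemma avg_bsum T Tinv psi n : ergodic_aut mu T Tinv -> bmf psi ->
  avg mu (bsum T psi n) = n%:R * avg mu psi.
Proof.
move=> eT bpsi; rewrite /bsum (avg_sum mu (f := fun i x => psi (iter i T x))).
  under eq_bigr do rewrite (avg_iter _ eT)//.
  by rewrite sumr_const card_ord mulr_natl.
move=> i; apply: bmf_comp => //; apply: measurable_iter.
by case: eT.
Qed.

Lemma measurable_le_cst (f : Om -> R) (c : R) : measurable_fun setT f ->
  measurable [set x | f x <= c].
Proof.
move=> mf; rewrite -[X in measurable X]setTI.
rewrite (_ : [set x | f x <= c] = f @^-1` `]-oo, c]%classic); first exact: mf.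
by apply/seteqP; split => x /=; rewrite in_itv.
Qed.

Lemma natr_big (a b : R) : 0 < a -> exists2 n : nat, (0 < n)%N & b < a * n%:R.
Proof.
move=> a0; have := archi_boundP (normr_ge0 (b / a)).
set n := Num.bound _ => h; exists n.+1 => //.
rewrite mulrC -ltr_pdivrMr//; rewrite (le_lt_trans (ler_norm _))//.
by rewrite (lt_le_trans h)// ler_nat.
Qed.

(** If g n <= c n infinitely often on a set [D] of positive measure, almost every orbit enters [D],
    so almost every point starts a block with g l <= c1 l, where c < c1 < c'. Covering long orbit
    segments by such blocks of bounded length makes the average of g n smaller than c' n, a
    contradiction. *)
Lemma subadd_liminf T Tinv K g (c c' : R) :
  ergodic_aut mu T Tinv -> subadd_process T K g ->
  (forall n, (0 < n)%N -> c' * n%:R <= avg mu (g n)) -> c < c' ->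
  \forall x \ae mu, exists N, forall n, (N <= n)%N -> c * n%:R < g n x.
Proof.
move=> eT sg lo cc'; have [mg sub gK] := sg.
have mT : measurable_fun setT T by case: eT.
have K0 : 0 <= K.
  by have := le_trans (normr_ge0 _) (gK 0%N point); rewrite mulr1.
pose D := \bigcap_N \bigcup_(n in [set n | (N <= n)%N]) [set x | g n x <= c * n%:R].
have mD : measurable D.
  apply: bigcapT_measurable => N; apply: bigcup_measurable => n _.
  exact: measurable_le_cst.
have [D0|D0] := eqVneq (mu D) 0%E.
  exists D; split => // x /= /forallNP nx N _ /=.
  have /existsNP[n /not_implyP[Nn /negP]] := nx N.
  by rewrite -leNgt => h; exists n.
exfalso.
pose c1 := (c + c') / 2.
have c1c' : c1 < c' by rewrite /c1; lra.
have cc1 : c < c1 by rewrite /c1; lra.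
pose G L := \bigcup_(l in [set l | (0 < l <= L)%N]) [set x | g l x <= c1 * l%:R].
have mG L : measurable (G L).
  by apply: bigcup_measurable => n _; exact: measurable_le_cst.
have incG n m : (n <= m)%N -> G n `<=` G m.
  move=> nm x [l /= /andP[l0 ln] gl]; exists l => //=.
  by rewrite l0 (leq_trans ln).
have covG : \forall x \ae mu, exists n, G n x.
  apply: filterS (recurrence eT mD D0) => x /(_ 0%N) [j _ Dj].
  have [N N0 hN] : exists2 N, (0 < N)%N & (K * j.+1%:R) + c * 0 - c1 * j%:R < (c1 - c) * N%:R.
    by apply: natr_big; lra.
  have [//|n /= Nn gn] := Dj N.
  exists (j + n)%N, (j + n)%N => /=; first by apply/andP; split; lia.
  rewrite (le_trans (sub _ _ _))// natrD.
  have := le_trans (ler_norm _) (gK j x).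
  have : (c1 - c) * N%:R <= (c1 - c) * n%:R.
    by rewrite ler_wpM2l ?ler_nat// subr_ge0 ltW.
  lra.
pose K' := K + `|c1| + 1.
have K'0 : 0 < K' by rewrite /K'; have := normr_ge0 c1; lra.
(* Points outside [G L] cost 2K' each, so this k makes their total share half of the gap c' - c1;
   the other half absorbs the last incomplete block. *)
pose k := (c' - c1) / (4 * K').
have k0 : 0 < k by rewrite divr_gt0//; lra.
have [L0 hL] := ae_increasing_cover mG incG covG k0.
have {}hL := hL L0.+1 (leqnSn _); set L := L0.+1 in hL.
pose psi x := 2 * K' * (\1_(~` G L) x : R).
have bpsi : bmf psi by apply: bmfZ; apply: bmf_indic; exact: measurableC.
pose g' n x := g n x - c1 * n%:R.
have g'K n x : g' n x <= K' * n.+1%:R.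
  rewrite /g'; have := le_trans (ler_norm _) (gK n x).
  have : - c1 * n%:R <= `|c1| * n.+1%:R.
    rewrite (@le_trans _ _ (`|c1| * n%:R))//.
      by rewrite ler_wpM2r// -normrN ler_norm.
    by rewrite ler_wpM2l// ler_nat.
  rewrite /K' !mulrDl mul1r; have : 0 <= n.+1%:R :> R by [].
  move: (n.+1%:R) => a; lra.
have step n x : g' n x <= bsum T psi n x + K' * L.+1%:R.
  apply: (@cover_bound T g' K' psi setT L) => //.
  - move=> a b y; rewrite /g' natrD; have := sub a b y; lra.
  - exact: ltW.
  - by move=> y; rewrite /psi mulr_ge0// mulr_ge0// ltW.
  move=> y _; have [Gy|nGy] := pselect (G L y).
    case: Gy => l /= lL gl; exists l; split => //.
    apply: (@le_trans _ _ 0); first by rewrite /g' subr_le0.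
    by apply: bsum_ge0 => z; rewrite /psi mulr_ge0// mulr_ge0// ltW.
  exists 1%N; split => //; rewrite bsum1 /psi indicE mem_set//= mulr1 mulrC.
  exact: (g'K 1%N y).
have [n n0 hn] : exists2 n, (0 < n)%N & K' * L.+1%:R < (c' - c1) / 2 * n%:R.
  by apply: natr_big; rewrite divr_gt0// subr_gt0.
have bg := subadd_bmf n sg.
have : avg mu (g n) <= c1 * n%:R + K' * L.+1%:R + n%:R * (2 * K' * fine (mu (~` G L))).
  have -> : n%:R * (2 * K' * fine (mu (~` G L))) = avg mu (bsum T psi n).
    rewrite (avg_bsum _ eT)// avgZ ?avg_indic//; first exact: measurableC.
    by apply: bmf_indic; exact: measurableC.
  rewrite -(avg_cst mu (c1 * _ + _)) -avgD; last 2 first.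
  - exact: bmf_cst.
  - exact: bsum_bmf eT bpsi.
  apply: avg_le_ae => //.
    by apply: bmfD; [exact: bmf_cst|exact: bsum_bmf eT bpsi].
  by apply: aeW => x; have := step n x; rewrite /g'; lra.
apply/negP; rewrite -ltNge; apply: lt_le_trans (lo n n0).
have : n%:R * (2 * K' * fine (mu (~` G L))) <= n%:R * ((c' - c1) / 2).
  rewrite ler_wpM2l//.
  have -> : (c' - c1) / 2 = 2 * K' * k by rewrite /k; field; exact: lt0r_neq0.
  by rewrite ler_wpM2l ?ltW//; lra.
lra.
Qed.

(** The negated Birkhoff sums are additive, in particular subadditive, so the lower bound just
    proved becomes an upper bound. *)
Lemma birkhoff_limsup T Tinv psi (c : R) : ergodic_aut mu T Tinv -> bmf psi ->
  avg mu psi < c ->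
  \forall x \ae mu, exists N, forall n, (N <= n)%N -> bsum T psi n x < c * n%:R.
Proof.
move=> eT bpsi hc; have [mpsi [K psiK]] := bpsi.
have K0 : 0 <= K by exact: le_trans (normr_ge0 _) (psiK point).
have sg : subadd_process T K (fun n x => - bsum T psi n x).
  split.
  - by move=> n; apply: measurable_funN; have [] := bsum_bmf n eT bpsi.
  - by move=> n m x; rewrite bsumD opprD.
  - move=> n x; rewrite normrN (le_trans (ler_norm_sum _ _ _))//.
    rewrite (@le_trans _ _ (\sum_(i < n) K))//; first exact: ler_sum.
    by rewrite sumr_const card_ord -[K *+ n]mulr_natr ler_wpM2l// ler_nat.
have lo n : (0 < n)%N -> - avg mu psi * n%:R <= avg mu (fun x => - bsum T psi n x).
  move=> n0; have -> : (fun x => - bsum T psi n x) = (fun x => -1 * bsum T psi n x).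
    by apply/funext => x; rewrite mulN1r.
  rewrite avgZ; last exact: bsum_bmf eT bpsi.
  by rewrite (avg_bsum _ eT)// mulN1r mulNr mulrC.
have := subadd_liminf eT sg lo (_ : - c < _); rewrite ltrN2 => /(_ hc).
apply: filterS => x [N hN]; exists N => n Nn; have := hN n Nn; lra.
Qed.

(** Averaging over the q possible starting phases of blocks of length q produces Birkhoff sums for T
    itself instead of T^q, which need not be ergodic. *)
Lemma subadd_blocks T K g q n x : subadd_process T K g ->
  q%:R * g (n + q)%N x <= bsum T (g q) n x + 2 * q%:R * (K * q.+1%:R).
Proof.
move=> [_ sub gK].
have K0 : 0 <= K.
  by have := le_trans (normr_ge0 _) (gK 0%N point); rewrite mulr1.
pose U n x := \sum_(j < q) g (n + q - j)%N (iter j T x).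
have U0 y : U 0%N y <= q%:R * (K * q.+1%:R).
  rewrite (@le_trans _ _ (\sum_(j < q) (K * q.+1%:R)))//.
    apply: ler_sum => j _; rewrite (le_trans (ler_norm _))// (le_trans (gK _ _))//.
    by rewrite ler_wpM2l// ler_nat; lia.
  by rewrite sumr_const card_ord mulr_natl.
(* The terms of [U m.+1 y] with j > 0 are the first q - 1 terms of [U m (T y)]. The term j = 0
   splits off [g q y] and leaves the last term of [U m (T y)]. *)
have US m y : U m.+1 y <= g q y + U m (T y).
  rewrite /U; case: (posnP q) => [->|q0].
    rewrite !big_ord0 addr0.
    by have := sub 0%N 0%N y; rewrite /= addn0; lra.
  have -> : q = q.-1.+1 by lia.
  rewrite big_ord_recl [in leRHS]big_ord_recr /= subn0.
  have -> : \sum_(i < q.-1) g (m.+1 + q.-1.+1 - bump 0 i)%N (T (iter i T y)) =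
      \sum_(i < q.-1) g (m + q.-1.+1 - i)%N (iter i T (T y)).
    apply: eq_bigr => i _; rewrite -iterS iterSr; congr (g _ _).
  rewrite [leRHS]addrCA [leLHS]addrC lerD2l.
  have := sub q.-1.+1 m.+1 y.
  have -> : (q.-1.+1 + m.+1 = m.+1 + q.-1.+1)%N by lia.
  rewrite iterSr.
  by have -> : (m + q.-1.+1 - q.-1 = m.+1)%N by lia.
have Un m y : U m y <= bsum T (g q) m y + q%:R * (K * q.+1%:R).
  elim: m y => [|m IH] y; first by rewrite /bsum big_ord0 add0r.
  rewrite -addn1 addnC bsumD bsum1 /= (le_trans (US m y))// -addrA lerD2l.
  exact: IH.
have gU : q%:R * g (n + q)%N x <= U n x + q%:R * (K * q.+1%:R).
  rewrite mulr_natl -(card_ord q) -sumr_const /= card_ord.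
  have -> : q%:R * (K * q.+1%:R) = \sum_(j < q) (K * q.+1%:R).
    by rewrite sumr_const card_ord mulr_natl.
  rewrite -big_split /=; apply: ler_sum => j _.
  have := sub j (n + q - j)%N x; have -> : (j + (n + q - j) = n + q)%N.
    by have := ltn_ord j; lia.
  have := le_trans (ler_norm _) (gK j x).
  have : K * j.+1%:R <= K * q.+1%:R.
    by rewrite ler_wpM2l// ler_nat; have := ltn_ord j; lia.
  lra.
have := Un n x; lra.
Qed.

Lemma subadd_limsup T Tinv K g q (c : R) :
  ergodic_aut mu T Tinv -> subadd_process T K g -> (0 < q)%N ->
  avg mu (g q) < c * q%:R ->
  \forall x \ae mu, exists N, forall n, (N <= n)%N -> g n x <= c * n%:R.
Proof.
move=> eT sg q0 hq; have [mg sub gK] := sg.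
have bg := subadd_bmf q sg.
pose c1 := (avg mu (g q) + c * q%:R) / 2.
have h1 : avg mu (g q) < c1 by rewrite /c1; lra.
have h2 : c1 < c * q%:R by rewrite /c1; lra.
apply: filterS (birkhoff_limsup eT bg h1) => x [N hN].
have [M M0 hM] : exists2 M, (0 < M)%N &
    `|c1| * q%:R + 2 * q%:R * (K * q.+1%:R) < (c * q%:R - c1) * M%:R.
  by apply: natr_big; rewrite subr_gt0.
exists (N + q + M)%N => n Nn.
rewrite -(ler_pM2l (_ : 0 < q%:R)) ?ltr0n//.
have -> : n = (n - q + q)%N by lia.
rewrite (le_trans (subadd_blocks q _ _ sg))//.
have := hN (n - q)%N; have -> : (N <= n - q)%N by lia.
move=> /(_ isT) h.
have e : n%:R = (n - q)%:R + q%:R :> R by rewrite -natrD; congr (_%:R); lia.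
have -> : (n - q + q)%:R = n%:R :> R by congr (_%:R); lia.
have h3 : (c * q%:R - c1) * M%:R <= (c * q%:R - c1) * n%:R.
  by apply: ler_wpM2l; [rewrite subr_ge0 ltW|rewrite ler_nat; lia].
have h4 : - c1 * q%:R <= `|c1| * q%:R by rewrite ler_wpM2r// -normrN ler_norm.
have h5 : c1 * n%:R = c1 * (n - q)%:R + c1 * q%:R by rewrite e mulrDr.
have h6 : (c * q%:R - c1) * n%:R = q%:R * (c * n%:R) - c1 * n%:R by ring.
lra.
Qed.

Definition rate g : R := inf [set avg mu (g n) / n%:R | n in [set n | (0 < n)%N]].

Section rate.
Variables (T Tinv : Om -> Om) (K : R) (g : nat -> Om -> R).
Hypotheses (eT : ergodic_aut mu T Tinv) (sg : subadd_process T K g).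

Lemma rate_has_inf :
  has_inf [set avg mu (g n) / n%:R | n in [set n | (0 < n)%N]].
Proof.
split; first by exists (avg mu (g 1%N) / 1%:R), 1%N.
exists (- (2 * K)) => _ [n /= n0 <-].
have [mg sub gK] := sg.
have K0 : 0 <= K.
  by have := le_trans (normr_ge0 _) (gK 0%N point); rewrite mulr1.
rewrite ler_pdivlMr ?ltr0n//.
have : avg mu (fun=> - (K * n.+1%:R)) <= avg mu (g n).
  apply: avg_le_ae; [exact: bmf_cst|exact: subadd_bmf sg|].
  by apply: aeW => x; have := gK n x; rewrite ler_norml => /andP[].
rewrite avg_cst; apply: le_trans.
rewrite mulNr lerN2 (_ : 2 * K * n%:R = K * (2 * n%:R)); last by ring.
by rewrite ler_wpM2l// -natrM ler_nat; lia.
Qed.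

Lemma rate_le n : rate g * n%:R <= avg mu (g n).
Proof.
have [->|n0] := posnP n.
  rewrite mulr0; have [mg sub gK] := sg.
  have : avg mu (fun=> 0) <= avg mu (g 0%N).
    apply: avg_le_ae; [exact: bmf_cst|exact: subadd_bmf sg|].
    by apply: aeW => x; have := sub 0%N 0%N x; rewrite /= addn0; lra.
  by rewrite avg_cst.
rewrite -ler_pdivlMr ?ltr0n//; apply: ge_inf; last by exists n.
by case: rate_has_inf.
Qed.

Lemma rate_lt c : rate g < c -> exists2 n, (0 < n)%N & avg mu (g n) < c * n%:R.
Proof.
rewrite -subr_gt0 => c0.
have [_ [n /= n0 <-]] := inf_adherent c0 rate_has_inf.
by rewrite addrC subrK ltr_pdivrMr ?ltr0n// => h; exists n.
Qed.

Lemma rate_limsup c : rate g < c ->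
  \forall x \ae mu, exists N, forall n, (N <= n)%N -> g n x <= c * n%:R.
Proof. by move=> /rate_lt[q q0]; exact: (subadd_limsup eT sg q0). Qed.

Lemma rate_liminf c : c < rate g ->
  \forall x \ae mu, exists N, forall n, (N <= n)%N -> c * n%:R < g n x.
Proof. by apply: (subadd_liminf eT sg) => n _; exact: rate_le. Qed.

Theorem kingman : \forall x \ae mu, forall e : R, 0 < e ->
  exists N, forall n, (N <= n)%N ->
    (rate g - e) * n%:R <= g n x <= (rate g + e) * n%:R.
Proof.
have : \forall x \ae mu, forall k : nat, exists N, forall n, (N <= n)%N ->
    (rate g - k.+1%:R^-1) * n%:R <= g n x <= (rate g + k.+1%:R^-1) * n%:R.
  apply: ae_foralln => k.
  have k0 : 0 < k.+1%:R^-1 :> R by rewrite invr_gt0.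
  have h1 : rate g - k.+1%:R^-1 < rate g by rewrite ltrBlDr ltrDl.
  have h2 : rate g < rate g + k.+1%:R^-1 by rewrite ltrDl.
  apply: filterS2 (rate_limsup h2) (rate_liminf h1) => x [N hN] [M hM].
  exists (N + M)%N => n nn; rewrite hN ?(ltW (hM _ _))//; lia.
apply: filterS => x hx e e0.
have [k k0 hk] := natr_big 1 e0.
have {hx}[N hN] := hx k; exists N => n Nn; have /andP[h1 h2] := hN n Nn.
have : k.+1%:R^-1 * n%:R <= e * n%:R.
  rewrite ler_wpM2r// -[leLHS]mulr1 ler_pdivrMl ?ltr0n// mulrC.
  by rewrite (le_trans (ltW hk))// ler_wpM2l ?ler_nat// ltW.
by move: (k.+1%:R^-1) (n%:R) h1 h2 => a b *; apply/andP; split; nra.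
Qed.

End rate.
End Subadditive.

(** * Singular directions in SL(2,R) *)

Section SL2.
Context {R : realType}.
Implicit Types (A B M : 'M[R]_2) (v w : R * R).

Definition nsq M : R := M 0 0 ^+ 2 + M 0 1 ^+ 2 + M 1 0 ^+ 2 + M 1 1 ^+ 2.
Definition det22 M : R := M 0 0 * M 1 1 - M 0 1 * M 1 0.
(** Vectors are pairs, so that identities of plane geometry become polynomial identities in the
    coordinates. *)
Definition mv M v : R * R := (M 0 0 * v.1 + M 0 1 * v.2, M 1 0 * v.1 + M 1 1 * v.2).
Definition wedge v w : R := v.1 * w.2 - v.2 * w.1.
Definition dot v w : R := v.1 * w.1 + v.2 * w.2.
Definition mx22 (a b c e : R) : 'M[R]_2 :=
  \matrix_(i, j) if i == 0 then (if j == 0 then a else b)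
                 else (if j == 0 then c else e).
Definition adj2 M : 'M[R]_2 := mx22 (M 1 1) (- M 0 1) (- M 1 0) (M 0 0).

Lemma mulmx2 A B i j : (A *m B) i j = A i 0 * B 0 j + A i 1 * B 1 j.
Proof.
rewrite mxE big_ord_recl big_ord1; congr (_ * _ + A i _ * B _ j); exact/val_inj.
Qed.

Lemma scalar22 i j : (1%:M : 'M[R]_2) i j = (i == j)%:R.
Proof. by rewrite mxE. Qed.

Lemma ord2P (P : 'I_2 -> Prop) : P 0 -> P 1 -> forall i, P i.
Proof.
move=> P0 P1 [[|[|//]] hi].
- by rewrite (_ : Ordinal hi = 0)//; exact/val_inj.
- by rewrite (_ : Ordinal hi = 1)//; exact/val_inj.
Qed.

Lemma mx22_eq A B : A 0 0 = B 0 0 -> A 0 1 = B 0 1 -> A 1 0 = B 1 0 ->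
  A 1 1 = B 1 1 -> A = B.
Proof. by move=> *; apply/matrixP; apply: ord2P; apply: ord2P. Qed.

Lemma mx22E a b c e : [/\ mx22 a b c e 0 0 = a, mx22 a b c e 0 1 = b,
  mx22 a b c e 1 0 = c & mx22 a b c e 1 1 = e].
Proof. by rewrite /mx22 !mxE. Qed.

Lemma adj2E M : (adj2 M 0 0 = M 1 1) * (adj2 M 0 1 = - M 0 1) *
  (adj2 M 1 0 = - M 1 0) * (adj2 M 1 1 = M 0 0).
Proof. by rewrite /adj2 /mx22 !mxE. Qed.

Lemma det22E M : \det M = det22 M.
Proof.
rewrite (expand_det_row M 0) big_ord_recl big_ord1 /cofactor.
rewrite !det_mx11 !mxE /= expr0 expr1 mul1r /det22.
have e1 (i : 'I_1) : lift (0 : 'I_2) i = 1 by apply/val_inj; rewrite ord1.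
have e2 (i : 'I_1) : lift (1 : 'I_2) i = 0 by apply/val_inj; rewrite ord1.
by rewrite !e1 !e2; ring.
Qed.

Lemma nsq_mulmx A B : nsq (A *m B) <= nsq A * nsq B.
Proof.
rewrite /nsq !mulmx2 -subr_ge0.
set a := A 0 0; set b := A 0 1; set c := A 1 0; set e := A 1 1.
set a' := B 0 0; set b' := B 0 1; set c' := B 1 0; set e' := B 1 1.
have -> : (a ^+ 2 + b ^+ 2 + c ^+ 2 + e ^+ 2) * (a' ^+ 2 + b' ^+ 2 + c' ^+ 2 + e' ^+ 2) -
  ((a * a' + b * c') ^+ 2 + (a * b' + b * e') ^+ 2 + (c * a' + e * c') ^+ 2 + (c * b' + e * e') ^+ 2)
  = (a * c' - b * a') ^+ 2 + (a * e' - b * b') ^+ 2 + (c * c' - e * a') ^+ 2 + (c * e' - e * b') ^+ 2.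
  by ring.
by rewrite !addr_ge0// sqr_ge0.
Qed.

Lemma nsq_ge0 A : 0 <= nsq A.
Proof. by rewrite !addr_ge0// sqr_ge0. Qed.

Lemma nsq_ge2 A : \det A = 1 -> 2 <= nsq A.
Proof.
rewrite det22E /det22 /nsq.
have := sqr_ge0 (A 0 0 - A 1 1); have := sqr_ge0 (A 0 1 + A 1 0).
move: (A 0 0) (A 0 1) (A 1 0) (A 1 1) => a b c e; nra.
Qed.

Lemma nsq_adj2 A : nsq (adj2 A) = nsq A.
Proof. by rewrite /nsq !adj2E; ring. Qed.

Lemma det_adj2 A : \det (adj2 A) = \det A.
Proof. by rewrite !det22E /det22 !adj2E; ring. Qed.

Lemma adj2_mul A B : adj2 (A *m B) = adj2 B *m adj2 A.
Proof. by apply: mx22_eq; rewrite !(mulmx2, adj2E); ring. Qed.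

Lemma adj2_1 : adj2 1%:M = 1%:M.
Proof. by apply: mx22_eq; rewrite !adj2E !scalar22 ?oppr0. Qed.

Lemma mul_adj2 A : \det A = 1 -> adj2 A *m A = 1%:M.
Proof.
rewrite det22E /det22 => h.
by apply: mx22_eq; rewrite !mulmx2 !adj2E !scalar22 /= -?h; ring.
Qed.

Lemma invmx_adj2 A : \det A = 1 -> invmx A = adj2 A.
Proof.
move=> dA; have uA : A \in unitmx by rewrite unitmxE dA unitr1.
by rewrite -[LHS]mul1mx -(mul_adj2 dA) -mulmxA mulmxV// mulmx1.
Qed.

Lemma mv_mul A B v : mv (A *m B) v = mv A (mv B v).
Proof. by rewrite /mv !mulmx2 /=; congr (_, _); ring. Qed.

Lemma mv1 v : mv 1%:M v = v.
Proof. by case: v => a b; rewrite /mv !scalar22 /=; congr (_, _); ring. Qed.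

Lemma wedge_mv A v w : wedge (mv A v) (mv A w) = \det A * wedge v w.
Proof. by rewrite det22E /det22 /wedge /mv /=; ring. Qed.

Lemma dot_ge0 v : 0 <= dot v v.
Proof. by rewrite /dot -!expr2 addr_ge0// sqr_ge0. Qed.

Lemma cauchy_schwarz v w : dot v w ^+ 2 + wedge v w ^+ 2 = dot v v * dot w w.
Proof. by rewrite /dot /wedge; ring. Qed.

Lemma mv_le A v : dot (mv A v) (mv A v) <= nsq A * dot v v.
Proof.
rewrite -subr_ge0 /dot /mv /nsq /=.
have -> : forall a b c e x y : R, (a ^+ 2 + b ^+ 2 + c ^+ 2 + e ^+ 2) * (x * x + y * y) -
  ((a * x + b * y) * (a * x + b * y) + (c * x + e * y) * (c * x + e * y)) =
  (a * y - b * x) ^+ 2 + (c * y - e * x) ^+ 2 by move=> *; ring.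
by rewrite addr_ge0// sqr_ge0.
Qed.

Lemma mvZ A (c : R) v : mv A (c * v.1, c * v.2) = (c * (mv A v).1, c * (mv A v).2).
Proof. by rewrite /mv /=; congr (_, _); ring. Qed.

Lemma dotZ (c : R) v : dot (c * v.1, c * v.2) (c * v.1, c * v.2) = c ^+ 2 * dot v v.
Proof. by rewrite /dot /=; ring. Qed.

(* For large M, the point p = (bloch1 M, bloch2 M) of the unit disc is close to the
   point (cos 2a, sin 2a) of the circle, a being the angle of the most contracted
   direction of M; [bloch_dir] recovers the direction from p. *)
Definition bloch1 M : R :=
  (M 0 1 ^+ 2 + M 1 1 ^+ 2 - M 0 0 ^+ 2 - M 1 0 ^+ 2) / nsq M.
Definition bloch2 M : R := - 2 * (M 0 0 * M 0 1 + M 1 0 * M 1 1) / nsq M.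

Definition bloch_dir (p1 p2 : R) : R * R :=
  (Num.sqrt ((1 + p1) / 2), (if p2 < 0 then -1 else 1) * Num.sqrt ((1 - p1) / 2)).

(** If M^T M has eigenvalues a and 1/a, then nsq M = a + 1/a and the point has length (a - 1/a)/(a +
    1/a). *)
Lemma bloch_sq M : \det M = 1 ->
  bloch1 M ^+ 2 + bloch2 M ^+ 2 = 1 - 4 / nsq M ^+ 2.
Proof.
move=> dM; have n0 : nsq M != 0 by rewrite gt_eqF// (lt_le_trans _ (nsq_ge2 dM)).
have : det22 M = 1 by rewrite -det22E.
rewrite /bloch1 /bloch2 => d1.
have -> : 1 - 4 / nsq M ^+ 2 = (nsq M ^+ 2 - 4 * det22 M ^+ 2) / nsq M ^+ 2.
  by rewrite d1; field.
rewrite !expr_div_n -mulrDl; congr (_ / _).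
by rewrite /nsq /det22; ring.
Qed.

(** With S = M^T M and S' = (BM)^T (BM), the two points have inner product 1 - 2 tr(adj(S) S') / (tr
    S tr S'), and tr(adj(S) S') = tr(S^{-1} S') = nsq B because det M = 1. Both points lie in the
    unit disc, which bounds their distance. Exponential growth of the norms therefore makes the
    displacements summable. *)
Lemma bloch_step M B : \det M = 1 -> \det B = 1 ->
  (bloch1 (B *m M) - bloch1 M) ^+ 2 + (bloch2 (B *m M) - bloch2 M) ^+ 2
  <= 4 * nsq B / (nsq M * nsq (B *m M)).
Proof.
move=> dM dB; have dBM : \det (B *m M) = 1 by rewrite det_mulmx dM dB mulr1.
have n0 : nsq M != 0 by rewrite gt_eqF// (lt_le_trans _ (nsq_ge2 dM)).
have n1 : nsq (B *m M) != 0 by rewrite gt_eqF// (lt_le_trans _ (nsq_ge2 dBM)).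
have key : bloch1 (B *m M) * bloch1 M + bloch2 (B *m M) * bloch2 M =
    1 - 2 * nsq B / (nsq M * nsq (B *m M)).
  have d1 : det22 M = 1 by rewrite -det22E.
  have -> : 1 - 2 * nsq B / (nsq M * nsq (B *m M)) =
      (nsq M * nsq (B *m M) - 2 * nsq B * det22 M ^+ 2) / (nsq M * nsq (B *m M)).
    by rewrite d1; field; rewrite n0 n1.
  rewrite /bloch1 /bloch2 !mulf_div [nsq (B *m M) * _]mulrC -mulrDl; congr (_ / _).
  rewrite /nsq /det22 !mulmx2; ring.
have h1 := bloch_sq dM; have h2 := bloch_sq dBM.
have p1 : 0 <= 4 / nsq M ^+ 2 by rewrite divr_ge0// sqr_ge0.
have p2 : 0 <= 4 / nsq (B *m M) ^+ 2 by rewrite divr_ge0// sqr_ge0.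
have -> : 4 * nsq B / (nsq M * nsq (B *m M)) = 2 * (2 * nsq B / (nsq M * nsq (B *m M))).
  by ring.
move: key h1 h2 p1 p2.
move: (4 / _) (4 / _) (2 * nsq B / _) (bloch1 _) (bloch1 _) (bloch2 _) (bloch2 _).
move=> a b c e f g h; nra.
Qed.

(** These are the half-angle formulas: the direction has half the angle of p, with nonnegative first
    coordinate. *)
Lemma bloch_dirP (p1 p2 : R) : p1 ^+ 2 + p2 ^+ 2 = 1 ->
  let s := bloch_dir p1 p2 in
  [/\ s.1 ^+ 2 = (1 + p1) / 2, s.2 ^+ 2 = (1 - p1) / 2 & 2 * s.1 * s.2 = p2].
Proof.
move=> h /=.
have b : -1 <= p1 <= 1.
  rewrite -ler_norml -(@ler_pXn2r _ 2)// ?nnegrE// expr1n real_normK ?num_real//.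
  by rewrite -h lerDl sqr_ge0.
have [h1 h2] : 0 <= (1 + p1) / 2 /\ 0 <= (1 - p1) / 2 by split; lra.
split; first by rewrite sqr_sqrtr.
  by rewrite exprMn sqr_sqrtr//; case: ifP; rewrite ?sqrrN expr1n mul1r.
rewrite mulrCA -(mulrA 2) -sqrtrM//.
have -> : (1 + p1) / 2 * ((1 - p1) / 2) = (p2 / 2) ^+ 2.
  by rewrite expr_div_n (_ : p2 ^+ 2 = 1 - p1 ^+ 2); [field|lra].
rewrite sqrtr_sqr normrM (ger0_norm (_ : 0 <= 2^-1))//.
have [p20|p20] := ltP p2 0; first by rewrite ltr0_norm//; field.
by rewrite ger0_norm//; field.
Qed.

Lemma bloch_dir_dot (p1 p2 : R) : p1 ^+ 2 + p2 ^+ 2 = 1 ->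
  dot (bloch_dir p1 p2) (bloch_dir p1 p2) = 1.
Proof.
by move=> /bloch_dirP[h1 h2 _]; rewrite /dot -!expr2 h1 h2; field.
Qed.

(** For a unit vector s with doubled-angle point p, |Ms|^2 = nsq M (1 - b.p)/2, where b is the point
    of M. Then [bloch_sq] rewrites 1 - b.p through |b - p|^2. *)
Lemma mv_bloch_dir M (p1 p2 : R) : \det M = 1 -> p1 ^+ 2 + p2 ^+ 2 = 1 ->
  let s := bloch_dir p1 p2 in
  dot (mv M s) (mv M s) = nsq M / 4 * ((bloch1 M - p1) ^+ 2 + (bloch2 M - p2) ^+ 2) + (nsq M)^-1.
Proof.
move=> dM hp s; have [h1 h2 h3] := bloch_dirP hp.
have n0 : nsq M != 0 by rewrite gt_eqF// (lt_le_trans _ (nsq_ge2 dM)).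
have -> : dot (mv M s) (mv M s) = (M 0 0 ^+ 2 + M 1 0 ^+ 2) * s.1 ^+ 2 +
    (M 0 0 * M 0 1 + M 1 0 * M 1 1) * (2 * s.1 * s.2) +
    (M 0 1 ^+ 2 + M 1 1 ^+ 2) * s.2 ^+ 2 by rewrite /dot /mv /=; ring.
rewrite h1 h2 h3.
have -> : (bloch1 M - p1) ^+ 2 + (bloch2 M - p2) ^+ 2 =
    (bloch1 M ^+ 2 + bloch2 M ^+ 2) + (p1 ^+ 2 + p2 ^+ 2) - 2 * (bloch1 M * p1 + bloch2 M * p2) by ring.
rewrite hp bloch_sq// /bloch1 /bloch2.
set P1 := _ - M 1 0 ^+ 2; set P2 := -2 * _.
have -> : nsq M / 4 * (1 - 4 / nsq M ^+ 2 + 1 - 2 * (P1 / nsq M * p1 + P2 / nsq M * p2)) + (nsq M)^-1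
  = (nsq M - (P1 * p1 + P2 * p2)) / 2 by field.
by rewrite /P1 /P2 /nsq; field.
Qed.

(** [D] solves D - D r = C, so from rank N0 on u n - D r^n is nondecreasing and u n + D r^n is
    nonincreasing. The limit lies between them, which also gives the explicit rate. *)
Lemma geometric_cvg (u : nat -> R) (C r : R) N0 : 0 <= C -> 0 < r -> r < 1 ->
  (forall k, (N0 <= k)%N -> `|u k.+1 - u k| <= C * r ^+ k) ->
  exists l, u @ \oo --> l /\
    forall n, (N0 <= n)%N -> `|u n - l| <= C / (1 - r) * r ^+ n.
Proof.
move=> C0 r0 r1 hu.
pose D := C / (1 - r).
have r1' : 1 - r != 0 by rewrite subr_eq0 gt_eqF.
have D0 : 0 <= D by rewrite divr_ge0// subr_ge0 ltW.
have DE : C = D - D * r by rewrite /D; field.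
pose w n := u (n + N0)%N - D * r ^+ (n + N0).
pose v n := u (n + N0)%N + D * r ^+ (n + N0).
have st n : u (n + N0)%N - C * r ^+ (n + N0) <= u (n.+1 + N0)%N <= u (n + N0)%N + C * r ^+ (n + N0).
  have := hu (n + N0)%N (leq_addl _ _).
  by rewrite ler_distl addSn.
have ndw : nondecreasing_seq w.
  apply/nondecreasing_seqP => n; have /andP[h _] := st n.
  rewrite /w addSn exprS; move: h; rewrite addSn DE.
  by move: (r ^+ _) (u _) (u _) => x y z; lra.
have niv : nonincreasing_seq v.
  apply/nonincreasing_seqP => n; have /andP[_ h] := st n.
  rewrite /v addSn exprS; move: h; rewrite addSn DE.
  by move: (r ^+ _) (u _) (u _) => x y z; lra.
have wv n : w n <= v n.
  have : 0 <= D * r ^+ (n + N0) by rewrite mulr_ge0// exprn_ge0// ltW.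
  by rewrite /w /v; lra.
have wv2 n m : w n <= v m.
  have [nm|/ltnW mn] := leqP n m.
    by rewrite (le_trans (ndw _ _ nm)).
  by rewrite (le_trans (wv n))//; exact: niv.
have ubw : has_ubound (range w) by exists (v 0%N) => _ [n _ <-].
have hs : has_sup (range w) by split => //; exists (w 0%N), 0%N.
exists (sup (range w)).
have bd n : (N0 <= n)%N -> `|u n - sup (range w)| <= D * r ^+ n.
  move=> n0; have e : n = (n - N0 + N0)%N by rewrite subnK.
  have h1 : w (n - N0)%N <= sup (range w) by apply: ub_le_sup => //; exists (n - N0)%N.
  have h2 : sup (range w) <= v (n - N0)%N.
    by apply: ge_sup; [exists (w 0%N), 0%N|move=> _ [m _ <-]].
  rewrite ler_distl; move: h1 h2; rewrite /w /v -e.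
  by move=> *; apply/andP; split; lra.
split => //.
apply/cvgrPdist_le => e e0.
have r1n : `|r| < 1 by rewrite gtr0_norm.
have := cvg_geometric D r1n; rewrite /geometric /= => /cvgrPdist_le /(_ e e0) [M _ hM].
exists (M + N0)%N => // n /= nn; rewrite distrC (le_trans (bd n _))//; first by lia.
have := hM n; rewrite /= sub0r normrN => h.
by apply: le_trans (ler_norm _) (h _); rewrite /=; lia.
Qed.

(** Since nsq (M n) >= r^-n, [bloch_step] moves the point by at most 2k r^n at time n. The points
    converge geometrically to the circle, and [mv_bloch_dir] converts the distance to the limit into
    a bound on |M n s|^2. *)
Lemma contracted_direction (M B : nat -> 'M[R]_2) (k r : R) N0 :
  (forall n, M n.+1 = B n *m M n) -> (forall n, \det (M n) = 1) ->
  (forall n, \det (B n) = 1) -> (forall n, nsq (B n) <= k ^+ 2) -> 0 <= k ->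
  0 < r -> r < 1 ->
  (forall n, (N0 <= n)%N -> 1 <= nsq (M n) * r ^+ n) ->
  exists p1 p2 : R, [/\ bloch1 \o M @ \oo --> p1, bloch2 \o M @ \oo --> p2,
    p1 ^+ 2 + p2 ^+ 2 = 1 &
    let s := bloch_dir p1 p2 in
    forall n, (N0 <= n)%N -> dot (mv (M n) s) (mv (M n) s) <=
      (2 * k / (1 - r)) ^+ 2 * (nsq (M n) * (r ^+ n) ^+ 2) + r ^+ n].
Proof.
move=> MS dM dB Bk k0 r0 r1 lo.
have rn0 n : 0 < r ^+ n by exact: exprn_gt0.
have nM n : 0 < nsq (M n) by rewrite (lt_le_trans _ (nsq_ge2 (dM n))).
have step n : (N0 <= n)%N -> (bloch1 (M n.+1) - bloch1 (M n)) ^+ 2 +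
    (bloch2 (M n.+1) - bloch2 (M n)) ^+ 2 <= (2 * k * r ^+ n) ^+ 2.
  move=> Nn; rewrite MS (le_trans (bloch_step (dM n) (dB n)))//.
  rewrite -MS ler_pdivrMr ?mulr_gt0//.
  have h1 := lo n Nn; have h2 := lo n.+1 (leqW Nn).
  have h2' : 1 <= nsq (M n.+1) * r ^+ n.
    rewrite (le_trans h2)// ler_pM2l// exprS ler_piMl// ?ltW//.
  have := Bk n; have : 1 <= (nsq (M n) * r ^+ n) * (nsq (M n.+1) * r ^+ n).
    by rewrite -[leLHS]mulr1 ler_pM.
  have -> : (2 * k * r ^+ n) ^+ 2 * (nsq (M n) * nsq (M n.+1)) =
    4 * k ^+ 2 * ((nsq (M n) * r ^+ n) * (nsq (M n.+1) * r ^+ n)) by ring.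
  move: (_ * (nsq (M n.+1) * _)) => X X1 Bk'.
  rewrite (@le_trans _ _ (4 * k ^+ 2))//; first by rewrite ler_pM2l.
  by rewrite ler_peMr// mulr_ge0// sqr_ge0.
have coord (x y c : R) : 0 <= c -> x ^+ 2 + y ^+ 2 <= c ^+ 2 -> `|x| <= c /\ `|y| <= c.
  move=> c0 h; split; rewrite -(@ler_pXn2r _ 2)// ?nnegrE// real_normK ?num_real//.
    by rewrite (le_trans _ h)// lerDl sqr_ge0.
  by rewrite (le_trans _ h)// lerDr sqr_ge0.
have C0 : 0 <= 2 * k by rewrite mulr_ge0.
have s1 n : (N0 <= n)%N -> `|bloch1 (M n.+1) - bloch1 (M n)| <= 2 * k * r ^+ n.
  by move=> /step /coord h; apply: (h _).1; rewrite mulr_ge0// ltW.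
have s2 n : (N0 <= n)%N -> `|bloch2 (M n.+1) - bloch2 (M n)| <= 2 * k * r ^+ n.
  by move=> /step /coord h; apply: (h _).2; rewrite mulr_ge0// ltW.
have [p1 [cp1 bp1]] := geometric_cvg C0 r0 r1 (u := bloch1 \o M) s1.
have [p2 [cp2 bp2]] := geometric_cvg C0 r0 r1 (u := bloch2 \o M) s2.
have unit : p1 ^+ 2 + p2 ^+ 2 = 1.
  have c1 : (fun n => bloch1 (M n) ^+ 2 + bloch2 (M n) ^+ 2) @ \oo --> p1 ^+ 2 + p2 ^+ 2.
    by apply: cvgD; rewrite !expr2; apply: cvgM.
  apply: (cvg_unique _ c1) => //.
  apply/cvgrPdist_le => e e0.
  have r1n : `|r| < 1 by rewrite gtr0_norm.
  have := cvg_geometric 4 r1n; rewrite /geometric /= => /cvgrPdist_le /(_ e e0) [L _ hL].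
  exists (L + N0)%N => // n /= nn; rewrite bloch_sq// opprB addrC subrK.
  rewrite ger0_norm; last by rewrite divr_ge0// sqr_ge0.
  have := hL n; rewrite /= sub0r normrN => h.
  apply: le_trans (h _); last by rewrite /=; lia.
  rewrite ger0_norm ?mulr_ge0 ?(ltW (rn0 n))// ler_pM2l//.
  have h1 : 1 <= nsq (M n) * r ^+ n by apply: lo; lia.
  rewrite -[leLHS]mul1r ler_pdivrMr ?exprn_gt0//.
  have h2 := nsq_ge2 (dM n); rewrite expr2 mulrCA.
  rewrite -[leLHS]mul1r mulrC ler_pM//; first by rewrite (le_trans _ h2)// ler1n.
  by rewrite mulrC.
exists p1, p2; split => // s n Nn.
rewrite mv_bloch_dir// lerD//; last first.
  by rewrite -[leLHS]mul1r ler_pdivrMr// mulrC; exact: lo.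
have h1 := bp1 n Nn; have h2 := bp2 n Nn.
set D := 2 * k / (1 - r) in h1 h2 *.
have sq (x : R) : `|x| <= D * r ^+ n -> x ^+ 2 <= D ^+ 2 * (r ^+ n) ^+ 2.
  move=> h; rewrite -exprMn -real_normK ?num_real// ler_pXn2r// nnegrE//.
  exact: le_trans h.
have := sq _ h1; have := sq _ h2; rewrite /=.
have -> : D ^+ 2 * (nsq (M n) * (r ^+ n) ^+ 2) = nsq (M n) * (D ^+ 2 * (r ^+ n) ^+ 2) by ring.
have -> : nsq (M n) / 4 * ((bloch1 (M n) - p1) ^+ 2 + (bloch2 (M n) - p2) ^+ 2)
  = nsq (M n) * (((bloch1 (M n) - p1) ^+ 2 + (bloch2 (M n) - p2) ^+ 2) / 4) by field.
move=> a1 a2; rewrite ler_pM2l//; move: a1 a2.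
have : 0 <= D ^+ 2 * (r ^+ n) ^+ 2 by rewrite mulr_ge0// sqr_ge0.
lra.
Qed.

End SL2.

(** * Cocycles and their stable directions *)

Ltac mfun := repeat first
  [ assumption | solve [eauto 2] | exact: measurable_cst | apply: measurable_funD | apply: measurable_funB
  | apply: measurable_funM | apply: measurable_funX | apply: measurable_funN ].

Section Cocycle.
Context {R : realType} {d : measure_display} {Om : measurableType d}.
Implicit Types (A : Om -> 'M[R]_2) (T Tinv : Om -> Om) (s u : Om -> R * R).

Fixpoint cocyc A T (n : nat) (x : Om) : 'M[R]_2 :=
  match n with
  | 0 => 1%:M
  | k.+1 => A (iter k T x) *m cocyc A T k x
  end.

Definition mmat A := forall i j, measurable_fun setT (fun x => A x i j).

Definition mvec s := measurable_fun setT (fun x => (s x).1) /\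
  measurable_fun setT (fun x => (s x).2).

Definition slc (K : R) A :=
  [/\ mmat A, forall x, \det (A x) = 1 & forall x, nsq (A x) <= expR K].

Definition lnN A T (n : nat) (x : Om) : R := ln (nsq (cocyc A T n x)).

(** Generator over [Tinv] of the inverse cocycle: its n-th product at x is A^{-n}(x), the adjugate
    being the inverse in SL(2). *)
Definition invc A Tinv (x : Om) : 'M[R]_2 := adj2 (A (Tinv x)).

Lemma cocycD A T n m x :
  cocyc A T (n + m) x = cocyc A T m (iter n T x) *m cocyc A T n x.
Proof.
elim: m => [|m IH]; first by rewrite addn0 mul1mx.
by rewrite addnS /= IH mulmxA -iterD addnC.
Qed.

Lemma cocycSr A T n x : cocyc A T n.+1 x = cocyc A T n (T x) *m A x.
Proof. by rewrite -[n.+1]add1n cocycD /= mulmx1. Qed.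

Lemma det_cocyc A T n x : (forall x, \det (A x) = 1) -> \det (cocyc A T n x) = 1.
Proof.
move=> dA; elim: n => [|n IH] /=; first by rewrite det1.
by rewrite det_mulmx dA IH mulr1.
Qed.

Lemma mmat_mul (A B : Om -> 'M[R]_2) : mmat A -> mmat B ->
  mmat (fun x => A x *m B x).
Proof.
move=> mA mB i j; rewrite (_ : (fun x => _) = fun x => A x i 0 * B x 0 j + A x i 1 * B x 1 j).
  by mfun.
by apply/funext => x; rewrite mulmx2.
Qed.

Lemma mmat_comp A T : measurable_fun setT T -> mmat A -> mmat (A \o T).
Proof. by move=> mT mA i j; apply: (measurableT_comp (mA i j)). Qed.

Lemma mmat_cocyc A T n : measurable_fun setT T -> mmat A -> mmat (cocyc A T n).
Proof.
move=> mT mA; elim: n => [|n IH] /=; first by move=> i j; exact: measurable_cst.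
apply: mmat_mul => //; apply: (@mmat_comp A (iter n T)) => //.
exact: measurable_iter.
Qed.

Lemma measurable_nsq A : mmat A -> measurable_fun setT (fun x => nsq (A x)).
Proof. by move=> mA; rewrite /nsq; mfun. Qed.

Lemma mvec_mv A s : mmat A -> mvec s -> mvec (fun x => mv (A x) (s x)).
Proof. by move=> mA [s1 s2]; rewrite /mvec /mv /=; split; mfun. Qed.

Lemma measurable_wedge s u : mvec s -> mvec u ->
  measurable_fun setT (fun x => wedge (s x) (u x)).
Proof. by move=> [? ?] [? ?]; rewrite /wedge; mfun. Qed.

Lemma measurable_dot s u : mvec s -> mvec u ->
  measurable_fun setT (fun x => dot (s x) (u x)).
Proof. by move=> [? ?] [? ?]; rewrite /dot; mfun. Qed.

Lemma nsq_cocyc_gt0 A T n x : (forall x, \det (A x) = 1) -> 0 < nsq (cocyc A T n x).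
Proof. by move=> dA; rewrite (lt_le_trans _ (nsq_ge2 (det_cocyc _ _ _ dA))). Qed.

Lemma lnNK A T n x : (forall x, \det (A x) = 1) ->
  expR (lnN A T n x) = nsq (cocyc A T n x).
Proof. by move=> dA; rewrite lnK// posrE nsq_cocyc_gt0. Qed.

Lemma lnN_ge0 A T n x : (forall x, \det (A x) = 1) -> 0 <= lnN A T n x.
Proof.
move=> dA; apply: ln_ge0; have := nsq_ge2 (det_cocyc T n x dA); lra.
Qed.

Lemma nsq_cocyc_le K A T n x : slc K A -> nsq (cocyc A T n x) <= expR (K * n.+1%:R).
Proof.
move=> [_ dA AK].
have h : 2 <= expR K by rewrite (le_trans (nsq_ge2 (dA x))).
elim: n => [|n IH] /=.
  by rewrite mulr1 (le_trans _ h)// /nsq !scalar22 /=; lra.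
rewrite -natr1 mulrDr mulr1 expRD [leRHS]mulrC (le_trans (nsq_mulmx _ _))//.
by rewrite ler_pM// nsq_ge0.
Qed.

Lemma lnN_process K A T : measurable_fun setT T -> slc K A ->
  subadd_process T K (lnN A T).
Proof.
move=> mT sA; have [mA dA AK] := sA; split.
- move=> n; rewrite /lnN; apply: measurableT_comp; first exact: measurable_ln.
  by apply: measurable_nsq; exact: mmat_cocyc.
- move=> n m x; rewrite -ler_expR expRD !lnNK// cocycD mulrC.
  exact: nsq_mulmx.
- move=> n x; rewrite ger0_norm ?lnN_ge0// -ler_expR lnNK//.
  exact: nsq_cocyc_le.
Qed.

Lemma slc_invc K A Tinv : measurable_fun setT Tinv -> slc K A -> slc K (invc A Tinv).
Proof.
move=> mTi [mA dA AK]; split.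
- have mAT : mmat (A \o Tinv) by exact: mmat_comp.
  apply: ord2P; apply: ord2P.
  + by under eq_fun do rewrite /invc adj2E; exact: (mAT 1 1).
  + by under eq_fun do rewrite /invc adj2E; apply: measurable_funN; exact: (mAT 0 1).
  + by under eq_fun do rewrite /invc adj2E; apply: measurable_funN; exact: (mAT 1 0).
  + by under eq_fun do rewrite /invc adj2E; exact: (mAT 0 0).
- by move=> x; rewrite det_adj2.
- by move=> x; rewrite nsq_adj2.
Qed.

Lemma cocyc_invc A T Tinv n x : cancel T Tinv ->
  cocyc (invc A Tinv) Tinv n (iter n T x) = adj2 (cocyc A T n x).
Proof.
move=> TK; elim: n => [|n IH]; first by rewrite adj2_1.
by rewrite cocycSr /= /invc TK IH adj2_mul.
Qed.

Lemma iter_cancel T Tinv n : cancel T Tinv -> cancel (iter n T) (iter n Tinv).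
Proof. by move=> TK; elim: n => [//|n IH] x; rewrite iterSr iterS TK IH. Qed.

Lemma cocyc_invcK A T Tinv n x v : cancel T Tinv -> (forall x, \det (A x) = 1) ->
  mv (cocyc (invc A Tinv) Tinv n (iter n T x)) (mv (cocyc A T n x) v) = v.
Proof.
by move=> TK dA; rewrite cocyc_invc// -mv_mul mul_adj2 ?mv1// det_cocyc.
Qed.

Variable mu : probability Om R.

Lemma rate_invc K A T Tinv : ergodic_aut mu T Tinv -> slc K A ->
  rate mu (lnN (invc A Tinv) Tinv) = rate mu (lnN A T).
Proof.
move=> eT sA; have [[TK TiK] mT mTi _ _] := eT.
congr inf; apply/seteqP; split => _ [n /= n0 <-]; exists n => //; congr (_ / _).
  rewrite -(@avg_iter _ _ _ mu Tinv T n (lnN A T n) (ergodic_aut_sym eT)); last exact: subadd_bmf (lnN_process mT sA).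
  congr avg; apply/funext => x; rewrite /lnN.
  by rewrite -{2}[x](iter_cancel n TiK) cocyc_invc// nsq_adj2.
rewrite -(@avg_iter _ _ _ mu Tinv T n (lnN A T n) (ergodic_aut_sym eT)); last exact: subadd_bmf (lnN_process mT sA).
congr avg; apply/funext => x; rewrite /lnN.
by rewrite -{1}[x](iter_cancel n TiK) cocyc_invc// nsq_adj2.
Qed.

Lemma measurable_sign (f : Om -> R) : measurable_fun setT f ->
  measurable_fun setT (fun x => if f x < 0 then -1 else 1 : R).
Proof.
move=> mf; apply: measurable_fun_ifT => //.
by apply: measurable_fun_ltr.
Qed.

Lemma measurable_sqrt (f : Om -> R) : measurable_fun setT f ->
  measurable_fun setT (fun x => Num.sqrt (f x)).
Proof.
move=> mf; apply: (measurableT_comp _ mf); apply: continuous_measurable_fun.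
exact: sqrt_continuous.
Qed.

Lemma bloch_bound (M : 'M[R]_2) : \det M = 1 -> `|bloch1 M| <= 1 /\ `|bloch2 M| <= 1.
Proof.
move=> dM; have h := bloch_sq dM.
have h4 : 0 <= 4 / nsq M ^+ 2 by rewrite divr_ge0// sqr_ge0.
have s1 := sqr_ge0 (bloch1 M); have s2 := sqr_ge0 (bloch2 M).
split; rewrite -(@ler_pXn2r _ 2)// ?nnegrE// expr1n real_normK ?num_real//; lra.
Qed.

Lemma measurable_limsup01 (h : nat -> Om -> R) : (forall n x, `|h n x| <= 1) ->
  (forall n, measurable_fun setT (h n)) ->
  measurable_fun setT (fun x => limn_sup (h ^~ x)).
Proof.
move=> h1 mh; apply: measurable_fun_limn_sup => // x _.
  by exists 1 => _ [n _ <-]; rewrite (le_trans (ler_norm _)).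
by exists (-1) => _ [n _ <-]; have := h1 n x; rewrite ler_norml => /andP[].
Qed.

(** The upper limits exist and are measurable everywhere; almost everywhere, when the exponent is
    positive, they are limits. *)
Definition stable_dir A T (x : Om) : R * R :=
  bloch_dir (limn_sup (fun n => bloch1 (cocyc A T n x)))
            (limn_sup (fun n => bloch2 (cocyc A T n x))).

Lemma mvec_stable_dir A T : measurable_fun setT T -> mmat A ->
  (forall x, \det (A x) = 1) -> mvec (stable_dir A T).
Proof.
move=> mT mA dA.
(* The reciprocal is its sign times exp(- ln |f|), and 0 where f vanishes. *)
have mV (f : Om -> R) : measurable_fun setT f -> measurable_fun setT (fun x => (f x)^-1).
  move=> mf.
  rewrite (_ : (fun x => _) = (fun x => (if f x < 0 then -1 else 1) * (if 0 < `|f x| then expR (- ln `|f x|) else 0))).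
    apply: measurable_funM; first exact: measurable_sign.
    have mn : measurable_fun setT (fun x => `|f x|) by exact: measurableT_comp.
    apply: measurable_fun_ifT => //; first exact: measurable_fun_ltr.
    apply: measurableT_comp; first exact: measurable_expR.
    by apply: measurable_funN; apply: measurableT_comp; first exact: measurable_ln.
  apply/funext => x; rewrite normr_gt0; case: (eqVneq (f x) 0) => [->|f0] /=.
    by rewrite invr0 mulr0.
  rewrite expRN lnK ?posrE ?normr_gt0//.
  case: ltP => h; first by rewrite ltr0_norm// mulN1r -invrN opprK.
  by rewrite ger0_norm// mul1r.
have mM n := mmat_cocyc n mT mA.
have m1 : measurable_fun setT (fun x => limn_sup (fun n => bloch1 (cocyc A T n x))).
  apply: (measurable_limsup01 (h := fun n x => bloch1 (cocyc A T n x))).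
    by move=> n x; have [] := bloch_bound (det_cocyc T n x dA).
  move=> n; rewrite /bloch1; apply: measurable_funM; last exact/mV/measurable_nsq.
  by have := mM n; rewrite /mmat => ?; mfun.
have m2 : measurable_fun setT (fun x => limn_sup (fun n => bloch2 (cocyc A T n x))).
  apply: (measurable_limsup01 (h := fun n x => bloch2 (cocyc A T n x))).
    by move=> n x; have [] := bloch_bound (det_cocyc T n x dA).
  move=> n; rewrite /bloch2; apply: measurable_funM; last exact/mV/measurable_nsq.
  by have := mM n; rewrite /mmat => ?; mfun.
split; rewrite /stable_dir /bloch_dir /=.
  by apply: measurable_sqrt; mfun.
by apply: measurable_funM; [exact: measurable_sign|apply: measurable_sqrt; mfun].
Qed.

Lemma expR_absorb (C e : R) : 0 < e ->
  exists N, forall n, (N <= n)%N -> C <= expR (e * n%:R).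
Proof.
move=> e0; have [N N0 hN] := natr_big C e0; exists N => n Nn.
rewrite (le_trans _ (expR_ge1Dx _))//.
have : e * N%:R <= e * n%:R by rewrite ler_pM2l// ler_nat.
lra.
Qed.

Lemma stable_dir_contracts K A T Tinv : ergodic_aut mu T Tinv -> slc K A ->
  0 < rate mu (lnN A T) ->
  \forall x \ae mu, dot (stable_dir A T x) (stable_dir A T x) = 1 /\
    forall e : R, 0 < e -> exists N, forall n, (N <= n)%N ->
      dot (mv (cocyc A T n x) (stable_dir A T x)) (mv (cocyc A T n x) (stable_dir A T x))
      <= expR ((- rate mu (lnN A T) + e) * n%:R).
Proof.
move=> eT sA L0; set L := rate _ _ in L0 *; have [mA dA AK] := sA.
have mT : measurable_fun setT T by case: eT.
apply: filterS (kingman eT (lnN_process mT sA)) => x; rewrite -/L => kx.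
(* The restriction e < L keeps r = exp(-(L - e)) below 1. In the bound of [contracted_direction],
   nsq times r^{2n} is at most exp((-L + 3e)n), and one more e absorbs the constant; hence the
   factor 4. *)
suff main e : 0 < e -> e < L -> dot (stable_dir A T x) (stable_dir A T x) = 1 /\
    exists N, forall n, (N <= n)%N ->
      dot (mv (cocyc A T n x) (stable_dir A T x)) (mv (cocyc A T n x) (stable_dir A T x))
      <= expR ((- L + 4 * e) * n%:R).
  split; first by have [] := main (L / 2) _ _ => //; lra.
  move=> e e0; pose e' := Num.min (e / 4) (L / 2).
  have e'0 : 0 < e' by rewrite lt_min; apply/andP; split; lra.
  have e'L : e' < L by rewrite gt_min; apply/orP; right; lra.
  have e'e : 4 * e' <= e.
    have : e' <= e / 4 by rewrite ge_min lexx.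
    lra.
  have [_ [N hN]] := main e' e'0 e'L; exists N => n Nn.
  rewrite (le_trans (hN n Nn))// ler_expR ler_wpM2r//; lra.
move=> e0 eL.
have [N hN] := kx e e0.
pose r := expR (- (L - e)).
have r0 : 0 < r by exact: expR_gt0.
have r1 : r < 1 by rewrite /r expR_lt1; lra.
have rn n : r ^+ n = expR (- (L - e) * n%:R) by rewrite expRM_natr.
pose k := expR (K / 2).
have kk : k ^+ 2 = expR K by rewrite -expRM_natr; congr expR; field.
have lo n : (N <= n)%N -> 1 <= nsq (cocyc A T n x) * r ^+ n.
  move=> Nn; rewrite -lnNK// rn -expRD -[leLHS]expR0 ler_expR.
  have /andP[h _] := hN n Nn; lra.
have [p1 [p2 [c1 c2 p12]]] := @contracted_direction R (fun n => cocyc A T n x)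
  (fun n => A (iter n T x)) k r N (fun=> erefl) (fun n => det_cocyc T n x dA)
  (fun n => dA _) (fun n => le_trans (AK _) (eq_ind_r (fun z => _ <= z) (lexx _) kk))
  (expR_ge0 _) r0 r1 lo.
have -> : stable_dir A T x = bloch_dir p1 p2.
  rewrite /stable_dir; congr bloch_dir.
    exact: (cvg_limn_inf_sup c1).2.
  exact: (cvg_limn_inf_sup c2).2.
move=> bd; split; first exact: bloch_dir_dot.
set C := (2 * k / (1 - r)) ^+ 2 in bd.
have C0 : 0 <= C by exact: sqr_ge0.
have [N' hN'] := expR_absorb (C + 1) e0.
exists (N + N')%N => n nn; rewrite (le_trans (bd n _))//; first by lia.
rewrite rn -lnNK//.
have /andP[_ h] := hN n (leq_trans (leq_addr _ _) nn).
apply: (@le_trans _ _ ((C + 1) * expR ((- L + 3 * e) * n%:R))).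
  rewrite mulrDl mul1r lerD//.
    rewrite ler_wpM2l// -expRM_natr -expRD ler_expR; lra.
  by rewrite ler_expR ler_wpM2r//; lra.
have -> : (- L + 4 * e) * n%:R = e * n%:R + (- L + 3 * e) * n%:R by ring.
rewrite expRD ler_wpM2r ?expR_ge0//; apply: hN'; lia.
Qed.

End Cocycle.

(** * The Oseledets splitting *)

Section Splitting.
Context {R : realType} {d : measure_display} {Om : measurableType d}.
Variable mu : probability Om R.
Implicit Types (A : Om -> 'M[R]_2) (T Tinv : Om -> Om) (s u : Om -> R * R).

Lemma ae_and (P Q : Om -> Prop) : (\forall x \ae mu, P x) ->
  (\forall x \ae mu, Q x) -> \forall x \ae mu, P x /\ Q x.
Proof. by apply: filterS2. Qed.

Lemma parallel_unit (v w : R * R) : wedge v w = 0 -> dot w w = 1 ->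
  v = (dot v w * w.1, dot v w * w.2).
Proof.
move=> h1 h2; case: v w h1 h2 => [a b] [c e]; rewrite /wedge /dot /= => h1 h2.
congr (_, _).
  have -> : (a * c + b * e) * c = a * (c * c + e * e) - e * (a * e - b * c) by ring.
  by rewrite h1 h2; ring.
have -> : (a * c + b * e) * e = b * (c * c + e * e) + c * (a * e - b * c) by ring.
by rewrite h1 h2; ring.
Qed.

Lemma wedgeC (v w : R * R) : wedge v w = - wedge w v.
Proof. by rewrite /wedge; ring. Qed.

Lemma small_prod (a b : R) : 0 <= a -> a <= 4^-1 -> 0 <= b -> b <= 4^-1 ->
  b * a <> 1.
Proof. by move=> *; nra. Qed.

Lemma wedge_sq_le (v w : R * R) : wedge v w ^+ 2 <= dot v v * dot w w.
Proof. by rewrite -cauchy_schwarz lerDr sqr_ge0. Qed.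

Lemma fmu_leU (E F G : set Om) : measurable E -> measurable F -> measurable G ->
  (\forall x \ae mu, E x -> F x \/ G x) ->
  fine (mu E) <= fine (mu F) + fine (mu G).
Proof.
move=> mE mF mG h; rewrite -!avg_indic// -avgD; try exact: bmf_indic.
apply: avg_le_ae; first exact: bmf_indic.
  by apply: bmfD; exact: bmf_indic.
apply: filterS h => x; rewrite !indicE => h.
have [Ex|nEx] := pselect (E x); last by rewrite memNset// addr_ge0.
rewrite mem_set//; case: (h Ex) => [Fx|Gx].
  by rewrite (mem_set Fx) lerDl.
by rewrite (mem_set Gx) lerDr.
Qed.

Lemma fmu_gt0 (E : set Om) : measurable E -> mu E != 0%E -> 0 < fine (mu E).
Proof.
move=> mE E0; rewrite lt_def fine_ge0// andbT; apply: contra E0 => /eqP h.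
by rewrite -(fineK (fin_num_measure _ _ mE)) h.
Qed.

(** A^n(Tx) contracts both A(x)s(x) and s(Tx) exponentially. It preserves [wedge], so two
    independent vectors could not both be contracted. *)
Lemma stable_dir_invariant K A T Tinv : ergodic_aut mu T Tinv -> slc K A ->
  0 < rate mu (lnN A T) ->
  \forall x \ae mu, wedge (mv (A x) (stable_dir A T x)) (stable_dir A T (T x)) = 0.
Proof.
move=> eT sA L0; have [_ dA _] := sA.
have h := stable_dir_contracts eT sA L0.
have h1 := ae_iter 1 eT h.
apply: filterS2 h h1 => x [_ hx] [_ hTx].
set L := rate _ _ in L0 hx hTx; set w := wedge _ _.
apply: contrapT => /eqP w0.
have w2 : 0 < w ^+ 2 by rewrite exprn_even_gt0.
have L2 : 0 < L / 2 by rewrite divr_gt0.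
have [N hN] := hx _ L2; have [M hM] := hTx _ L2.
have [N' hN'] := expR_absorb (2 / w ^+ 2) L2.
pose n := (N + M + N')%N.
have e1 : w ^+ 2 <= expR ((- L + L / 2) * n.+1%:R) * expR ((- L + L / 2) * n%:R).
  have -> : w = wedge (mv (cocyc A T n (T x)) (mv (A x) (stable_dir A T x)))
                    (mv (cocyc A T n (T x)) (stable_dir A T (T x))).
    by rewrite wedge_mv det_cocyc// mul1r.
  rewrite (le_trans (wedge_sq_le _ _))// -mv_mul -cocycSr.
  by apply: ler_pM; rewrite ?dot_ge0 ?hN ?hM//; rewrite /n; lia.
have e2 : expR ((- L + L / 2) * n.+1%:R) * expR ((- L + L / 2) * n%:R) <= (expR (L / 2 * n%:R))^-1.
  rewrite -expRN -expRD ler_expR -[n.+1%:R]natr1.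
  have : 0 <= n%:R :> R by [].
  move: (n%:R) => z z0; have := mulr_ge0 (ltW L0) z0; lra.
have e3 : 2 / w ^+ 2 <= expR (L / 2 * n%:R) by apply: hN'; rewrite /n; lia.
have := le_trans e1 e2; apply/negP; rewrite -ltNge.
rewrite invf_plt ?posrE ?expR_gt0//; apply: lt_le_trans e3.
by rewrite -[ltLHS]mul1r ltr_pM2r ?invr_gt0// ltr1n.
Qed.

Definition inv_dir A T s x := forall n,
  dot (s (iter n T x)) (s (iter n T x)) = 1 /\
  wedge (mv (A (iter n T x)) (s (iter n T x))) (s (iter n.+1 T x)) = 0.

Lemma inv_dir_cocyc A T s x n : inv_dir A T s x ->
  exists k : R, mv (cocyc A T n x) (s x) = (k * (s (iter n T x)).1, k * (s (iter n T x)).2).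
Proof.
move=> h; elim: n => [|n [k IH]].
  by exists 1; rewrite mv1 !mul1r; case: (s x).
rewrite /= mv_mul IH mvZ.
have [_ w0] := h n; have [u1 _] := h n.+1.
rewrite (parallel_unit w0 u1) /=; eexists (k * _); congr (_, _); rewrite -mulrA; reflexivity.
Qed.

Definition contracts A T (L : R) s x := dot (s x) (s x) = 1 /\
  forall e : R, 0 < e -> exists N, forall n, (N <= n)%N ->
    dot (mv (cocyc A T n x) (s x)) (mv (cocyc A T n x) (s x)) <= expR ((- L + e) * n%:R).

(** On the set [D] where the lines coincide, A^N scales u(x) by a factor whose inverse is the
    scaling of u(T^N x) under A^{-N}. Outside two sets, each of measure less than half that of [D],
    both squared factors are at most 1/4, which is impossible. Invariance of the measure moves the
    second set from T^N x back to x. *)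
Lemma contracting_transverse K A T Tinv (L : R) s u : ergodic_aut mu T Tinv ->
  slc K A -> 0 < L -> mvec s -> mvec u ->
  (\forall x \ae mu, contracts A T L s x) ->
  (\forall x \ae mu, contracts (invc A Tinv) Tinv L u x) ->
  (\forall x \ae mu, wedge (mv (A x) (s x)) (s (T x)) = 0) ->
  (\forall x \ae mu, wedge (mv (A x) (u x)) (u (T x)) = 0) ->
  \forall x \ae mu, wedge (u x) (s x) != 0.
Proof.
move=> eT sA L0 ms mu_ hs hu sinv uinv.
have [[TK TiK] mT mTi _ _] := eT; have [mA dA _] := sA.
have eTi := ergodic_aut_sym eT.
have sAi := slc_invc mTi sA; have [mAi dAi _] := sAi.
pose D := [set x | `|wedge (u x) (s x)| <= 0].
have mD : measurable D.
  by apply: measurable_le_cst; apply: measurableT_comp => //; exact: measurable_wedge.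
have [D0|D0] := eqVneq (mu D) 0%E.
  exists D; split => // x /= /negP; rewrite negbK => /eqP h.
  by rewrite /D /= h normr0.
exfalso.
pose small (B : Om -> 'M[R]_2) (U : Om -> Om) v n := \bigcap_(m in [set m | (n <= m)%N])
  [set x : Om | dot (mv (cocyc B U m x) (v x)) (mv (cocyc B U m x) (v x)) <= (4 : R)^-1].
have msmall B U v n : measurable_fun setT U -> mmat B -> mvec v -> measurable (small B U v n).
  move=> mU mB mv'; apply: bigcap_measurable; first by exists n => /=.
  move=> m _.
  by apply: measurable_le_cst; apply: measurable_dot; apply: mvec_mv => //; exact: mmat_cocyc.
have incsmall B U v n m : (n <= m)%N -> small B U v n `<=` small B U v m.
  by move=> nm x h k /= mk; apply: h => /=; exact: leq_trans mk.
have covsmall B U v : (\forall x \ae mu, contracts B U L v x) ->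
    \forall x \ae mu, exists n, small B U v n x.
  apply: filterS => x [_ hx].
  have L2 : 0 < L / 2 by rewrite divr_gt0.
  have [N hN] := hx _ L2; have [N' hN'] := expR_absorb 4 L2.
  exists (N + N')%N => m /= nm; rewrite (le_trans (hN m _))//; first by lia.
  have -> : (- L + L / 2) * m%:R = - (L / 2 * m%:R) by field.
  by rewrite expRN lef_pV2 ?posrE ?expR_gt0// hN'//; lia.
pose k := fine (mu D) / 2.
have k0 : 0 < k by rewrite divr_gt0// fmu_gt0.
have [N1 h1] := ae_increasing_cover (fun n => msmall A T s n mT mA ms)
   (@incsmall A T s) (covsmall _ _ _ hs) k0.
have [N2 h2] := ae_increasing_cover (fun n => msmall _ Tinv u n mTi mAi mu_)
   (@incsmall (invc A Tinv) Tinv u) (covsmall _ _ _ hu) k0.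
pose N := maxn N1 N2.
have {}h1 := h1 N (leq_maxl _ _); have {}h2 := h2 N (leq_maxr _ _).
set F := ~` small A T s N in h1; set G := ~` small _ Tinv u N in h2.
have mF : measurable F by apply: measurableC; exact: msmall.
have mG : measurable G by apply: measurableC; exact: msmall.
have mG' : measurable (iter N T @^-1` G).
  by apply: measurable_preim => //; exact: measurable_iter.
have : fine (mu D) <= fine (mu F) + fine (mu (iter N T @^-1` G)).
  apply: fmu_leU => //.
  have ai : \forall x \ae mu, inv_dir A T s x /\ inv_dir A T u x.
    have a1 : \forall x \ae mu, forall n, dot (s (iter n T x)) (s (iter n T x)) = 1 /\
        wedge (mv (A (iter n T x)) (s (iter n T x))) (s (iter n.+1 T x)) = 0.
      apply: ae_foralln => n; apply: (@ae_iter _ _ _ mu T Tinv n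
        (fun y => dot (s y) (s y) = 1 /\ wedge (mv (A y) (s y)) (s (T y)) = 0)) => //.
      by apply: filterS2 hs sinv => x [].
    have a2 : \forall x \ae mu, forall n, dot (u (iter n T x)) (u (iter n T x)) = 1 /\
        wedge (mv (A (iter n T x)) (u (iter n T x))) (u (iter n.+1 T x)) = 0.
      apply: ae_foralln => n; apply: (@ae_iter _ _ _ mu T Tinv n
        (fun y => dot (u y) (u y) = 1 /\ wedge (mv (A y) (u y)) (u (T y)) = 0)) => //.
      by apply: filterS2 hu uinv => x [].
    by apply: filterS2 a1 a2 => x.
  apply: filterS ai => x [iS iU]; rewrite /D /= normr_le0 => /eqP w0.
  apply: contrapT => /not_orP[]; rewrite /F /G /= => /contrapT Fx /contrapT Gx.
  have {}Fx := Fx N (leqnn N); have {}Gx := Gx N (leqnn N); rewrite /= in Fx Gx.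
  have [u1 _] := iU 0%N; have [s1 _] := iS 0%N; rewrite /= in u1 s1.
  have [un1 _] := iU N; rewrite /= in un1.
  have [c hc] := inv_dir_cocyc N iU.
  have su : s x = (dot (s x) (u x) * (u x).1, dot (s x) (u x) * (u x).2).
    by apply: parallel_unit => //; rewrite wedgeC w0 oppr0.
  have dsu : dot (s x) (u x) ^+ 2 = 1.
    have := cauchy_schwarz (s x) (u x); rewrite s1 u1.
    rewrite wedgeC w0 oppr0.
    by rewrite expr0n addr0 mulr1.
  move: Fx; rewrite {1 2}su mvZ dotZ dsu mul1r hc dotZ un1 mulr1 => c4.
  have := cocyc_invcK N x (u x) TK dA; rewrite hc mvZ => e.
  have := u1; rewrite -{1 2}e dotZ.
  by apply: small_prod => //; [exact: dot_ge0|exact: sqr_ge0].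
rewrite (preserved_iter _ eT)//; apply/negP; rewrite -ltNge.
by rewrite (lt_le_trans (ltrD h1 h2))// -splitr.
Qed.

(** The sign of [wedge] is normalised so that a rotation by positive angles reaches the line of s
    exactly when a positive wedge product stops being positive. *)
Definition frame A T Tinv (L : R) s u x :=
  [/\ dot (s x) (s x) = 1 /\ dot (u x) (u x) = 1, 0 < wedge (u x) (s x),
      wedge (mv (A x) (s x)) (s (T x)) = 0, wedge (mv (A x) (u x)) (u (T x)) = 0 &
      forall e : R, 0 < e -> exists N, forall n, (N <= n)%N ->
        [/\ nsq (cocyc A T n x) <= expR ((L + e) * n%:R),
            dot (mv (cocyc A T n x) (s x)) (mv (cocyc A T n x) (s x))
              <= expR ((- L + e) * n%:R) &
            dot (mv (cocyc (invc A Tinv) Tinv n x) (u x))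
                (mv (cocyc (invc A Tinv) Tinv n x) (u x))
              <= expR ((- L + e) * n%:R)]].

(** The unstable direction is the stable direction of the inverse cocycle, which has the same
    rate. *)
Lemma contracting_sections K A T Tinv : ergodic_aut mu T Tinv -> slc K A ->
  0 < rate mu (lnN A T) ->
  exists s u, [/\ mvec s /\ mvec u,
    \forall x \ae mu, contracts A T (rate mu (lnN A T)) s x,
    \forall x \ae mu, contracts (invc A Tinv) Tinv (rate mu (lnN A T)) u x,
    \forall x \ae mu, wedge (mv (A x) (s x)) (s (T x)) = 0 &
    \forall x \ae mu, wedge (mv (A x) (u x)) (u (T x)) = 0].
Proof.
move=> eT sA L0; have [[TK TiK] mT mTi _ _] := eT; have [mA dA _] := sA.
have eTi := ergodic_aut_sym eT.
have sAi := slc_invc mTi sA; have [mAi dAi _] := sAi.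
have rE := rate_invc eT sA.
have L0i : 0 < rate mu (lnN (invc A Tinv) Tinv) by rewrite rE.
exists (stable_dir A T), (stable_dir (invc A Tinv) Tinv); split.
- by split; exact: mvec_stable_dir.
- exact: (stable_dir_contracts eT sA L0).
- by rewrite -rE; exact: (stable_dir_contracts eTi sAi L0i).
- exact: (stable_dir_invariant eT sA L0).
have h := ae_iter 1 eT (stable_dir_invariant eTi sAi L0i).
apply: filterS h => x /=; rewrite /invc TK; move: (stable_dir _ _) => u h.
have : wedge (mv (A x) (mv (adj2 (A x)) (u (T x)))) (mv (A x) (u x)) = 0.
  by rewrite wedge_mv h mulr0.
rewrite -mv_mul (_ : A x *m adj2 (A x) = 1%:M); last first.
  have := mul_adj2 (dA x); exact: mulmx1C.
by rewrite mv1 wedgeC => /eqP; rewrite oppr_eq0 => /eqP.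
Qed.

Theorem oseledets K A T Tinv : ergodic_aut mu T Tinv -> slc K A ->
  0 < rate mu (lnN A T) ->
  exists s u, [/\ mvec s, mvec u &
    \forall x \ae mu, frame A T Tinv (rate mu (lnN A T)) s u x].
Proof.
move=> eT sA L0; have [[TK TiK] mT mTi _ _] := eT; have [mA dA _] := sA.
have eTi := ergodic_aut_sym eT.
have sAi := slc_invc mTi sA; have [mAi dAi _] := sAi.
have [s [u [[ms mu_] hs hu sinv uinv]]] := contracting_sections eT sA L0.
have tr := contracting_transverse eT sA L0 ms mu_ hs hu sinv uinv.
pose sg x : R := if wedge (u x) (s x) < 0 then -1 else 1.
have msg : measurable_fun setT sg by apply: measurable_sign; exact: measurable_wedge.
have sg2 x : sg x ^+ 2 = 1 by rewrite /sg; case: ifP; rewrite ?sqrrN expr1n.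
pose s' x := (sg x * (s x).1, sg x * (s x).2).
exists s', u; split => //.
  by case: ms => ? ?; split; rewrite /s' /=; mfun.
have kk := kingman eT (lnN_process mT sA).
have H := ae_and (ae_and hs hu) (ae_and (ae_and sinv uinv) (ae_and tr kk)).
apply: filterS H => x [[[s1 cs] [u1 cu]] [[si ui] [tx kx]]].
have wE : wedge (u x) (s' x) = sg x * wedge (u x) (s x) by rewrite /wedge /s' /=; ring.
split => //.
- by rewrite /s' dotZ sg2 mul1r.
- rewrite wE /sg; case: (ltP (wedge (u x) (s x)) 0) => h; first by rewrite mulN1r oppr_gt0.
  by rewrite mul1r lt_def tx.
- rewrite /s' mvZ.
  have -> : wedge (sg x * (mv (A x) (s x)).1, sg x * (mv (A x) (s x)).2)
    (sg (T x) * (s (T x)).1, sg (T x) * (s (T x)).2) =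
    sg x * sg (T x) * wedge (mv (A x) (s x)) (s (T x)) by rewrite /wedge /=; ring.
  by rewrite si mulr0.
move=> e e0; have [N1 h1] := cs e e0; have [N2 h2] := cu e e0; have [N3 h3] := kx e e0.
exists (N1 + N2 + N3)%N => n nn; split.
- have /andP[_ h] : _ := h3 n (leq_trans (leq_addl _ _) nn).
  by rewrite -lnNK// ler_expR.
- by rewrite /s' mvZ dotZ sg2 mul1r; apply: h1; lia.
- by apply: h2; lia.
Qed.

End Splitting.

(** * Perturbation by rotations *)

Section Rotation.
Context {R : realType}.
Implicit Types (v w s u : R * R) (t e : R).

(* Rotations are parametrised by the tangent [t] of their angle. *)
Definition csn t : R := (Num.sqrt (1 + t ^+ 2))^-1.
Definition rotm t : 'M[R]_2 := mx22 (csn t) (- (t * csn t)) (t * csn t) (csn t).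

Lemma csn_gt0 t : 0 < csn t.
Proof. by rewrite invr_gt0 sqrtr_gt0; have := sqr_ge0 t; lra. Qed.

Lemma csn_sq t : csn t ^+ 2 * (1 + t ^+ 2) = 1.
Proof.
have h : 0 < 1 + t ^+ 2 by have := sqr_ge0 t; lra.
by rewrite exprVn sqr_sqrtr ?ltW// mulVf// gt_eqF.
Qed.

Lemma csn_le1 t : csn t <= 1.
Proof.
have h := csn_sq t; have c0 := csn_gt0 t; have t2 := sqr_ge0 t.
rewrite -(@ler_pXn2r _ 2) ?nnegrE ?(ltW c0)// expr1n.
by have := mulr_ge0 (sqr_ge0 (csn t)) t2; lra.
Qed.

Lemma rotmE t : (rotm t 0 0 = csn t) * (rotm t 0 1 = - (t * csn t)) *
  (rotm t 1 0 = t * csn t) * (rotm t 1 1 = csn t).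
Proof. by rewrite /rotm /mx22 !mxE. Qed.

Lemma det_rotm t : \det (rotm t) = 1.
Proof.
rewrite det22E /det22 !rotmE.
have -> : csn t * csn t - - (t * csn t) * (t * csn t) = csn t ^+ 2 * (1 + t ^+ 2) by ring.
exact: csn_sq.
Qed.

Lemma rotm0 : rotm 0 = 1%:M.
Proof.
have c1 : csn 0 = 1 by rewrite /csn expr0n addr0 sqrtr1 invr1.
by apply: mx22_eq; rewrite !rotmE !scalar22 /= c1 ?mul0r ?oppr0.
Qed.

Lemma nsq_mul_rotm (A : 'M[R]_2) t : nsq (A *m rotm t) = nsq A.
Proof.
rewrite /nsq !mulmx2 !rotmE.
transitivity (nsq A * (csn t ^+ 2 * (1 + t ^+ 2))); last by rewrite csn_sq mulr1 /nsq.
by rewrite /nsq; ring.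
Qed.

Lemma dot_rotm t v : dot (mv (rotm t) v) (mv (rotm t) v) = dot v v.
Proof.
rewrite /dot /mv !rotmE /=.
transitivity ((v.1 * v.1 + v.2 * v.2) * (csn t ^+ 2 * (1 + t ^+ 2))); last by rewrite csn_sq mulr1.
by ring.
Qed.

Lemma wedge_rotm t v s :
  wedge (mv (rotm t) v) s = csn t * (wedge v s - t * dot v s).
Proof. by rewrite /wedge /mv /dot !rotmE /=; ring. Qed.

(** The partial sums y m of 1/q j satisfy q m * y m <= K + 1, the extra 1 being the term j = m. So
    1/q is at least y/(K + 1), y grows by the factor (K + 1)/K at each step, and q decays
    accordingly. *)
Lemma summable_ratio_decay (q : nat -> R) (K : R) : (forall j, 0 < q j) -> 0 <= K ->
  (forall m, \sum_(j < m) q m / q j <= K) ->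
  forall m, q m <= (K + 1) * (K / (K + 1)) ^+ m * q 0%N.
Proof.
move=> q0 K0 h m.
pose y m := \sum_(j < m.+1) (q j)^-1.
have K1 : 0 < K + 1 by lra.
have yS n : y n.+1 = y n + (q n.+1)^-1 by rewrite /y big_ord_recr.
have qy n : q n * y n <= K + 1.
  rewrite /y big_ord_recr /= mulrDr mulfV ?gt_eqF// lerD2r.
  by rewrite mulr_sumr; exact: h.
have step n : y n <= K / (K + 1) * y n.+1.
  have : y n.+1 / (K + 1) <= (q n.+1)^-1.
    by rewrite ler_pdivrMr// ler_pdivlMl//; exact: qy.
  have -> : K / (K + 1) * y n.+1 = y n.+1 - y n.+1 / (K + 1) by field; rewrite gt_eqF.
  by rewrite yS; lra.
have : y 0%N <= (K / (K + 1)) ^+ m * y m.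
  elim: m => [|n IH]; first by rewrite expr0 mul1r.
  rewrite (le_trans IH)// exprSr -mulrA ler_wpM2l//.
  by rewrite exprn_ge0// divr_ge0// ltW.
rewrite /y big_ord1 -/(y m) => h0.
have h1 : y m <= (K + 1) / q m by rewrite ler_pdivlMr// mulrC; exact: qy.
have h2 : (q 0%N)^-1 <= (K / (K + 1)) ^+ m * ((K + 1) / q m).
  rewrite (le_trans h0)// ler_wpM2l//.
  by rewrite exprn_ge0// divr_ge0// ltW.
have := ler_wpM2l (ltW (q0 0%N)) h2; rewrite mulfV ?gt_eqF//.
have -> : q 0%N * ((K / (K + 1)) ^+ m * ((K + 1) / q m)) =
  ((K + 1) * (K / (K + 1)) ^+ m * q 0%N) / q m by ring.
by rewrite ler_pdivlMr// mul1r.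
Qed.

(* If rotating [u] by a small positive angle at every step never reaches the
   line of [s], then the slope of the rotated vector in the frame (u, s)
   increases by at least a multiple of 1 / |s_j|^2 at time j while staying below
   a multiple of 1 / |s_m|^2, so that the sums of |s_m|^2 / |s_j|^2 are bounded. *)
Lemma unreached_ratio_sum (A : nat -> 'M[R]_2) (u s v : nat -> R * R) (e om : R) :
  (forall j, \det (A j) = 1) ->
  (forall j, u j.+1 = mv (A j) (u j)) -> (forall j, s j.+1 = mv (A j) (s j)) ->
  v 0%N = u 0%N -> (forall j, v j.+1 = mv (A j) (mv (rotm e) (v j))) ->
  wedge (u 0%N) (s 0%N) = om -> 0 < om -> 0 < e ->
  (forall j, e * `|dot (u j) (s j)| < om) ->
  (forall j, 0 < wedge (mv (rotm e) (v j)) (s j)) ->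
  forall m, \sum_(j < m) dot (s m) (s m) / dot (s j) (s j) <= 2 / (e ^+ 2 * csn e).
Proof.
move=> dA uS sS v0 vS om0 omp e0 ang F m.
have wus j : wedge (u j) (s j) = om.
  by elim: j => [//|j IH]; rewrite uS sS wedge_mv dA mul1r.
pose a j := wedge (v j) (s j); pose b j := wedge (u j) (v j).
have aS j : a j.+1 = wedge (mv (rotm e) (v j)) (s j).
  by rewrite /a vS sS wedge_mv dA mul1r.
have bS j : b j.+1 = wedge (u j) (mv (rotm e) (v j)).
  by rewrite /b vS uS wedge_mv dA mul1r.
have a0 j : 0 < a j.
  by case: j => [|j]; [rewrite /a v0 wus|rewrite aS].
have ds j : 0 < dot (s j) (s j).
  rewrite lt_def dot_ge0 andbT; apply/eqP => h.
  have := wedge_sq_le (u j) (s j); rewrite h mulr0 wus; apply/negP.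
  by rewrite -ltNge exprn_gt0.
have dv j : 0 < dot (v j) (v j).
  rewrite lt_def dot_ge0 andbT; apply/eqP => h.
  have := wedge_sq_le (v j) (s j); rewrite h mul0r; apply/negP.
  by rewrite -ltNge exprn_gt0// a0.
pose ta j := b j / a j.
have c0 := csn_gt0 e.
have inc j : om * (e * csn e) / dot (s j) (s j) <= ta j.+1 - ta j.
  have -> : ta j.+1 - ta j = om * (e * csn e) * dot (v j) (v j) / (a j * a j.+1).
    (* Plücker's relation for u, s, v and the rotated v, together with wedge(v, rotated v) = e
       csn(e) |v|^2. *)
    have num : b j.+1 * a j - b j * a j.+1 = om * (e * csn e) * dot (v j) (v j).
      rewrite aS bS /a /b -(wus j) /wedge /mv /dot !rotmE /=; ring.
    rewrite -num /ta; field.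
    by rewrite !gt_eqF.
  have aa : a j * a j.+1 <= dot (v j) (v j) * dot (s j) (s j).
    have h1 := wedge_sq_le (v j) (s j).
    have h2 := wedge_sq_le (mv (rotm e) (v j)) (s j).
    rewrite dot_rotm -aS in h2; rewrite -/(a j) in h1.
    have := sqr_ge0 (a j - a j.+1); move: h1 h2.
    move: (a j) (a j.+1) (_ * dot (s j) _) => x y z; nra.
  rewrite ler_pdivrMr// mulrAC ler_pdivlMr ?mulr_gt0//.
  by rewrite -[leRHS]mulrA ler_pM2l// ?mulr_gt0//.
(* The rotated v has not passed s, so e dot(v, s) < wedge(v, s). Expanding om v = a u + b s and
   bounding the u-part by [ang] leaves e b |s|^2 <= 2 om a. *)
have top : ta m <= 2 * om / (e * dot (s m) (s m)).
  have := F m; rewrite wedge_rotm pmulr_rgt0// -/(a m) => h.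
  have dec : om * dot (v m) (s m) = a m * dot (u m) (s m) + b m * dot (s m) (s m).
    by rewrite -(wus m) /a /b /wedge /dot; ring.
  rewrite /ta ler_pdivrMr// mulrAC ler_pdivlMr ?mulr_gt0//.
  have h1 : e * (om * dot (v m) (s m)) <= om * a m.
    by rewrite mulrCA ler_pM2l//; lra.
  rewrite dec in h1.
  have h2 : - (om * a m) <= e * (a m * dot (u m) (s m)).
    have : - om <= e * dot (u m) (s m).
      have := ang m; have : - `|dot (u m) (s m)| <= dot (u m) (s m).
        by rewrite lerNl -normrN ler_norm.
      move=> h2 h3; have := ler_wpM2l (ltW e0) h2; lra.
    move=> h2; have := ler_wpM2r (ltW (a0 m)) h2; lra.
  lra.
have tot : \sum_(j < m) (om * (e * csn e) / dot (s j) (s j)) <= ta m.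
  apply: (@le_trans _ _ (\sum_(j < m) (ta j.+1 - ta j))).
    by apply: ler_sum => j _; exact: inc.
  rewrite -(big_mkord xpredT (fun j => ta j.+1 - ta j)) telescope_sumr//.
  have b0 : b 0%N = 0 by rewrite /b v0 /wedge; ring.
  by rewrite {2}/ta b0 mul0r subr0.
have := le_trans tot top.
have -> : \sum_(j < m) (om * (e * csn e) / dot (s j) (s j)) =
    om * (e * csn e) / dot (s m) (s m) * \sum_(j < m) dot (s m) (s m) / dot (s j) (s j).
  rewrite mulr_sumr; apply: eq_bigr => j _; field.
  by rewrite !gt_eqF.
move: (\sum_(j < m) _) => S hS.
have -> : 2 / (e ^+ 2 * csn e) = (2 * om / (e * dot (s m) (s m))) / (om * (e * csn e) / dot (s m) (s m)).
  by field; rewrite !gt_eqF.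
by rewrite ler_pdivlMr ?divr_gt0 ?mulr_gt0// mulrC.
Qed.

End Rotation.

(** * Words of rotation parameters read along an orbit *)

Section Words.
Context {R : realType} {d : measure_display} {Om : measurableType d}.
Variable mu : probability Om R.
Implicit Types (A : Om -> 'M[R]_2) (T Tinv : Om -> Om) (s u : Om -> R * R) (w : seq R).

Fixpoint wordc A T w (x : Om) : 'M[R]_2 :=
  match w with
  | [::] => 1%:M
  | t :: w' => wordc A T w' (T x) *m (A x *m rotm t)
  end.

Lemma wordc_cat A T w1 w2 x :
  wordc A T (w1 ++ w2) x = wordc A T w2 (iter (size w1) T x) *m wordc A T w1 x.
Proof.
elim: w1 x => [|t w1 IH] x /=; first by rewrite mulmx1.
by rewrite IH -iterS iterSr !mulmxA.
Qed.

Lemma wordc_nseq0 A T k x : wordc A T (nseq k 0) x = cocyc A T k x.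
Proof.
elim: k x => [|k IH] x //.
by rewrite cocycSr -IH -[nseq k.+1 0]/(0 :: nseq k 0) /= rotm0 mulmx1.
Qed.

Lemma mmat_wordc A T w : measurable_fun setT T -> mmat A -> mmat (wordc A T w).
Proof.
move=> mT mA; elim: w => [|t w IH] /=; first by move=> i j; exact: measurable_cst.
apply: (@mmat_mul _ _ _ (fun x => wordc A T w (T x))).
  by move=> i j; apply: (measurableT_comp (IH i j)).
by apply: mmat_mul => // i j; exact: measurable_cst.
Qed.

Lemma nsq_wordc_le K A T w x : slc K A ->
  nsq (wordc A T w x) <= expR (K * (size w).+1%:R).
Proof.
move=> sA; have [_ dA AK] := sA.
elim: w x => [|t w IH] x /=.
  by have := nsq_cocyc_le T 0 x sA.
rewrite -[(size w).+2%:R]natr1 mulrDr mulr1 expRD (le_trans (nsq_mulmx _ _))//.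
by apply: ler_pM; rewrite ?nsq_ge0// nsq_mul_rotm.
Qed.

Lemma wedge_mv_neq0 (M : 'M[R]_2) (v : R * R) : \det M = 1 -> dot v v = 1 ->
  0 < dot (mv M v) (mv M v).
Proof.
move=> dM v1; rewrite lt_def dot_ge0 andbT; apply/eqP => h.
have := mv_le (adj2 M) (mv M v).
by rewrite h mulr0 -mv_mul mul_adj2// mv1 v1; lra.
Qed.

(** The last letter is free: a full rotation e may overshoot the line of s, and a smaller one hits
    it exactly. *)
Definition reaches A T s u (e : R) x (j : nat) (t : R) := `|t| <= e /\
  wedge (mv (wordc A T (rcons (nseq j e) t) x) (u x)) (mv (cocyc A T j.+1 x) (s x)) = 0.

Definition tilt A T s u (e : R) j x : R :=
  wedge (mv (rotm e) (mv (wordc A T (nseq j e) x) (u x))) (mv (cocyc A T j x) (s x)).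

Lemma measurable_tilt A T s u e j : measurable_fun setT T -> mmat A -> mvec s ->
  mvec u -> measurable_fun setT (tilt A T s u e j).
Proof.
move=> mT mA ms mu_; apply: measurable_wedge.
  apply: mvec_mv; first by move=> i k; exact: measurable_cst.
  by apply: mvec_mv => //; exact: mmat_wordc.
by apply: mvec_mv => //; exact: mmat_cocyc.
Qed.

Lemma wedge_wordc_rcons A T s u e j t x : (forall x, \det (A x) = 1) ->
  wedge (mv (wordc A T (rcons (nseq j e) t) x) (u x)) (mv (cocyc A T j.+1 x) (s x)) =
  csn t * (wedge (mv (wordc A T (nseq j e) x) (u x)) (mv (cocyc A T j x) (s x)) -
    t * dot (mv (wordc A T (nseq j e) x) (u x)) (mv (cocyc A T j x) (s x))).
Proof.
move=> dA; rewrite -cats1 wordc_cat size_nseq /= mul1mx !mv_mul.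
by rewrite wedge_mv dA mul1r wedge_rotm.
Qed.

Lemma tilt_next A T s u e j x : (forall x, \det (A x) = 1) ->
  wedge (mv (wordc A T (nseq j.+1 e) x) (u x)) (mv (cocyc A T j.+1 x) (s x)) =
  tilt A T s u e j x.
Proof.
move=> dA; have -> : nseq j.+1 e = rcons (nseq j e) e by elim: j => //= j <-.
by rewrite wedge_wordc_rcons// /tilt wedge_rotm.
Qed.

Lemma tilt_reaches A T s u e m x : (forall x, \det (A x) = 1) -> 0 < e ->
  0 < wedge (u x) (s x) -> tilt A T s u e m x <= 0 ->
  exists2 j, (j <= m)%N & exists t, reaches A T s u e x j t.
Proof.
move=> dA e0 w0 Fm.
have ex : exists j, tilt A T s u e j x <= 0 by exists m.
case: (ex_minnP ex) => j Fj minj.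
exists j; first exact: minj.
set v := mv (wordc A T (nseq j e) x) (u x); set sj := mv (cocyc A T j x) (s x).
have a0 : 0 < wedge v sj.
  rewrite /v /sj; case: j minj {Fj v sj} => [|j] minj; first by rewrite /= !mv1.
  by rewrite tilt_next// ltNge; apply/negP => /minj; rewrite ltnn.
have := Fj; rewrite /tilt wedge_rotm -/v -/sj pmulr_rle0 ?csn_gt0// subr_le0 => h.
have d0 : 0 < dot v sj by rewrite -(pmulr_rgt0 _ e0) (lt_le_trans a0).
exists (wedge v sj / dot v sj); split.
  by rewrite ger0_norm ?divr_ge0 ?(ltW a0) ?(ltW d0)// ler_pdivrMr.
by rewrite wedge_wordc_rcons// -/v -/sj divfK ?gt_eqF// subrr mulr0.
Qed.

(** If the tangent of the angle between the two lines is at most e, one rotation suffices. *)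
Lemma angle_reaches A T s u e x : (forall x, \det (A x) = 1) -> 0 < e ->
  0 < wedge (u x) (s x) -> wedge (u x) (s x) <= e * `|dot (u x) (s x)| ->
  exists t, reaches A T s u e x 0 t.
Proof.
move=> dA e0 w0 h.
have d0 : 0 < `|dot (u x) (s x)| by rewrite -(pmulr_rgt0 _ e0) (lt_le_trans w0).
exists (wedge (u x) (s x) / dot (u x) (s x)); split.
  by rewrite normrM normfV gtr0_norm// ler_pdivrMr.
rewrite wedge_wordc_rcons// !mv1 divfK ?subrr ?mulr0//.
by rewrite -normr_gt0.
Qed.

Lemma ae_iter_forall T Tinv (P : Om -> Prop) : ergodic_aut mu T Tinv ->
  (\forall x \ae mu, P x) -> \forall x \ae mu, forall n, P (iter n T x).
Proof. by move=> eT h; apply: ae_foralln => n; exact: ae_iter eT h. Qed.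

Lemma frame_inv_dir A T Tinv L s u x : (forall n, frame A T Tinv L s u (iter n T x)) ->
  inv_dir A T s x /\ inv_dir A T u x.
Proof. by move=> h; split => n; have [[]] := h n. Qed.

(** If neither small angles nor sign changes of the tilt occur on a set of positive measure,
    [unreached_ratio_sum] applies at almost every point with one constant k, and
    [summable_ratio_decay] gives a uniform rate. *)
Lemma reach_or_uniform K A T Tinv L s u (e : R) : ergodic_aut mu T Tinv ->
  slc K A -> mvec s -> mvec u -> 0 < e ->
  (\forall x \ae mu, frame A T Tinv L s u x) ->
  (exists C tau c : R, [/\ 0 < C, 0 < tau < 1, 0 < c &
     \forall x \ae mu, c <= wedge (u x) (s x) ^+ 2 /\
       forall m, dot (mv (cocyc A T m x) (s x)) (mv (cocyc A T m x) (s x))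
                 <= C * tau ^+ m]) \/
  (exists (D : set Om) m, [/\ measurable D, mu D != 0%E &
     forall x, D x -> 0 < wedge (u x) (s x) ->
       exists2 j, (j <= m)%N & exists t, reaches A T s u e x j t]).
Proof.
move=> eT sA ms mu_ e0 fr; have [_ mT _ _ _] := eT; have [mA dA _] := sA.
pose D0 := [set x | wedge (u x) (s x) - e * `|dot (u x) (s x)| <= 0].
have mD0 : measurable D0.
  apply: measurable_le_cst; apply: measurable_funB; first exact: measurable_wedge.
  apply: measurable_funM => //; apply: measurableT_comp => //.
  exact: measurable_dot.
pose D m := [set x | tilt A T s u e m x <= 0].
have mD m : measurable (D m) by apply: measurable_le_cst; exact: measurable_tilt.
have [D00|D00] := eqVneq (mu D0) 0%E; last first.
  right; exists D0, 0%N; split => // x; rewrite /D0 /= subr_le0 => h w0.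
  by exists 0%N => //; exact: angle_reaches.
have [Dm0|/existsNP[m /eqP Dm0]] := pselect (forall m, mu (D m) = 0%E); last first.
  by right; exists (D m), m; split => // x Dx w0; exact: (tilt_reaches (m := m)).
left.
pose k : R := 2 / (e ^+ 2 * csn e).
have k0 : 0 < k by rewrite divr_gt0// mulr_gt0 ?csn_gt0// exprn_gt0.
(* The third constant comes from e^2 dot^2 <= wedge^2 and dot^2 + wedge^2 = 1 for unit vectors. *)
exists (k + 1), (k / (k + 1)), (e ^+ 2 / (1 + e ^+ 2)); split.
- by lra.
- have k1 : 0 < k + 1 by lra.
  by apply/andP; split; [exact: divr_gt0|rewrite ltr_pdivrMr//; lra].
- by rewrite divr_gt0 ?exprn_gt0//; have := exprn_gt0 2 e0; lra.
have n0 : \forall x \ae mu, ~ D0 x by exists D0; split => // x /= /contrapT.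
have nm : \forall x \ae mu, forall m, ~ D m x.
  by apply: ae_foralln => m; exists (D m); split; [exact: mD|exact: Dm0|move=> x /= /contrapT].
have fr' := ae_iter_forall eT fr; have n0' := ae_iter_forall eT n0.
apply: filterS2 (ae_and fr' n0') nm => x [fx nx] nmx.
have [[s1 u1] w0 _ _ _] := fx 0%N; rewrite /= in s1 u1 w0.
have ang0 : e * `|dot (u x) (s x)| < wedge (u x) (s x).
  have := nx 0%N; rewrite /D0 /= => /negP; rewrite -ltNge subr_gt0//.
split.
  have cs := cauchy_schwarz (u x) (s x); rewrite s1 u1 mulr1 in cs.
  rewrite ler_pdivrMr; last by have := exprn_gt0 2 e0; lra.
  have : e ^+ 2 * dot (u x) (s x) ^+ 2 <= wedge (u x) (s x) ^+ 2.
    rewrite -[dot _ _ ^+ 2]real_normK ?num_real// -exprMn ler_pXn2r ?nnegrE ?mulr_ge0 ?(ltW e0) ?(ltW w0)//.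
    exact: ltW.
  have -> : dot (u x) (s x) ^+ 2 = 1 - wedge (u x) (s x) ^+ 2 by lra.
  lra.
have [iS iU] := frame_inv_dir fx.
have r0 : forall m, \sum_(j < m) dot (mv (cocyc A T m x) (s x)) (mv (cocyc A T m x) (s x)) /
    dot (mv (cocyc A T j x) (s x)) (mv (cocyc A T j x) (s x)) <= k.
  apply: (@unreached_ratio_sum R (fun j => A (iter j T x))
     (fun j => mv (cocyc A T j x) (u x)) (fun j => mv (cocyc A T j x) (s x))
     (fun j => mv (wordc A T (nseq j e) x) (u x)) e (wedge (u x) (s x))) => //.
  - by move=> j; rewrite /= mv_mul.
  - by move=> j; rewrite /= mv_mul.
  - move=> j; have -> : nseq j.+1 e = rcons (nseq j e) e by elim: j => //= j <-.
    by rewrite -cats1 wordc_cat size_nseq /= mul1mx !mv_mul.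
  - by rewrite /= !mv1.
  - move=> j.
    (* The images of u and s are multiples b and a of the unit directions at T^j x, so wedge and dot
       both scale by ab, which is positive since wedge is preserved. *)
    have wj : wedge (u x) (s x) = wedge (mv (cocyc A T j x) (u x)) (mv (cocyc A T j x) (s x)).
      by rewrite wedge_mv det_cocyc// mul1r.
    have [a ha] := inv_dir_cocyc j iS; have [b hb] := inv_dir_cocyc j iU.
    have [_ wj0 _ _ _] := fx j.
    have := nx j; rewrite /D0 /= => /negP; rewrite -ltNge subr_gt0 => angj.
    move: w0; rewrite wj ha hb.
    set U := u (iter j T x); set S := s (iter j T x).
    have -> : wedge (b * U.1, b * U.2) (a * S.1, a * S.2) = a * b * wedge U S by rewrite /wedge /=; ring.
    have -> : dot (b * U.1, b * U.2) (a * S.1, a * S.2) = a * b * dot U S by rewrite /dot /=; ring.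
    rewrite pmulr_lgt0// => ab0.
    by rewrite normrM gtr0_norm// mulrCA ltr_pM2l.
  - by move=> j; have := nmx j; rewrite /D /= => /negP; rewrite -ltNge.
move=> m.
have := @summable_ratio_decay R (fun j => dot (mv (cocyc A T j x) (s x)) (mv (cocyc A T j x) (s x))) k _ (ltW k0) r0 m.
rewrite /= mv1 s1 mulr1; apply => j.
by apply: wedge_mv_neq0 => //; exact: det_cocyc.
Qed.

(** Controls a matrix by its images of two directions, at the price of their angle; the difference
    of the two sides is a sum of four squares. *)
Lemma nsq_frame (W : 'M[R]_2) (v w : R * R) :
  nsq W * wedge v w ^+ 2 <=
  2 * (dot (mv W v) (mv W v) * dot w w + dot (mv W w) (mv W w) * dot v v).
Proof.
rewrite -subr_ge0 /nsq /dot /mv /wedge /=.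
case: v w => [v1 v2] [w1 w2] /=.
move: (W 0 0) (W 0 1) (W 1 0) (W 1 1) => a b c e.
have -> : 2 * (((a * v1 + b * v2) * (a * v1 + b * v2) + (c * v1 + e * v2) * (c * v1 + e * v2)) * (w1 * w1 + w2 * w2) +
   ((a * w1 + b * w2) * (a * w1 + b * w2) + (c * w1 + e * w2) * (c * w1 + e * w2)) * (v1 * v1 + v2 * v2)) -
   (a ^+ 2 + b ^+ 2 + c ^+ 2 + e ^+ 2) * (v1 * w2 - v2 * w1) ^+ 2 =
   ((a * v1 + b * v2) * w1 + (a * w1 + b * w2) * v1) ^+ 2 + ((a * v1 + b * v2) * w2 + (a * w1 + b * w2) * v2) ^+ 2
 + ((c * v1 + e * v2) * w1 + (c * w1 + e * w2) * v1) ^+ 2 + ((c * v1 + e * v2) * w2 + (c * w1 + e * w2) * v2) ^+ 2.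
  by ring.
by rewrite !addr_ge0// sqr_ge0.
Qed.

End Words.

(** * Cancellation of long blocks *)

Section ReachWords.
Context {R : realType} {d : measure_display} {Om : measurableType d}.
Variable mu : probability Om R.
Implicit Types (A : Om -> 'M[R]_2) (T Tinv : Om -> Om) (s u : Om -> R * R) (w : seq R).

(* If a small perturbation along [j] steps sends u(x) into the stable line, then
   a long unperturbed block before x and one of equal length after it cancel. *)
Lemma reaching_word_bound K A T (L : R) s u e x y z j t k (C del om : R) :
  slc K A -> x = iter k T y -> z = iter j.+1 T x ->
  inv_dir A T s y -> inv_dir A T u y -> reaches A T s u e x j t ->
  expR (K * j.+2%:R) <= C ->
  nsq (cocyc A T k y) <= expR ((L + del) * k%:R) ->
  dot (mv (cocyc A T k y) (s y)) (mv (cocyc A T k y) (s y)) <= expR ((- L + del) * k%:R) ->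
  nsq (cocyc A T k z) <= expR ((L + del) * k%:R) ->
  dot (mv (cocyc A T k z) (s z)) (mv (cocyc A T k z) (s z)) <= expR ((- L + del) * k%:R) ->
  om = wedge (u y) (s y) -> 0 < om ->
  nsq (wordc A T (nseq k 0 ++ rcons (nseq j e) t ++ nseq k 0) y)
    <= 4 * C / om ^+ 2 * expR (2 * del * k%:R).
Proof.
move=> sA xE zE iS iU [te rch] hC ny sy nz sz omE om0; have [_ dA _] := sA.
have iSx : inv_dir A T s x.
  by move=> n; rewrite xE -!iterD; exact: (iS (n + k)%N).
have [s1 _] := iS 0%N; have [u1 _] := iU 0%N; rewrite /= in s1 u1.
have [ux1 _] := iU k; rewrite -xE in ux1.
have [sz1 _] := iSx j.+1; rewrite -zE in sz1.
set w := rcons _ _; set P := wordc A T w x.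
have sw : size w = j.+1 by rewrite size_rcons size_nseq.
have WE : wordc A T (nseq k 0 ++ w ++ nseq k 0) y = cocyc A T k z *m (P *m cocyc A T k y).
  by rewrite !wordc_cat !wordc_nseq0 size_nseq sw -xE -zE mulmxA.
rewrite WE; set W := _ *m _.
have PC : nsq P <= C.
  by rewrite (le_trans _ hC)// (le_trans (nsq_wordc_le _ _ _ sA))// sw.
have C0 : 0 <= C by rewrite (le_trans _ PC)// nsq_ge0.
have LL : expR ((L + del) * k%:R) * expR ((- L + del) * k%:R) = expR (2 * del * k%:R).
  by rewrite -expRD; congr expR; ring.
have e0 : 0 <= expR (2 * del * k%:R) by exact: expR_ge0.
(* s(y) is first contracted by A^k(y); the middle word and the last block can regain at most C
   exp((L + del)k). *)
have Ws : dot (mv W (s y)) (mv W (s y)) <= C * expR (2 * del * k%:R).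
  rewrite /W !mv_mul (le_trans (mv_le _ _))//.
  apply: (@le_trans _ _ (expR ((L + del) * k%:R) * (C * expR ((- L + del) * k%:R)))).
    apply: ler_pM => //; rewrite ?nsq_ge0 ?dot_ge0//.
    rewrite (le_trans (mv_le _ _))//.
    by apply: ler_pM; rewrite ?nsq_ge0 ?dot_ge0.
  by rewrite mulrCA LL.
(* u(y) first expands by at most exp((L + del)k), is then sent into the stable line, and the last
   block contracts it. *)
have Wu : dot (mv W (u y)) (mv W (u y)) <= C * expR (2 * del * k%:R).
  have [a ha] := inv_dir_cocyc k iU; rewrite -xE in ha.
  have a2 : a ^+ 2 <= expR ((L + del) * k%:R).
    have := mv_le (cocyc A T k y) (u y); rewrite ha dotZ ux1 u1 !mulr1 => h.
    exact: le_trans h ny.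
  have [b hb] := inv_dir_cocyc j.+1 iSx; rewrite -zE in hb.
  have b0 : b != 0.
    apply/eqP => b0; have := wedge_mv_neq0 (det_cocyc T j.+1 x dA) (iSx 0%N).1.
    by rewrite hb b0 dotZ expr0n mul0r ltxx.
  have wz : wedge (mv P (u x)) (s z) = 0.
    move: rch; rewrite hb -/w -/P.
    have -> : wedge (mv P (u x)) (b * (s z).1, b * (s z).2) = b * wedge (mv P (u x)) (s z).
      by rewrite /wedge /=; ring.
    by move/eqP; rewrite mulf_eq0 (negbTE b0) => /eqP.
  have hP := parallel_unit wz sz1; set c := dot _ _ in hP.
  have c2 : c ^+ 2 <= C.
    have := mv_le P (u x); rewrite hP dotZ sz1 ux1 !mulr1 => h.
    exact: le_trans h PC.
  rewrite /W !mv_mul ha mvZ hP !mvZ !dotZ.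
  apply: (@le_trans _ _ (expR ((L + del) * k%:R) * (C * expR ((- L + del) * k%:R)))).
    apply: ler_pM => //; first exact: sqr_ge0.
      by apply: mulr_ge0; [exact: sqr_ge0|exact: dot_ge0].
    by apply: ler_pM; rewrite ?sqr_ge0 ?dot_ge0.
  by rewrite mulrCA LL.
have := nsq_frame W (u y) (s y); rewrite -omE s1 u1 !mulr1 => h.
have -> : 4 * C / om ^+ 2 * expR (2 * del * k%:R) = 4 * (C * expR (2 * del * k%:R)) / om ^+ 2 by ring.
rewrite ler_pdivlMr ?exprn_gt0//; lra.
Qed.

Lemma ae_not_null (D : set Om) (G : nat -> set Om) : measurable D -> mu D != 0%E ->
  (forall n, measurable (G n)) -> (\forall x \ae mu, exists n, G n x) ->
  exists n, mu (D `&` G n) != 0%E.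
Proof.
move=> mD D0 mG cov; apply: contrapT => /forallNP h.
have h' : \forall x \ae mu, forall n, ~ (D `&` G n) x.
  apply: ae_foralln => n; exists (D `&` G n); split.
  - exact: measurableI.
  - by apply/eqP; have := h n; move/negP; rewrite negbK.
  - by move=> x /= /contrapT.
have [x Dx [[n Gx] nx]] := ae_exists mD D0 (ae_and cov h').
exact: (nx n).
Qed.

Theorem reach_words K A T Tinv (L : R) s u e (D : set Om) m (del : R) :
  ergodic_aut mu T Tinv -> slc K A -> mvec s -> mvec u ->
  (\forall x \ae mu, frame A T Tinv L s u x) ->
  measurable D -> mu D != 0%E ->
  (forall x, D x -> 0 < wedge (u x) (s x) ->
       exists2 j, (j <= m)%N & exists t, reaches A T s u e x j t) ->
  0 < del ->
  \forall y \ae mu, exists k j t, [/\ (0 < k)%N, `|t| <= e &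
    nsq (wordc A T (nseq k 0 ++ rcons (nseq j e) t ++ nseq k 0) y) < expR (3 * del * k%:R)].
Proof.
move=> eT sA ms mu_ fr mD D0 hD del0; have [_ mT _ _ _] := eT; have [mA dA AK] := sA.
pose G0 n := \bigcap_(i in [set i | (n <= i)%N])
   ([set z | nsq (cocyc A T i z) <= expR ((L + del) * i%:R)] `&`
    [set z | dot (mv (cocyc A T i z) (s z)) (mv (cocyc A T i z) (s z)) <= expR ((- L + del) * i%:R)]).
have mG0 n : measurable (G0 n).
  apply: bigcap_measurable; first by exists n => /=.
  move=> i _; have mc := mmat_cocyc i mT mA.
  apply: measurableI; apply: measurable_le_cst; first exact: measurable_nsq.
  by apply: measurable_dot; exact: mvec_mv.
have incG0 n n' x : (n <= n')%N -> G0 n x -> G0 n' x.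
  by move=> nn h i /= ni; apply: h => /=; exact: leq_trans ni.
have covG0 : \forall x \ae mu, exists n, G0 n x.
  apply: filterS fr => x [_ _ _ _ /(_ del del0)[N hN]].
  by exists N => i /= Ni; have [] := hN i Ni.
(* The reaching time j varies with the point, so the estimates are required at every possible
   landing point, up to m + 1 steps ahead. *)
pose G n := \bigcap_(i in [set i | (i <= m.+1)%N]) (iter i T @^-1` G0 n).
have mG n : measurable (G n).
  apply: bigcap_measurable; first by exists 0%N.
  by move=> i _; apply: measurable_preim => //; exact: measurable_iter.
have covG : \forall x \ae mu, exists n, G n x.
  apply: filterS (ae_iter_forall eT covG0) => x hx.
  have : exists n, forall i, (i <= m.+1)%N -> G0 n (iter i T x).
    elim: (m.+1) => [|k [n IH]].
      by have [n hn] := hx 0%N; exists n => i; rewrite leqn0 => /eqP ->.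
    have [n' hn'] := hx k.+1; exists (maxn n n') => i.
    rewrite leq_eqVlt => /orP[/eqP->|ik]; first exact: incG0 (leq_maxr _ _) hn'.
    by apply: incG0 (leq_maxl _ _) (IH i _).
  by move=> [n hn]; exists n => i /= im; exact: hn.
have [N DN0] := ae_not_null mD D0 mG covG.
have rec := recurrence eT (measurableI _ _ mD (mG N)) DN0.
have H := ae_and (ae_iter_forall eT fr) rec.
apply: filterS H => y [fy vy].
have [iS iU] := frame_inv_dir fy.
have [_ om0 _ _ /(_ del del0)[N1 hN1]] := fy 0%N; rewrite /= in om0 hN1.
have K0 : 0 <= K.
  rewrite -ler_expR expR0 (le_trans _ (AK y))//; have := nsq_ge2 (dA y); lra.
pose C := expR (K * m.+2%:R).
(* The constant and the angle at y are fixed here, before the visit time k; a third del absorbs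
   them. *)
have [N2 hN2] := expR_absorb (4 * C / wedge (u y) (s y) ^+ 2 + 1) del0.
have [k kN [Dk Gk]] := vy (N + N1 + N2 + 1)%N.
have [_ wk _ _ _] := fy k.
have [j jm [t rt]] := hD _ Dk wk.
have Nk : (N <= k)%N by lia.
have [nz sz] := Gk j.+1 jm k Nk.
exists k, j, t; split; first by lia.
  by case: rt.
have [|ny sy _] := hN1 k; first by lia.
apply: (@le_lt_trans _ _ (4 * C / wedge (u y) (s y) ^+ 2 * expR (2 * del * k%:R))).
  apply: (@reaching_word_bound K A T L s u e (iter k T y) y (iter j.+1 T (iter k T y)) j t k C del) => //.
  by rewrite ler_expR ler_wpM2l// ler_nat; lia.
have -> : 3 * del * k%:R = del * k%:R + 2 * del * k%:R by ring.
rewrite expRD ltr_pM2r ?expR_gt0//.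
have : 4 * C / wedge (u y) (s y) ^+ 2 + 1 <= expR (del * k%:R) by apply: hN2; lia.
lra.
Qed.

End ReachWords.

(** * Reduction to words with rational parameters *)

Section RationalWords.
Context {R : realType} {d : measure_display} {Om : measurableType d}.
Variable mu : probability Om R.
Implicit Types (A : Om -> 'M[R]_2) (T Tinv : Om -> Om).

Lemma nsq_rotm_poly (P Q : 'M[R]_2) : exists a b c : R, forall t,
  nsq (P *m (rotm t *m Q)) = csn t ^+ 2 * (a + b * t + c * t ^+ 2).
Proof.
pose J := mx22 (0 : R) (-1) 1 0.
pose X := P *m Q; pose Y := P *m (J *m Q).
have [J00 J01 J10 J11] := mx22E (0 : R) (-1) 1 0.
exists (nsq X), (2 * (X 0 0 * Y 0 0 + X 0 1 * Y 0 1 + X 1 0 * Y 1 0 + X 1 1 * Y 1 1)), (nsq Y) => t.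
by rewrite /nsq /X /Y !mulmx2 !rotmE J00 J01 J10 J11; ring.
Qed.

(** After division by csn(t)^2 the strict bound says that a polynomial in t is positive, an open
    condition. *)
Lemma rotm_rat_approx (P Q : 'M[R]_2) (t e b : R) :
  nsq (P *m (rotm t *m Q)) < b -> `|t| < e ->
  exists q : rat, `|ratr q : R| <= e /\ nsq (P *m (rotm (ratr q) *m Q)) < b.
Proof.
move=> hb te; have [a0 [b0 [c0 hp]]] := nsq_rotm_poly P Q.
pose f t := b * (1 + t ^+ 2) - (a0 + b0 * t + c0 * t ^+ 2).
have fE x : (nsq (P *m (rotm x *m Q)) < b) = (0 < f x).
  have e1 : csn x ^+ 2 * f x = b - nsq (P *m (rotm x *m Q)).
    by rewrite hp /f mulrBr mulrCA csn_sq mulr1.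
  by rewrite -subr_gt0 -e1 pmulr_rgt0// exprn_gt0// csn_gt0.
have cf : continuous f.
  move=> x; apply: cvgB; [apply: cvgM; [exact: cvg_cst|]|];
    repeat first [apply: cvgD | exact: cvg_cst | apply: cvgM | exact: cvg_id
                 | apply: exprn_continuous].
have f0 : 0 < f t by rewrite -fE.
have n1 : \forall x \near t, 0 < f x.
  exact: (cvgr_gt (f t) (cf t)).
have n2 : \forall x \near t, `|x| < e.
  exact: (cvgr_lt `|t| (@norm_continuous _ R t)).
have n12 : \forall x \near t, 0 < f x /\ `|x| < e by apply: filterS2 n1 n2 => x.
have [g /= g0 hg] := (nbhs_ballP _ _).1 n12.
have tg : t - g < t + g by lra.
have [q] := rat_in_itvoo tg.
rewrite in_itv /= => /andP[q1 q2].
have [|fq qe] := hg (ratr q).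
  by rewrite /ball /= ltr_norml; apply/andP; split; lra.
by exists q; rewrite (ltW qe) fE.
Qed.

(** The letters 0 and e are already rational, so only the last rotation is moved; the gap e < e'
    leaves room for it. *)
Lemma reach_rational_words A T (e e' del : R) (q0 : rat) :
  e = ratr q0 -> 0 < e -> e < e' -> 0 < del ->
  (\forall y \ae mu, exists k j t, [/\ (0 < k)%N, `|t| <= e &
    nsq (wordc A T (nseq k 0 ++ rcons (nseq j e) t ++ nseq k 0) y) < expR (3 * del * k%:R)]) ->
  \forall y \ae mu, exists w : seq rat, [/\ (0 < size w)%N,
    all (fun t => `|ratr t : R| <= e') w &
    nsq (wordc A T (map ratr w) y) <= expR (3 * del * (size w)%:R)].
Proof.
move=> eq e0 ee' del0; apply: filterS => y [k [j [t [k0 te h]]]].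
pose x := iter k T y; pose xj := iter j T x.
have wE t' : wordc A T (nseq k 0 ++ rcons (nseq j e) t' ++ nseq k 0) y =
    (cocyc A T k (T xj) *m A xj) *m (rotm t' *m (wordc A T (nseq j e) x *m cocyc A T k y)).
  rewrite -cats1 !wordc_cat !wordc_nseq0 size_cat !size_nseq /= mul1mx addn1 /xj /x /=.
  by rewrite !mulmxA.
rewrite wE in h.
have [q [qe hq]] := rotm_rat_approx h (le_lt_trans te ee').
exists (nseq k 0 ++ rcons (nseq j q0) q ++ nseq k 0); split.
- by rewrite size_cat size_nseq; lia.
- have z0 : `|ratr (0 : rat) : R| <= e' by rewrite rmorph0 normr0; lra.
  rewrite !all_cat all_rcons !all_nseq z0 qe -eq.
  have -> : `|e| <= e' by rewrite gtr0_norm// ltW.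
  by rewrite !orbT.
have -> : map ratr (nseq k 0 ++ rcons (nseq j q0) q ++ nseq k 0) =
    nseq k (0 : R) ++ rcons (nseq j e) (ratr q) ++ nseq k 0.
  by rewrite !map_cat map_rcons !map_nseq rmorph0 eq.
rewrite wE (le_trans (ltW hq))// ler_expR ler_wpM2l//; first by lra.
by rewrite ler_nat !size_cat size_nseq; lia.
Qed.

End RationalWords.

(** * Reading words along orbits *)

Section Machine.
Context {R : realType} {d : measure_display} {Om : measurableType d}.
Variable mu : probability Om R.
Variables (T Tinv : Om -> Om) (E : set Om) (fr : Om -> seq rat).

(* [state x] is the part of the word in use that remains to be read at [x]: a new
   word [fr x] is started when the previous one is exhausted, and at every visit
   to [E], which makes the state well defined from the last visit to [E] on. *)
Definition next_state (w : seq rat) (y : Om) : seq rat :=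
  if behead w is a :: l then a :: l else fr y.

Fixpoint run (k : nat) (y : Om) : seq rat :=
  if k is k'.+1 then next_state (run k' y) (iter k T y) else fr y.

Definition last_visit (x : Om) : option nat :=
  if pselect (exists n, `[< E (iter n Tinv x) >]) is left h
  then Some (ex_minn h) else None.

Definition state (x : Om) : seq rat :=
  if last_visit x is Some n then run n (iter n Tinv x) else [:: 0].

Lemma last_visit_Some x n : last_visit x = Some n <->
  E (iter n Tinv x) /\ forall m, (m < n)%N -> ~ E (iter m Tinv x).
Proof.
rewrite /last_visit; case: pselect => [h|h]; last first.
  by split => // -[En _]; exfalso; apply: h; exists n; exact/asboolP.
case: ex_minnP => m /asboolP Em minm; split.
  move=> [<-]; split => // i im /asboolP /minm; by rewrite leqNgt im.
move=> [En hn]; congr Some; apply/eqP; rewrite eqn_leq.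
rewrite minm ?andTb; last exact/asboolP.
by rewrite leqNgt; apply/negP => /hn.
Qed.

Definition visited x := exists n, E (iter n Tinv x).

Lemma visitedP x : visited x -> exists n, last_visit x = Some n.
Proof.
move=> [n En]; rewrite /last_visit; case: pselect => [h|h]; first by eexists.
by exfalso; apply: h; exists n; exact/asboolP.
Qed.

Hypotheses (TK : cancel T Tinv) (TiK : cancel Tinv T).

Lemma iter_inv n x : iter n.+1 Tinv (T x) = iter n Tinv x.
Proof. by rewrite iterSr TK. Qed.

Lemma visited_next x : visited x -> visited (T x).
Proof. by move=> [n En]; exists n.+1; rewrite iter_inv. Qed.

Lemma visited_iter n x : visited x -> visited (iter n T x).
Proof. by move=> vx; elim: n => //= n; exact: visited_next. Qed.

Lemma state_reset x : E x -> state x = fr x.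
Proof.
move=> Ex; rewrite /state (_ : last_visit x = Some 0%N)//.
by apply/last_visit_Some; split.
Qed.

Lemma state_next x : visited x -> ~ E (T x) -> state (T x) = next_state (state x) (T x).
Proof.
move=> /visitedP[n hn] nE; rewrite /state hn.
have -> : last_visit (T x) = Some n.+1.
  apply/last_visit_Some; move/last_visit_Some: hn => [En hn]; rewrite iter_inv.
  by split => // -[//|m]; rewrite ltnS iter_inv; exact: hn.
rewrite iter_inv /=; congr next_state.
by rewrite -[in LHS]/(iter n.+1 T _) iterS (iter_cancel n TiK).
Qed.

Lemma state_fresh_or_behead x : visited x ->
  state (T x) = fr (T x) \/ (behead (state x) != [::] /\ state (T x) = behead (state x)).
Proof.
move=> vx; have [Ex|nE] := pselect (E (T x)); first by left; exact: state_reset.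
rewrite state_next// /next_state; case: (behead _) => [|a l]; first by left.
by right.
Qed.

Lemma run_all (P : pred rat) k y : (forall z, all P (fr z)) -> all P (run k y).
Proof.
move=> h; elim: k => [//|k IH] /=; rewrite /next_state.
by case: (run k y) IH => [|b [|a l]] //= /andP[].
Qed.

Lemma run_size L k y : (forall z, (0 < size (fr z) <= L)%N) ->
  (0 < size (run k y) <= L)%N.
Proof.
move=> h; elim: k => [//|k IH] /=; rewrite /next_state.
by case: (run k y) IH => [|b [|a l]] //= /ltnW.
Qed.

Lemma state_all (P : pred rat) x : P 0 -> (forall z, all P (fr z)) -> all P (state x).
Proof.
move=> P0 h; rewrite /state; case: last_visit => [n|]; first exact: run_all.
by rewrite /= P0.
Qed.

Lemma state_size L x : (forall z, (0 < size (fr z) <= L)%N) ->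
  (0 < size (state x) <= L)%N.
Proof.
move=> h; rewrite /state; case: last_visit => [n|]; first exact: run_size.
by rewrite /=; have := h x; lia.
Qed.

Hypotheses (mT : measurable_fun setT T) (mTi : measurable_fun setT Tinv).
Hypotheses (mE : measurable E) (mfr : forall w, measurable [set x | fr x = w]).

Lemma measurable_prop (P : Prop) : measurable [set x : Om | P].
Proof.
have [p|np] := pselect P.
  by rewrite (_ : [set _ | _] = setT)//; apply/seteqP; split.
by rewrite (_ : [set _ | _] = set0)//; apply/seteqP; split.
Qed.

(** There are countably many words, so the set splits over the value of the previous state. *)
Lemma measurable_run k w : measurable [set y | run k y = w].
Proof.
elim: k w => [//|k IH] w.
rewrite (_ : [set y | _] = \bigcup_(v : seq rat)
   ([set y | run k y = v] `&` [set y | next_state v (iter k.+1 T y) = w])); last first.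
  apply/seteqP; split => y /=; first by move=> h; exists (run k y).
  by move=> [v _ [<- <-]].
apply: countable_bigcupT_measurable => // v; apply: measurableI => //.
rewrite /next_state; case: (behead v) => [|a l]; last exact: measurable_prop.
apply: (@measurable_preim _ _ (iter k.+1 T) [set x | fr x = w]) => //.
exact: measurable_iter.
Qed.

Lemma measurable_last_visit n : measurable [set x | last_visit x = Some n].
Proof.
rewrite (_ : [set x | _] = (iter n Tinv @^-1` E) `&`
  \bigcap_(m in [set m | (m < n)%N]) (iter m Tinv @^-1` (~` E))); last first.
  apply/seteqP; split => x /=; first by move=> /last_visit_Some[? ?]; split.
  by move=> [? ?]; apply/last_visit_Some; split.
apply: measurableI; first by apply: measurable_preim => //; exact: measurable_iter.
case: n => [|n].
  by rewrite (_ : \bigcap_(_ in _) _ = setT)//; apply/seteqP; split => // x _ m.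
apply: bigcap_measurable; first by exists 0%N.
move=> m _; apply: measurable_preim; [exact: measurable_iter|exact: measurableC].
Qed.

Lemma measurable_state w : measurable [set x | state x = w].
Proof.
rewrite (_ : [set x | _] = (\bigcup_n ([set x | last_visit x = Some n] `&`
    (iter n Tinv @^-1` [set y | run n y = w]))) `|`
    ((~` \bigcup_n [set x | last_visit x = Some n]) `&` [set x | [:: 0] = w])); last first.
  apply/seteqP; split => x /=; rewrite /state.
    case e : (last_visit x) => [n|] h; first by left; exists n.
    by right; split => // -[n _] /=; rewrite e.
  move=> [[n _ [/= -> //]]|[nv h]].
  case e : (last_visit x) => [n|] //.
  by exfalso; apply: nv; exists n.
have mlv n := measurable_last_visit n.
apply: measurableU; last first.
  apply: measurableI; last exact: measurable_prop.
  by apply: measurableC; exact: bigcupT_measurable.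
apply: bigcupT_measurable => n; apply: measurableI => //.
by apply: measurable_preim; [exact: measurable_iter|exact: measurable_run].
Qed.

Lemma measurable_state_fun (h : seq rat -> R) : measurable_fun setT (h \o state).
Proof.
move=> _ B mB; rewrite setTI.
rewrite (_ : _ @^-1` _ = \bigcup_(w : seq rat) ([set x | state x = w] `&` [set x | B (h w)])).
  apply: countable_bigcupT_measurable => // w.
  by apply: measurableI; [exact: measurable_state|exact: measurable_prop].
apply/seteqP; split => x /=; first by move=> Bx; exists (state x).
by move=> [w _ [<-]].
Qed.

Variables (A : Om -> 'M[R]_2) (K : R) (L : nat).
Hypotheses (sA : slc K A) (frL : forall z, (0 < size (fr z) <= L)%N).

Definition angle x : R := ratr (head 0 (state x)).
Definition perturbed x : 'M[R]_2 := A x *m rotm (angle x).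

Lemma slc_perturbed : slc K perturbed.
Proof.
have [mA dA AK] := sA; split.
- apply: mmat_mul => // i j.
  exact: (measurable_state_fun (fun w => rotm (ratr (head 0 w)) i j)).
- by move=> x; rewrite det_mulmx dA det_rotm mulr1.
- by move=> x; rewrite nsq_mul_rotm.
Qed.

Lemma cocyc_perturbed (w : seq rat) i x : (i <= size w)%N ->
  (forall j, (j < i)%N -> state (iter j T x) = drop j w) ->
  cocyc perturbed T i x = wordc A T (map ratr (take i w)) x.
Proof.
elim: i => [|i IH] iw h; first by rewrite take0.
rewrite (take_nth 0)// map_rcons -cats1 wordc_cat size_map size_takel ?(ltnW iw)//.
rewrite [RHS]/= mul1mx /= IH ?(ltnW iw)//; last by move=> j ji; apply: h; exact: ltnW.
by rewrite /perturbed /angle h// -nth0 nth_drop addn0.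
Qed.

(** A word is either read to its end or cut off by a visit to E; in both cases a fresh word starts
    at the landing point. *)
Lemma block_step x : visited x -> state x = fr x ->
  exists l, [/\ (0 < l <= L)%N, visited (iter l T x),
    state (iter l T x) = fr (iter l T x) &
    (l = size (fr x) /\ cocyc perturbed T l x = wordc A T (map ratr (fr x)) x)
    \/ E (iter l T x)].
Proof.
move=> vx sx; have /andP[w0 wL] := frL x; set w := fr x in sx w0 wL *.
have [[i /andP[i0 iw] Ei]|none] := pselect (exists2 i, (0 < i < size w)%N & E (iter i T x)).
  exists i; split; [by rewrite i0 (leq_trans (ltnW iw))|exact: visited_iter| |by right].
  exact: state_reset.
have st i : (i < size w)%N -> state (iter i T x) = drop i w.
  elim: i => [|i IH] iw; first by rewrite drop0.
  have nE : ~ E (T (iter i T x)) by move=> h; apply: none; exists i.+1.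
  rewrite /= state_next//; last exact: visited_iter.
  rewrite IH ?(ltnW iw)// /next_state.
  have -> : behead (drop i w) = drop i.+1 w by rewrite -drop1 drop_drop add1n.
  by case e : (drop i.+1 w) => [|a l] //; move: (size_drop i.+1 w); rewrite e /=; lia.
exists (size w); split; [by rewrite w0|exact: visited_iter| |left; split => //].
  have -> : size w = (size w).-1.+1 by lia.
  rewrite /=; set y := iter _ T x.
  have [//|[ne _]] : state (T y) = fr (T y) \/ _ := state_fresh_or_behead (visited_iter _ vx).
  exfalso; move/eqP: ne; apply; rewrite st; last by lia.
  by rewrite -drop1 drop_drop drop_oversize//; lia.
by rewrite (@cocyc_perturbed w)// take_size.
Qed.

(** Every step without a fresh word removes one letter. *)
Lemma reach_fresh x : visited x ->
  exists2 j, (j <= L.+1)%N & state (iter j T x) = fr (iter j T x).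
Proof.
move=> vx; have /andP[_] := state_size x frL.
move: (L) => k; elim: k x vx => [|k IH] x vx sz.
  have [h|[ne _]] := state_fresh_or_behead vx; first by exists 1%N.
  by move: sz ne; case: (state x).
have [h|[ne h]] := state_fresh_or_behead vx; first by exists 1%N.
have [|j jk hj] := IH (T x) (visited_next vx).
  by rewrite h size_behead; lia.
by exists j.+1 => //; rewrite iterSr.
Qed.

End Machine.

(** * A measurable perturbation with small exponent *)

Section Tower.
Context {R : realType} {d : measure_display} {Om : measurableType d}.
Variable mu : probability Om R.
Variables (T Tinv : Om -> Om) (A : Om -> 'M[R]_2) (K e del : R).
Hypotheses (eT : ergodic_aut mu T Tinv) (sA : slc K A) (e0 : 0 < e) (del0 : 0 < del).

Definition good_word (w : seq rat) : set Om :=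
  [set y | nsq (wordc A T (map ratr w) y) <= expR (3 * del * (size w)%:R)].

(** Enumerates all nonempty words with letters bounded by e; other codes give the harmless word
    [[:: 0]]. *)
Definition word_of (i : nat) : seq rat :=
  if unpickle i is Some w then
    if (0 < size w)%N && all (fun t => `|ratr t : R| <= e) w then w else [:: 0]
  else [:: 0].

(** Chooses the good word of largest index below p. Where there is none, a single unperturbed step
    is made. *)
Fixpoint first_word (p : nat) (y : Om) : seq rat :=
  if p is p'.+1 then
    if `[< good_word (word_of p') y >] then word_of p' else first_word p' y
  else [:: 0].

Fixpoint word_size (p : nat) : nat :=
  if p is p'.+1 then maxn (size (word_of p')) (word_size p') else 1.

(** A finite list containing every angle that can occur, which makes the perturbation a simple
    function. *)
Fixpoint letters (p : nat) : seq rat :=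
  if p is p'.+1 then word_of p' ++ letters p' else [:: 0].

Let mT : measurable_fun setT T. Proof. by case: eT. Qed.
Let mTi : measurable_fun setT Tinv. Proof. by case: eT. Qed.

Lemma measurable_good_word w : measurable (good_word w).
Proof.
apply: measurable_le_cst; apply: measurable_nsq; apply: mmat_wordc => //.
by case: sA.
Qed.

Lemma measurable_first_word p w : measurable [set x | first_word p x = w].
Proof.
elim: p => [|p IH]; first exact: (measurable_prop ([:: 0] = w)).
rewrite (_ : [set x | _] = (good_word (word_of p) `&` [set x | word_of p = w]) `|`
   (~` good_word (word_of p) `&` [set x | first_word p x = w])); last first.
  apply/seteqP; split => x /=; case: asboolP => h.
  - by move=> ?; left.
  - by move=> ?; right.
  - by move=> [[]|[]].
  - by move=> [[]|[]].
have mg := measurable_good_word (word_of p).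
apply: measurableU; apply: measurableI => //; first exact: measurable_prop.
exact: measurableC.
Qed.

Lemma word_of_size i : (0 < size (word_of i))%N.
Proof. by rewrite /word_of; case: unpickle => [w|] //; case: ifP => // /andP[]. Qed.

Lemma zero_letter : `|ratr (0 : rat) : R| <= e.
Proof. by rewrite rmorph0 normr0 ltW. Qed.

Lemma letters_le p : all (fun t => `|ratr t : R| <= e) (letters p).
Proof.
elim: p => [|p IH] /=; first by rewrite zero_letter.
rewrite all_cat IH andbT /word_of; case: unpickle => [w|].
  by case: ifP => [/andP[]|] //=; rewrite zero_letter.
by rewrite /= zero_letter.
Qed.

Lemma first_word_size p y : (0 < size (first_word p y) <= word_size p)%N.
Proof.
elim: p => [//|p /andP[h1 h2]] /=; case: ifP => _.
  by rewrite word_of_size leq_maxl.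
by rewrite h1 (leq_trans h2)// leq_maxr.
Qed.

Lemma first_word_letters p y : all (fun t => t \in letters p) (first_word p y).
Proof.
elim: p => [//|p IH] /=; case: ifP => _; apply/allP => t tw; rewrite mem_cat.
  by rewrite tw.
by move/allP: IH => /(_ _ tw) ->; rewrite orbT.
Qed.

Lemma first_word_good p y i : (i < p)%N -> good_word (word_of i) y ->
  good_word (first_word p y) y.
Proof.
elim: p => [//|p IH] ip gi /=; case: asboolP => // ng.
apply: IH => //; rewrite ltn_neqAle -ltnS ip andbT.
by apply/eqP => h; apply: ng; rewrite -h.
Qed.

Lemma zero_letters p : 0 \in letters p.
Proof. by elim: p => [//|p IH] /=; rewrite mem_cat IH orbT. Qed.

Hypothesis words : \forall y \ae mu, exists w : seq rat, [/\ (0 < size w)%N,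
    all (fun t => `|ratr t : R| <= e) w & good_word w y].

Hypothesis small : forall k : R, 0 < k ->
  exists E, [/\ measurable E, mu E != 0%E & fine (mu E) < k].

Lemma fmu_bigcup_le (F : nat -> set Om) (k : R) n : (forall i, measurable (F i)) ->
  (forall i, fine (mu (F i)) <= k) ->
  measurable (\bigcup_(i in [set i | (i < n)%N]) F i) /\
  fine (mu (\bigcup_(i in [set i | (i < n)%N]) F i)) <= n%:R * k.
Proof.
move=> mF Fk; have mB m : measurable (\bigcup_(i in [set i | (i < m)%N]) F i).
  by apply: bigcup_measurable => i _.
split => //; elim: n => [|n IH].
  rewrite mul0r (_ : \bigcup_(_ in _) _ = set0) ?measure0//.
  by apply/seteqP; split => // x [].
apply: (@le_trans _ _ (n%:R * k + k)); last by rewrite -natr1 mulrDl mul1r.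
apply: le_trans (lerD IH (Fk n)); apply: fmu_leU => //.
apply: aeW => x [i /= ]; rewrite ltnS leq_eqVlt => /orP[/eqP ->|ilt] Fx; first by right.
by left; exists i.
Qed.

(** Good blocks contribute at most 3 del per step. Points without a good word among the first p,
    points shortly before E, and the two ends of a long orbit segment contribute at most del each,
    whence 6 del. *)
Theorem small_rate_perturbation : exists (th : Om -> R) (vals : seq R),
  [/\ measurable_fun setT th, forall x, th x \in vals, forall x, `|th x| <= e &
      exists2 n, (0 < n)%N &
        avg mu (lnN (fun x => A x *m rotm (th x)) T n) <= 6 * del * n%:R].
Proof.
have [[TK TiK] _ _ _ _] := eT; have [mA dA AK] := sA.
have K0 : 0 <= K.
  rewrite -ler_expR expR0 (le_trans _ (AK point))//; have := nsq_ge2 (dA point); lra.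
pose G p := \bigcup_(i in [set i | (i < p)%N]) good_word (word_of i).
have mG p : measurable (G p).
  by apply: bigcup_measurable => i _; exact: measurable_good_word.
have incG n m : (n <= m)%N -> G n `<=` G m.
  by move=> nm x [i /= ilt h]; exists i => //=; exact: leq_trans nm.
have covG : \forall x \ae mu, exists n, G n x.
  apply: filterS words => y [w [w0 wl gw]]; exists (pickle w).+1, (pickle w) => //=.
  by rewrite /word_of pickleK w0 wl.
have k0 : 0 < del / (2 * K + 1) by rewrite divr_gt0//; lra.
have [p0 /(_ _ (leqnn _)) hp] := ae_increasing_cover mG incG covG k0.
set p := p0 in hp; set fr := first_word p; set L := word_size p.
have frL z : (0 < size (fr z) <= L)%N by exact: first_word_size.
(* The division by L + 1 pays for the L + 1 preimages of E that form [NE]. *)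
have k1 : 0 < del / ((2 * K + 1) * L.+1%:R) by rewrite divr_gt0// mulr_gt0//; lra.
have [E [mE E0 hE]] := small k1.
have mfr w : measurable [set x | fr x = w] by exact: measurable_first_word.
pose th := @angle R _ Om T Tinv E fr.
pose B := @perturbed R _ Om T Tinv E fr A.
have sB : slc K B by exact: slc_perturbed.
have pB := lnN_process mT sB; have [_ subB KB] := pB.
have [mN nE] := @fmu_bigcup_le (fun i => iter i T @^-1` E) (del / ((2 * K + 1) * L.+1%:R)) L.+1
  (fun i => measurable_preim (measurable_iter i mT) mE)
  (fun i => eq_ind_r (fun z => fine z <= _) (ltW hE) (preserved_iter i eT mE)).
set NE := (\bigcup_(_ in _) _) in mN nE.
(* The trivial bound K(n + 1) on a block of positive length n is at most 2K per step, which is what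
   [psi] charges on the two exceptional sets. *)
pose psi x := 3 * del + 2 * K * (\1_(~` G p) x + \1_NE x).
have bpsi : bmf psi.
  apply: bmfD; first exact: bmf_cst.
  by apply: bmfZ; apply: bmfD; apply: bmf_indic => //; exact: measurableC.
have ind0 x : 0 <= 2 * K * (\1_(~` G p) x + \1_NE x).
  by apply: mulr_ge0; [exact: mulr_ge0|rewrite !indicE addr_ge0].
have psi0 x : 0 <= psi x.
  by rewrite /psi addr_ge0// mulr_ge0// ltW.
have bpsi_ge n x : 2 * K * n%:R <= bsum T psi n x ->
    lnN B T n x <= bsum T psi n x \/ n = 0%N.
  case: n => [|n] h; first by right.
  left; apply: le_trans h; rewrite (le_trans (ler_norm _))// (le_trans (KB _ _))//.
  have : K * n.+2%:R <= K * (2 * n.+1%:R).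
    by rewrite ler_wpM2l// -natrM ler_nat; lia.
  lra.
have main n x : visited Tinv E x ->
    lnN B T n x <= bsum T psi n x + 2 * K * L.+2%:R.
  move=> vx.
  pose P := [set y | visited Tinv E y /\ state T Tinv E fr y = fr y].
  have cov := @cover_bound R _ Om T (lnN B T) K psi P L subB
    (fun n x => le_trans (ler_norm _) (KB n x)) K0 psi0.
  have {}cov : forall n y, P y -> lnN B T n y <= bsum T psi n y + K * L.+1%:R.
    apply: cov => y [vy sy].
    have [l [lL vl sl]] := block_step TK TiK A frL vy sy.
    have l0 : (0 < l)%N by case/andP: lL.
    move=> h; exists l; split => //; case: h => [[lE cE]|El].
      have [Gy|nGy] := pselect (G p y).
        apply: (@le_trans _ _ (\sum_(i < l) (3 * del))).
          rewrite sumr_const card_ord -[_ *+ l]mulr_natr -ler_expR lnNK; last by case: sB.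
          rewrite cE lE; case: Gy => i /= ip gi.
          exact: (first_word_good ip gi).
        by apply: ler_sum => i _; rewrite /psi lerDl.
      (* No listed word is good at y, so the default word is read and the charge at y alone covers
         the block. *)
      have fr1 : size (fr y) = 1%N.
        rewrite /fr; have : forall i, (i < p)%N -> ~ good_word (word_of i) y.
          by move=> i ip h; apply: nGy; exists i.
        elim: (p) => [//|q IH] h /=; case: asboolP => [/h|_]; first by move=> /(_ (ltnSn _)).
        by apply: IH => i iq; apply: h; exact: leqW.
      have [] // := @bpsi_ge l y; last by move=> l00; move: l0; rewrite l00.
      rewrite lE fr1 bsum1 mulr1 /psi !indicE mem_set//=.
      have z0 : 0 <= (y \in NE)%:R :> R by [].
      move: ((y \in NE)%:R : R) z0 => z z0; have := mulr_ge0 K0 z0; have := del0; lra.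
    have [] // := @bpsi_ge l y; last by move=> l00; move: l0; rewrite l00.
    have -> : 2 * K * l%:R = \sum_(i < l) (2 * K) by rewrite sumr_const card_ord mulr_natr.
    apply: ler_sum => i _.
    (* The block was cut off by E after l <= L steps, so all its points lie in [NE]. *)
    have NEi : NE (iter i T y).
      exists (l - i)%N => /=; first by lia.
      by rewrite -iterD subnK// ltnW.
    rewrite /psi !indicE (mem_set NEi) /=.
    have z0 : 0 <= (iter i T y \in ~` G p)%:R :> R by [].
    by move: ((iter i T y \in ~` G p)%:R : R) z0 => z z0; have := mulr_ge0 K0 z0; have := del0; lra.
  have [j jL fj] := reach_fresh TK TiK frL vx.
  have [nj|jn] := leqP n j.
    rewrite (le_trans (ler_norm _))// (le_trans (KB _ _))//.
    have := bsum_ge0 T n x psi0.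
    have : K * n.+1%:R <= K * L.+2%:R by rewrite ler_wpM2l// ler_nat; lia.
    have : 0 <= K * L.+2%:R by rewrite mulr_ge0.
    lra.
  have -> : n = (j + (n - j))%N by lia.
  rewrite (le_trans (subB _ _ _))// bsumD.
  have h1 := cov (n - j)%N (iter j T x) (conj (visited_iter TK j vx) fj).
  have h2 := le_trans (ler_norm _) (KB j x).
  have h3 : K * j.+1%:R <= K * L.+2%:R by rewrite ler_wpM2l// ler_nat ltnS.
  have h4 : K * L.+1%:R <= K * L.+2%:R by rewrite ler_wpM2l// ler_nat.
  have h5 := bsum_ge0 T j x psi0.
  lra.
exists th, (map ratr (letters p)); split.
- exact: (measurable_state_fun mT mTi mE mfr (fun w => ratr (head 0 w))).
- move=> x; apply: map_f.
  have /andP[] := state_size T Tinv E x frL.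
  have : all (fun t => t \in letters p) (state T Tinv E fr x).
    apply: state_all; first exact: zero_letters.
    by move=> z; exact: first_word_letters.
  by case: (state _ _ _ _ x) => //= a l /andP[].
- move=> x; have : all (fun t => `|ratr t : R| <= e) (state T Tinv E fr x).
    apply: state_all; first exact: zero_letter.
    move=> z; apply/allP => t /(allP (first_word_letters p z)).
    exact: (allP (letters_le p)).
  rewrite /th /angle; case: (state _ _ _ _ x) => [_|a l /andP[]] //.
  exact: zero_letter.
have [n n0 hn] := natr_big (2 * K * L.+2%:R) del0.
exists n => //; rewrite -/B.
have vae : \forall x \ae mu, visited Tinv E x.
  apply: filterS (recurrence (ergodic_aut_sym eT) mE E0) => x /(_ 0%N)[m _ Em].
  by exists m.
have : avg mu (lnN B T n) <= avg mu (bsum T psi n) + 2 * K * L.+2%:R.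
  rewrite -[X in _ + X](avg_cst mu) -avgD; [|exact: bsum_bmf eT bpsi|exact: bmf_cst].
  apply: avg_le_ae; first exact: subadd_bmf pB.
    by apply: bmfD; [exact: bsum_bmf eT bpsi|exact: bmf_cst].
  by apply: filterS vae => x vx; exact: main.
rewrite (avg_bsum _ eT)//.
have apsi : avg mu psi <= 5 * del.
  have bi1 : bmf (\1_(~` G p) : Om -> R) by apply: bmf_indic; exact: measurableC.
  have bi2 : bmf (\1_NE : Om -> R) by exact: bmf_indic.
  rewrite /psi avgD; [|exact: bmf_cst|by apply: bmfZ; exact: bmfD].
  rewrite avg_cst avgZ; last exact: bmfD.
  rewrite avgD// !avg_indic//; last exact: measurableC.
  have s1 : 2 * K * fine (mu (~` G p)) <= del.
    apply: (@le_trans _ _ (2 * K * (del / (2 * K + 1)))).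
      by rewrite ler_wpM2l ?mulr_ge0// ltW.
    rewrite mulrA ler_pdivrMr; last by lra.
    by rewrite [leRHS]mulrC ler_wpM2r ?(ltW del0)//; lra.
  have s2 : 2 * K * fine (mu NE) <= del.
    apply: (@le_trans _ _ (2 * K * (del / (2 * K + 1)))).
      rewrite ler_wpM2l ?mulr_ge0// (le_trans nE)//.
      have -> : L.+1%:R * (del / ((2 * K + 1) * L.+1%:R)) = del / (2 * K + 1).
        have z0 : L.+1%:R != 0 :> R by rewrite pnatr_eq0.
        have c0 : 2 * K + 1 != 0 by rewrite gt_eqF//; lra.
        by move: (L.+1%:R : R) (2 * K + 1) z0 c0 => z c z0 c0; field; rewrite z0 c0.
      by [].
    rewrite mulrA ler_pdivrMr; last by lra.
    by rewrite [leRHS]mulrC ler_wpM2r ?(ltW del0)//; lra.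
  by have := del0; lra.
have h7 : n%:R * avg mu psi <= n%:R * (5 * del) by rewrite ler_wpM2l.
lra.
Qed.

End Tower.

(** * Uniform hyperbolicity *)

Section Norms.
Context {R : realType}.

Lemma mx_entry_le m n (M : 'M[R]_(m.+1, n.+1)) i j : `|M i j| <= `|M|.
Proof.
rewrite [leRHS]mx_normrE.
exact: (le_bigmax _ (fun ij : 'I_m.+1 * 'I_n.+1 => `|M ij.1 ij.2|) (i, j)).
Qed.

Lemma mx_norm_le m n (M : 'M[R]_(m.+1, n.+1)) (b : R) : 0 <= b ->
  (forall i j, `|M i j| <= b) -> `|M| <= b.
Proof. by move=> b0 h; rewrite [leLHS]mx_normrE; apply: bigmax_le => // -[]. Qed.

Lemma sqr_le_norm (x b : R) : `|x| <= b -> x ^+ 2 <= b ^+ 2.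
Proof.
move=> h; rewrite -real_normK ?num_real// ler_pXn2r// nnegrE//.
exact: le_trans h.
Qed.

(** The norm of a matrix here is its largest absolute entry, hence the factor 4. *)
Lemma nsq_le_norm (M : 'M[R]_2) : nsq M <= 4 * `|M| ^+ 2.
Proof.
have h i j := sqr_le_norm (mx_entry_le M i j).
by have := h 0 0; have := h 0 1; have := h 1 0; have := h 1 1; rewrite /nsq; lra.
Qed.

Lemma norm_le_nsq (M : 'M[R]_2) : `|M| ^+ 2 <= nsq M.
Proof.
rewrite -[nsq M](sqr_sqrtr (nsq_ge0 M)) ler_pXn2r ?nnegrE ?sqrtr_ge0//.
apply: mx_norm_le; first exact: sqrtr_ge0.
have h x : x ^+ 2 <= nsq M -> `|x| <= Num.sqrt (nsq M).
  by move=> h; rewrite -sqrtr_sqr; exact: ler_wsqrtr.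
have s0 := sqr_ge0 (M 0 0); have s1 := sqr_ge0 (M 0 1).
have s2 := sqr_ge0 (M 1 0); have s3 := sqr_ge0 (M 1 1).
by apply: ord2P; apply: ord2P; apply: h; rewrite /nsq; lra.
Qed.

Definition vec_of (v : 'rV[R]_2) : R * R := (v 0 0, v 0 1).

Lemma dot_le_norm (v : 'rV[R]_2) : dot (vec_of v) (vec_of v) <= 2 * `|v| ^+ 2.
Proof.
have h j := sqr_le_norm (mx_entry_le v 0 j).
by have := h 0; have := h 1; rewrite /dot /vec_of /= -!expr2; lra.
Qed.

Lemma norm_le_dot (v : 'rV[R]_2) : `|v| ^+ 2 <= dot (vec_of v) (vec_of v).
Proof.
rewrite -[leRHS](sqr_sqrtr (dot_ge0 _)) ler_pXn2r ?nnegrE ?sqrtr_ge0//.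
apply: mx_norm_le; first exact: sqrtr_ge0.
have h x : x ^+ 2 <= dot (vec_of v) (vec_of v) -> `|x| <= Num.sqrt (dot (vec_of v) (vec_of v)).
  by move=> h; rewrite -sqrtr_sqr; exact: ler_wsqrtr.
have s0 := sqr_ge0 (v 0 0); have s1 := sqr_ge0 (v 0 1).
by move=> i; rewrite ord1; apply: ord2P; apply: h; rewrite /dot /vec_of /= -!expr2; lra.
Qed.

Lemma vec_of_act (M : 'M[R]_2) v : vec_of (act M v) = mv M (vec_of v).
Proof.
have h j : (M *m v^T) j 0 = M j 0 * v 0 0 + M j 1 * v 0 1.
  rewrite mxE big_ord_recl big_ord1 !mxE.
  by congr (_ + M j _ * v 0 _); exact/val_inj.
by rewrite /vec_of /act /mv /= ![_^T 0 _]mxE !h.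
Qed.

(** Both rows equal v, so the row space is the line of v, as the definition of uniform hyperbolicity
    encodes subspaces. *)
Definition line_mx (v : R * R) : 'M[R]_2 := \matrix_(i, j) if j == 0 then v.1 else v.2.
Definition row_of (v : R * R) : 'rV[R]_2 := \row_j if j == 0 then v.1 else v.2.

Lemma vec_of_row v : vec_of (row_of v) = v.
Proof. by case: v => a b; rewrite /vec_of /row_of !mxE. Qed.

Lemma line_mx_eq v : (line_mx v :=: row_of v)%MS.
Proof.
apply/eqmxP/andP; split.
  apply/row_subP => i; rewrite (_ : row i _ = row_of v) ?submx_refl//.
  by apply/rowP => j; rewrite !mxE.
rewrite (_ : row_of v = row 0 (line_mx v)) ?row_sub//.
by apply/rowP => j; rewrite !mxE.
Qed.

Lemma row_ofZ (c : R) v : row_of (c * v.1, c * v.2) = c *: row_of v.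
Proof. by apply/rowP => j; rewrite !mxE /=; case: ifP. Qed.

Lemma sub_line_mx (w : 'rV[R]_2) v : (w <= line_mx v)%MS ->
  exists c, vec_of w = (c * v.1, c * v.2).
Proof.
rewrite line_mx_eq => /sub_rVP[c ->]; exists c.
by rewrite -row_ofZ vec_of_row.
Qed.

Lemma line_mx_mul (A : 'M[R]_2) v : line_mx v *m A^T = line_mx (mv A v).
Proof.
by apply: mx22_eq; rewrite mulmx2 !mxE /=; ring.
Qed.

Lemma line_mx_scale (c : R) v : c != 0 ->
  (line_mx (c * v.1, c * v.2)%R == line_mx v)%MS.
Proof.
move=> c0; apply/eqmxP; apply: eqmx_trans (line_mx_eq _) _.
rewrite row_ofZ; apply: eqmx_trans (eqmx_scale _ c0) _.
exact: eqmx_sym (line_mx_eq _).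
Qed.

Lemma rank_line_mx v : dot v v != 0 -> \rank (line_mx v) = 1%N.
Proof.
move=> v0; rewrite line_mx_eq rank_rV; case: eqP => // h.
by move: v0; rewrite -(vec_of_row v) h /dot /vec_of !mxE /= mulr0 addr0 eqxx.
Qed.

Lemma line_mx_direct v w : wedge v w != 0 ->
  mxdirect (line_mx v + line_mx w) /\ (line_mx v + line_mx w == 1%:M)%MS.
Proof.
move=> h.
have v0 : dot v v != 0.
  apply/eqP => d0; have := wedge_sq_le v w; rewrite d0 mul0r => h'.
  by move: h; rewrite -sqrf_eq0 eq_le h' sqr_ge0.
have w0 : dot w w != 0.
  apply/eqP => d0; have := wedge_sq_le v w; rewrite d0 mulr0 => h'.
  by move: h; rewrite -sqrf_eq0 eq_le h' sqr_ge0.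
have full : (1%:M <= line_mx v + line_mx w)%MS.
  apply/row_subP => i; move: (row i _) => z.
  (* Cramer's rule. *)
  have -> : z = (wedge (vec_of z) w / wedge v w) *: row_of v +
                (wedge v (vec_of z) / wedge v w) *: row_of w.
    apply/rowP; apply: ord2P; rewrite !mxE /= /wedge /vec_of /=; field;
      by move: h; rewrite /wedge.
  apply: addmx_sub_adds; apply: scalemx_sub; by rewrite line_mx_eq.
have eq1 : (line_mx v + line_mx w :=: 1%:M)%MS.
  by apply/eqmxP; rewrite submx1.
split; last by apply/eqmxP.
by apply/mxdirectP => /=; rewrite /= eq1 mxrank1 !rank_line_mx.
Qed.

End Norms.

(** * From estimates on the splitting to uniform hyperbolicity *)

Section UniformHyperbolicity.
Context {R : realType} {X : ptopologicalType}.
Variables (mu : probability (Borel X) R) (T Tinv : Borel X -> Borel X).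
Variables (A : Borel X -> 'M[R]_2) (K L : R) (s u : Borel X -> R * R).

Lemma cocycle_posE (B : Borel X -> 'M[R]_2) (U : Borel X -> Borel X) n x :
  @cocycle_pos R X B U n x = cocyc B U n x.
Proof. by elim: n => //= n ->. Qed.

Lemma cocycle_negE n x : (forall x, \det (A x) = 1) ->
  @cocycle_neg R X A Tinv n x = cocyc (invc A Tinv) Tinv n x.
Proof. by move=> dA; elim: n => //= n ->; rewrite invmx_adj2. Qed.

Hypotheses (eT : ergodic_aut mu T Tinv) (sA : slc K A) (ms : mvec s) (mu_ : mvec u).
Hypothesis fr : \forall x \ae mu, frame A T Tinv L s u x.

(** Passing from squared Euclidean lengths to the maximum norm costs the factor 2 and the square
    roots. *)
Lemma line_growth (M : 'M[R]_2) (v : R * R) (w : 'rV[R]_2) (C tau : R) n :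
  0 < C -> 0 < tau -> dot v v = 1 -> (w <= line_mx v)%MS ->
  dot (mv M v) (mv M v) <= C * tau ^+ n ->
  `|act M w| <= Num.sqrt (2 * C) * Num.sqrt tau ^+ n * `|w|.
Proof.
move=> C0 t0 v1 /sub_line_mx[c hc] h.
have tn : 0 <= tau ^+ n by rewrite exprn_ge0// ltW.
rewrite -(@ler_pXn2r _ 2) ?nnegrE ?mulr_ge0 ?sqrtr_ge0 ?exprn_ge0 ?sqrtr_ge0//.
rewrite (le_trans (norm_le_dot _))// vec_of_act hc mvZ dotZ.
have := dot_le_norm w; rewrite hc dotZ v1 mulr1 => h2.
rewrite !exprMn sqr_sqrtr; last by rewrite mulr_ge0// ltW.
rewrite exprAC sqr_sqrtr ?(ltW t0)//.
apply: (@le_trans _ _ (c ^+ 2 * (C * tau ^+ n))); first by rewrite ler_wpM2l// sqr_ge0.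
have -> : 2 * C * tau ^+ n * `|w| ^+ 2 = (2 * `|w| ^+ 2) * (C * tau ^+ n) by ring.
by rewrite ler_wpM2r// mulr_ge0// ltW.
Qed.

Lemma uniformly_hyperbolic_of_bounds (C tau : R) : 0 < C -> 0 < tau < 1 ->
  (\forall x \ae mu, forall n,
     dot (mv (cocyc A T n x) (s x)) (mv (cocyc A T n x) (s x)) <= C * tau ^+ n /\
     dot (mv (cocyc (invc A Tinv) Tinv n x) (u x))
         (mv (cocyc (invc A Tinv) Tinv n x) (u x)) <= C * tau ^+ n) ->
  @uniformly_hyperbolic R X mu T Tinv A.
Proof.
move=> C0 /andP[t0 t1] bd; have [_ dA _] := sA.
have ml (v : Borel X -> R * R) : mvec v -> forall i j, measurable_fun setT (fun x => line_mx (v x) i j).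
  move=> [m1 m2] i; apply: ord2P.
    by under eq_fun do rewrite mxE /=.
  by under eq_fun do rewrite mxE /=.
exists (fun x => line_mx (u x)), (fun x => line_mx (s x)).
split; first exact: (ml u mu_).
split; first exact: (ml s ms).
exists (Num.sqrt (2 * C)), (Num.sqrt tau); split.
- by rewrite sqrtr_gt0 mulr_gt0.
- by rewrite sqrtr_gt0.
- by rewrite -sqrtr1 ltr_sqrt.
apply: filterS2 (ae_iter_forall eT fr) bd => x fx bx.
have [[s1 u1] w0 si ui _] := fx 0%N; rewrite /= in s1 u1 w0 si ui.
have [[sT1 uT1] _ _ _ _] := fx 1%N; rewrite /= in sT1 uT1.
have eqm v v' : dot v v = 1 -> dot v' v' = 1 -> wedge (mv (A x) v) v' = 0 ->
    (line_mx v *m (A x)^T == line_mx v')%MS.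
  move=> v1 v1' w; rewrite line_mx_mul (parallel_unit w v1').
  apply: line_mx_scale; apply/eqP => h.
  have := wedge_mv_neq0 (dA x) v1; rewrite (parallel_unit w v1') dotZ h expr0n mul0r.
  by rewrite ltxx.
split.
- by apply: line_mx_direct; rewrite gt_eqF.
- exact: eqm.
- exact: eqm.
- move=> n v hv; rewrite cocycle_posE; apply: line_growth hv _ => //.
  exact: (bx n).1.
- move=> n v hv; rewrite cocycle_negE//; apply: line_growth hv _ => //.
  exact: (bx n).2.
Qed.

(** At y = T^{-n}x the preserved wedge product gives c <= |A^n u|^2 |A^n s|^2 <= |A^n u|^2 C tau^n.
    So u expands uniformly forward, and A^{-n} contracts it at x by (C/c) tau^n. *)
Lemma uniformly_hyperbolic_of_stable (C tau c : R) : 0 < C -> 0 < tau < 1 -> 0 < c ->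
  (\forall x \ae mu, c <= wedge (u x) (s x) ^+ 2 /\
     forall n, dot (mv (cocyc A T n x) (s x)) (mv (cocyc A T n x) (s x)) <= C * tau ^+ n) ->
  @uniformly_hyperbolic R X mu T Tinv A.
Proof.
move=> C0 t01 c0 bd; have [_ dA _] := sA; have [[TK TiK] _ _ _ _] := eT.
have /andP[t0 t1] := t01.
have Cm : 0 < Num.max C (C / c) by rewrite lt_max C0.
apply: (uniformly_hyperbolic_of_bounds Cm t01).
have H := ae_iter_forall eT (ae_and fr bd).
have : \forall x \ae mu, forall n, forall m,
    frame A T Tinv L s u (iter m T (iter n Tinv x)) /\
    (c <= wedge (u (iter m T (iter n Tinv x))) (s (iter m T (iter n Tinv x))) ^+ 2 /\
     forall k, dot (mv (cocyc A T k (iter m T (iter n Tinv x))) (s (iter m T (iter n Tinv x))))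
                   (mv (cocyc A T k (iter m T (iter n Tinv x))) (s (iter m T (iter n Tinv x)))) <= C * tau ^+ k).
  exact: (ae_iter_forall (ergodic_aut_sym eT) H).
apply: filterS => x hx n.
have tn : 0 < tau ^+ n by exact: exprn_gt0.
split.
  have [_ [_ /(_ n) h]] := hx 0%N 0%N.
  by apply: (le_trans h); rewrite ler_pM2r// le_max lexx.
pose y := iter n Tinv x.
have xy : iter n T y = x by exact: (iter_cancel n TiK).
have [iS iU] : inv_dir A T s y /\ inv_dir A T u y.
  by apply: (@frame_inv_dir _ _ _ _ _ Tinv L) => m; have [] := hx n m.
have [_ [cy sy]] := hx n 0%N; rewrite /= -/y in cy sy.
have [k hk] := inv_dir_cocyc n iU; rewrite xy in hk.
have [uy1 _] := iU 0%N; rewrite /= in uy1.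
have [ux1 _] := iU n; rewrite xy in ux1.
have := cocyc_invcK n y (u y) TK dA; rewrite xy hk mvZ => e.
have e2 : k ^+ 2 * dot (mv (cocyc (invc A Tinv) Tinv n x) (u x)) (mv (cocyc (invc A Tinv) Tinv n x) (u x)) = 1.
  by rewrite -dotZ e.
have k2 : k ^+ 2 = dot (mv (cocyc A T n y) (u y)) (mv (cocyc A T n y) (u y)).
  by rewrite hk dotZ ux1 mulr1.
have low : c <= k ^+ 2 * (C * tau ^+ n).
  apply: (le_trans cy).
  have -> : wedge (u y) (s y) = wedge (mv (cocyc A T n y) (u y)) (mv (cocyc A T n y) (s y)).
    by rewrite wedge_mv det_cocyc// mul1r.
  rewrite (le_trans (wedge_sq_le _ _))// k2 ler_wpM2l ?dot_ge0//.
have k0 : 0 < k ^+ 2.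
  rewrite lt_def sqr_ge0 andbT; apply/eqP => h; move: e2; rewrite h mul0r => /eqP.
  by rewrite eq_sym oner_eq0.
apply: (@le_trans _ _ (C / c * tau ^+ n)); last by rewrite ler_pM2r// le_max lexx orbT.
set D := dot _ _ in e2 *.
have -> : D = (k ^+ 2)^-1 by rewrite -[RHS]mulr1 -e2 mulKf// gt_eqF.
rewrite -[leLHS]mul1r ler_pdivrMr//.
have -> : C / c * tau ^+ n * k ^+ 2 = (k ^+ 2 * (C * tau ^+ n)) / c by ring.
by rewrite ler_pdivlMr// mul1r.
Qed.

(** The points whose contraction has not begun by time N form a set of measure below k for some N,
    hence a null set; the times before N are absorbed in the constant. *)
Lemma uniformly_hyperbolic_of_atomic (k : R) : 0 < L -> 0 < k ->
  (forall E : set (Borel X), measurable E -> mu E != 0%E -> k <= fine (mu E)) ->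
  @uniformly_hyperbolic R X mu T Tinv A.
Proof.
move=> L0 k0 big; have [mA dA AK] := sA; have [[TK TiK] mT mTi _ _] := eT.
have sAi := slc_invc mTi sA; have [mAi dAi _] := sAi.
have K0 : 0 <= K.
  rewrite -ler_expR expR0 (le_trans _ (AK point))//; have := nsq_ge2 (dA point); lra.
pose tau := expR (- (L / 2)).
have tn n : tau ^+ n = expR ((- L + L / 2) * n%:R).
  by rewrite -expRM_natr; congr expR; field.
pose G N := \bigcap_(n in [set n | (N <= n)%N])
  ([set x | dot (mv (cocyc A T n x) (s x)) (mv (cocyc A T n x) (s x)) <= tau ^+ n] `&`
   [set x | dot (mv (cocyc (invc A Tinv) Tinv n x) (u x))
         (mv (cocyc (invc A Tinv) Tinv n x) (u x)) <= tau ^+ n]).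
have mG N : measurable (G N).
  apply: bigcap_measurable; first by exists N => /=.
  move=> n _; apply: measurableI; apply: measurable_le_cst.
    by apply: measurable_dot; apply: mvec_mv => //; exact: mmat_cocyc.
  by apply: measurable_dot; apply: mvec_mv => //; exact: mmat_cocyc.
have incG n m : (n <= m)%N -> G n `<=` G m.
  by move=> nm x h i /= mi; apply: h => /=; exact: leq_trans mi.
have covG : \forall x \ae mu, exists n, G n x.
  apply: filterS fr => x [_ _ _ _ h].
  have [N hN] := h (L / 2) (divr_gt0 L0 (ltr0n _ 2)).
  by exists N => n /= Nn; have [_ h1 h2] := hN n Nn; split; rewrite /= tn.
have [N /(_ N (leqnn N)) hN] := ae_increasing_cover mG incG covG k0.
have GN : \forall x \ae mu, G N x.
  exists (~` G N); split => //; first exact: measurableC.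
  have [//|h] := eqVneq (mu (~` G N)) 0%E.
  by have := big _ (measurableC (mG N)) h; rewrite leNgt hN.
pose C := expR (K * N.+1%:R + L / 2 * N%:R).
have t01 : 0 < tau < 1 by rewrite expR_gt0 expR_lt1; apply/andP; split => //; lra.
apply: (@uniformly_hyperbolic_of_bounds C tau) => //; first exact: expR_gt0.
apply: filterS2 fr GN => x [[s1 u1] _ _ _ _] Gx n.
have C1 : 1 <= C.
  rewrite -[leLHS]expR0 ler_expR addr_ge0// mulr_ge0//; lra.
have [Nn|nN] := leqP N n.
  have [h1 h2] := Gx n Nn; rewrite /= in h1 h2.
  have h : tau ^+ n <= C * tau ^+ n by rewrite ler_peMl// exprn_ge0// expR_ge0.
  by split; [exact: le_trans h1 h|exact: le_trans h2 h].
have bnd : expR (K * n.+1%:R) <= C * tau ^+ n.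
  rewrite tn -expRD ler_expR.
  have h1 : K * n.+1%:R <= K * N.+1%:R by rewrite ler_wpM2l// ler_nat ltnW.
  have h2 : L / 2 * n%:R <= L / 2 * N%:R by rewrite ler_wpM2l ?ler_nat 1?ltnW//; lra.
  lra.
split; apply: (le_trans (mv_le _ _)); rewrite ?s1 ?u1 mulr1; apply: le_trans bnd.
  exact: nsq_cocyc_le.
exact: nsq_cocyc_le.
Qed.

End UniformHyperbolicity.

(** * Continuous cocycles *)

Section Borel.
Context {R : realType} {X : ptopologicalType}.
Implicit Types (A B : X -> 'M[R]_2) (f g : X -> R).

Lemma borel_open (U : set X) : open U -> measurable (U : set (Borel X)).
Proof. by move=> oU; apply: sub_sigma_algebra. Qed.

Lemma borel_closed (U : set X) : closed U -> measurable (U : set (Borel X)).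
Proof.
by move=> cU; rewrite -[U]setCK; apply: measurableC; apply: borel_open; exact: closed_openC.
Qed.

Lemma borel_continuous f : continuous f -> measurable_fun setT (f : Borel X -> R).
Proof.
move=> /continuousP cf; apply: (measurability _ (RGenOpens.measurableE R)).
move=> _ [_ [a [b ->] <-]]; rewrite setTI; apply: borel_open.
exact/cf/interval_open.
Qed.

Lemma continuous_entry A i j : continuous A -> continuous (fun x => A x i j).
Proof.
move=> cA x; apply: (@continuous_comp _ _ _ A (fun M : 'M[R]_2 => M i j)).
  exact: cA.
exact: coord_continuous.
Qed.

Lemma entries_continuous A : (forall i j, continuous (fun x => A x i j)) -> continuous A.
Proof.
move=> h x; apply/cvgrPdist_le => e e0.
have n i j : \forall y \near x, `|A x i j - A y i j| <= e.
  by have /cvgrPdist_le := h i j x; exact.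
near=> y; apply: mx_norm_le; first exact: ltW.
by apply: ord2P; apply: ord2P; rewrite !mxE; near: y; exact: n.
Unshelve. all: by end_near. Qed.

Lemma compact_bound f : compact [set: X] -> continuous f ->
  exists k : R, forall x, `|f x| <= k.
Proof.
move=> cX cf; have : compact (f @` setT).
  by apply: continuous_compact => //; exact: continuous_subspaceT.
move=> /compact_bounded[M [_ hM]]; exists (M + 1) => x.
by apply: hM; [rewrite ltrDl|exists x].
Qed.

Lemma SL2C_slc A : compact [set: X] -> @SL2C R X A ->
  exists K : R, slc K (A : Borel X -> 'M[R]_2).
Proof.
move=> cX [cA dA].
have ce i j : continuous (fun x => A x i j) by exact: continuous_entry.
have cn : continuous (fun x => nsq (A x)).
  move=> x; rewrite /nsq.
  by repeat apply: cvgD; rewrite /= !expr2; apply: cvgM; exact: ce.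
have [k hk] := compact_bound cX cn.
exists k; split => //.
- by move=> i j; exact: borel_continuous.
- move=> x; rewrite (le_trans (ler_norm _))// (le_trans (hk x))//.
  by rewrite (le_trans _ (expR_ge1Dx _))//; lra.
Qed.

Lemma csn_continuous : continuous (@csn R).
Proof.
move=> t; rewrite /csn; apply: cvgV.
  by rewrite gt_eqF// sqrtr_gt0; have := sqr_ge0 t; lra.
apply: (@continuous_comp _ _ _ (fun t : R => 1 + t ^+ 2) (@Num.sqrt R)).
  by apply: cvgD; [exact: cvg_cst|exact: exprn_continuous].
exact: sqrt_continuous.
Qed.

Lemma SL2C_rotm A f : @SL2C R X A -> continuous f ->
  @SL2C R X (fun x => A x *m rotm (f x)).
Proof.
move=> [cA dA] cf; split; last by move=> x; rewrite det_mulmx dA det_rotm mulr1.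
have ce i j : continuous (fun x => A x i j) by exact: continuous_entry.
have cc : continuous (fun x => csn (f x)).
  by move=> x; apply: (@continuous_comp _ _ _ f (@csn R)); [exact: cf|exact: csn_continuous].
have cs : continuous (fun x => f x * csn (f x)).
  by move=> x; apply: cvgM; [exact: cf|exact: cc].
have cr : forall i j, continuous (fun x => rotm (f x) i j).
  have tr g h : (forall x, g x = h x) -> continuous h -> continuous g by move=> /funext ->.
  apply: ord2P; apply: ord2P.
  - by apply: tr cc => x; rewrite rotmE.
  - apply: (tr _ (fun x => - (f x * csn (f x)))) => x; first by rewrite rotmE.
    by apply: cvgN; exact: cs.
  - by apply: tr cs => x; rewrite rotmE.
  - by apply: tr cc => x; rewrite rotmE.
apply: entries_continuous => i j.
rewrite (_ : (fun x => _) = (fun x => A x i 0 * rotm (f x) 0 j + A x i 1 * rotm (f x) 1 j)); last first.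
  by apply/funext => x; rewrite mulmx2.
move=> x; apply: cvgD; apply: cvgM; solve [exact: ce|exact: cr].
Qed.

Lemma rotm_close (M : 'M[R]_2) (t b : R) : (forall i j, `|M i j| <= b) ->
  `|M - M *m rotm t| <= 2 * b * `|t|.
Proof.
move=> hM; have b0 : 0 <= b by exact: le_trans (normr_ge0 _) (hM 0 0).
have c0 := csn_gt0 t; have c1 := csn_le1 t; have cq := csn_sq t.
have z1 : csn t * `|t| <= 1.
  rewrite -(@ler_pXn2r _ 2) ?nnegrE ?mulr_ge0 ?(ltW c0)// expr1n exprMn.
  rewrite real_normK ?num_real//; have := sqr_ge0 (csn t); lra.
have z2 : csn t * `|t| <= `|t| by rewrite ler_piMl.
(* 1 - csn <= 1 - csn^2 = (csn |t|)^2 <= csn |t|, because csn |t| <= 1. *)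
have h1 : `|1 - csn t| <= `|t|.
  rewrite ger0_norm ?subr_ge0//; apply: le_trans z2.
  have z0 : 0 <= csn t * `|t| by rewrite mulr_ge0// ltW.
  have e : 1 - csn t ^+ 2 = (csn t * `|t|) ^+ 2.
    by rewrite exprMn real_normK ?num_real//; lra.
  have e1 : csn t ^+ 2 <= csn t by rewrite expr2 ler_piMl// ltW.
  have e2 : (csn t * `|t|) ^+ 2 <= csn t * `|t| by rewrite expr2 ler_piMl.
  lra.
have h2 : `|t * csn t| <= `|t| by rewrite normrM (gtr0_norm c0) mulrC.
have pr x y z w : `|x| <= b -> `|y| <= `|t| -> `|z| <= b -> `|w| <= `|t| ->
    `|x * y + z * w| <= 2 * b * `|t|.
  move=> *; rewrite (le_trans (ler_normD _ _))// !normrM.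
  have -> : 2 * b * `|t| = b * `|t| + b * `|t| by ring.
  by apply: lerD; apply: ler_pM.
apply: mx_norm_le; first by rewrite !mulr_ge0.
move=> i; apply: ord2P; rewrite 2!mxE mulmx2 !rotmE.
- have -> : M i 0 - (M i 0 * csn t + M i 1 * (t * csn t)) =
    M i 0 * (1 - csn t) + M i 1 * (- (t * csn t)) by ring.
  by apply: pr => //; rewrite normrN.
- have -> : M i 1 - (M i 0 * - (t * csn t) + M i 1 * csn t) =
    M i 0 * (t * csn t) + M i 1 * (1 - csn t) by ring.
  exact: pr.
Qed.

(** The bound b on the products is carried through the induction because the modulus of continuity
    at the next step depends on it; everything is uniform in x. *)
Lemma cocyc_close A (T : X -> X) (k : R) n : (forall x i j, `|A x i j| <= k) ->
  exists b : R, (forall x i j, `|cocyc (A : Borel X -> _) T n x i j| <= b) /\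
  forall e : R, 0 < e -> exists2 h : R, 0 < h &
    forall B, (forall x i j, `|A x i j - B x i j| <= h) ->
      forall x i j, `|cocyc (A : Borel X -> _) T n x i j - cocyc (B : Borel X -> _) T n x i j| <= e.
Proof.
move=> hA; have k0 : 0 <= k by exact: le_trans (normr_ge0 _) (hA point 0 0).
elim: n => [|n [b [hb IH]]].
  exists 1; split => [x i j|e e0].
    by rewrite mxE; case: (i == j); rewrite ?normr1 ?normr0.
  by exists 1 => // B _ x i j; rewrite subrr normr0 ltW.
have b0 : 0 <= b by exact: le_trans (normr_ge0 _) (hb point 0 0).
have pr (x y z w p q : R) : `|x| <= p -> `|y| <= q -> `|z| <= p -> `|w| <= q ->
    `|x * y + z * w| <= 2 * (p * q).
  move=> *; rewrite (le_trans (ler_normD _ _))// !normrM.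
  have -> : 2 * (p * q) = p * q + p * q by ring.
  by apply: lerD; apply: ler_pM.
exists (2 * (k * b)); split => [x i j|e e0].
  by rewrite /= mulmx2; apply: pr.
pose e' := Num.min 1 (e / (4 * (k + 1))).
have e'0 : 0 < e' by rewrite lt_min ltr01 divr_gt0//; lra.
have e'1 : e' <= 1 by rewrite ge_min lexx.
have e'2 : e' * (4 * (k + 1)) <= e.
  by rewrite -ler_pdivlMr ?ge_min ?lexx ?orbT//; lra.
have [h h0 hB] := IH e' e'0.
pose h' := Num.min h (e / (4 * (b + 1))).
have h'0 : 0 < h' by rewrite lt_min h0 divr_gt0//; lra.
have h'2 : h' * (4 * (b + 1)) <= e.
  by rewrite -ler_pdivlMr ?ge_min ?lexx ?orbT//; lra.
exists h' => // B AB x i j.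
have ABh y i' j' : `|A y i' j' - B y i' j'| <= h.
  by rewrite (le_trans (AB y i' j'))// ge_min lexx.
have {}hB := hB B ABh x; rewrite /= !mulmx2.
set M := cocyc _ _ _ _ in hB hb *; set M' := cocyc (B : Borel X -> _) _ _ _ in hB *.
set Ay := A _; set By := B _.
have hM' i' j' : `|M' i' j'| <= b + 1.
  have -> : M' i' j' = M i' j' - (M i' j' - M' i' j') by ring.
  rewrite (le_trans (ler_normB _ _))// lerD//; first exact: hb.
  exact: le_trans (hB _ _) e'1.
have -> : Ay i 0 * M 0 j + Ay i 1 * M 1 j - (By i 0 * M' 0 j + By i 1 * M' 1 j) =
  (Ay i 0 * (M 0 j - M' 0 j) + Ay i 1 * (M 1 j - M' 1 j)) +
  ((Ay i 0 - By i 0) * M' 0 j + (Ay i 1 - By i 1) * M' 1 j) by ring.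
rewrite (le_trans (ler_normD _ _))//.
have r1 : `|Ay i 0 * (M 0 j - M' 0 j) + Ay i 1 * (M 1 j - M' 1 j)| <= 2 * (k * e').
  by apply: pr; [exact: hA|exact: hB|exact: hA|exact: hB].
have r2 : `|(Ay i 0 - By i 0) * M' 0 j + (Ay i 1 - By i 1) * M' 1 j| <= 2 * (h' * (b + 1)).
  by apply: pr; [exact: AB|exact: hM'|exact: AB|exact: hM'].
lra.
Qed.

Lemma ln_perturb (x y e : R) : 2 <= x -> 2 <= y -> y <= x + e -> 0 <= e -> ln y <= ln x + e.
Proof.
move=> x2 y2 h e0; have x0 : 0 < x by lra.
rewrite -ler_expR expRD !lnK ?posrE//; last by lra.
rewrite (le_trans h)// (@le_trans _ _ (x * (1 + e)))//.
  by have := ler_wpM2r e0 x2; lra.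
by rewrite ler_pM2l// expR_ge1Dx.
Qed.

Lemma lnN_close A (T : X -> X) (k : R) n : (forall x i j, `|A x i j| <= k) ->
  (forall x, \det (A x) = 1) -> forall e : R, 0 < e -> exists2 h : R, 0 < h &
    forall B, (forall x, \det (B x) = 1) -> (forall x, `|A x - B x| <= h) ->
      forall x, lnN (B : Borel X -> _) T n x <= lnN (A : Borel X -> _) T n x + e.
Proof.
move=> hA dA e e0; have [b [hb IH]] := cocyc_close T n hA.
have b0 : 0 <= b by exact: le_trans (normr_ge0 _) (hb point 0 0).
pose e' := Num.min 1 (e / (8 * (b + 1))).
have e'0 : 0 < e' by rewrite lt_min ltr01 divr_gt0//; lra.
have e'1 : e' <= 1 by rewrite ge_min lexx.
have e'2 : e' * (8 * (b + 1)) <= e.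
  by rewrite -ler_pdivlMr ?ge_min ?lexx ?orbT//; lra.
have [h h0 hB] := IH e' e'0; exists h => // B dB AB x.
have ABe y i j : `|A y i j - B y i j| <= h.
  by rewrite (le_trans _ (AB y))//; have := mx_entry_le (A y - B y) i j; rewrite !mxE.
have {}hB := hB B ABe x.
apply: ln_perturb.
- exact/nsq_ge2/det_cocyc.
- exact/nsq_ge2/det_cocyc.
- have {}hb := hb x; move: (cocyc (A : Borel X -> _) T n x) (cocyc (B : Borel X -> _) T n x) hB hb => M M' hB hb.
  have q i j : M' i j ^+ 2 <= M i j ^+ 2 + e' * (2 * (b + 1)).
    have d := hB i j; have m := hb i j.
    have -> : M' i j ^+ 2 = M i j ^+ 2 + (M i j - M' i j) * ((M i j - M' i j) - 2 * M i j) by ring.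
    rewrite lerD2l (le_trans (ler_norm _))// normrM.
    apply: ler_pM => //; rewrite (le_trans (ler_normB _ _))//.
    have : `|2 * M i j| = 2 * `|M i j| by rewrite normrM ger0_norm.
    lra.
  by have := q 0 0; have := q 0 1; have := q 1 0; have := q 1 1; rewrite /nsq; lra.
- exact: ltW.
Qed.

Variable mu : probability (Borel X) R.

(** Regularity squeezes E between a compact set and an open set whose difference is small; Urysohn's
    function is exact outside that difference. *)
Lemma indicator_approx (E : set (Borel X)) (k : R) : compact [set: X] ->
  hausdorff_space X -> @regular_measure R X mu -> measurable E -> 0 < k ->
  exists (g : X -> R) (F : set (Borel X)), [/\ continuous g, measurable F,
    fine (mu F) <= k & forall x, ~ F x -> g x = \1_E x].
Proof.
move=> cX hX reg mE k0; have [inn out] := reg E mE.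
have fE : mu E \is a fin_num by exact: fin_num_measure.
have k2 : 0 < k / 2 by rewrite divr_gt0.
have [Kc [cK KE] hK] : exists2 Kc : set X, compact Kc /\ Kc `<=` E &
    (mu E - (k / 2)%:E < mu Kc)%E.
  have : (mu E - (k / 2)%:E < ereal_sup [set mu K0 | K0 in [set K0 : set X | compact K0 /\ K0 `<=` E]])%E.
    by rewrite -inn lteBlDr// lteDl// lte_fin.
  by move=> /ereal_sup_gt[_ [K0 h <-] h']; exists K0.
have [U [oU EU] hU] : exists2 U : set X, open U /\ E `<=` U &
    (mu U < mu E + (k / 2)%:E)%E.
  have : (ereal_inf [set mu U | U in [set U : set X | open U /\ E `<=` U]] < mu E + (k / 2)%:E)%E.
    by rewrite -out lteDl// lte_fin.
  by move=> /ereal_inf_lt[_ [U h <-] h']; exists U.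
have clK : closed Kc by exact: compact_closed.
have mK : measurable (Kc : set (Borel X)) by exact: borel_closed.
have mU : measurable (U : set (Borel X)) by exact: borel_open.
have sep : uniform_separator (~` U) Kc.
  have nX := compact_normal hX cX.
  apply: (normal_separatorP (R := R)).1 => //; first exact: open_closedC.
  by rewrite -subset0 => x [/= nU /KE /EU].
exists (Urysohn (~` U) Kc), (U `\` Kc); split.
- exact: Urysohn_continuous.
- exact: measurableD.
- have KU : Kc `<=` U by move=> x /KE /EU.
  have fK : mu Kc \is a fin_num by exact: fin_num_measure.
  have fU : mu U \is a fin_num by exact: fin_num_measure.
  rewrite measureD//; last by rewrite (le_lt_trans (probability_le1 _ _))// ltry.
  rewrite setIidr//.
  have hK' : fine (mu E) - k / 2 < fine (mu Kc) by rewrite -lte_fin EFinB !fineK.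
  have hU' : fine (mu U) < fine (mu E) + k / 2 by rewrite -lte_fin EFinD !fineK.
  by rewrite fineB//; lra.
- move=> x nF; have [Ux|nU] := pselect (U x).
    have Kx : Kc x by apply: contrapT => nK; exact: nF.
    rewrite indicE mem_set; last exact: KE.
    by have := Urysohn_sub1 (R := R) sep; apply; exists x.
  rewrite indicE memNset; last by move/EU.
  by have := Urysohn_sub0 (R := R) sep; apply; exists x.
Qed.

Lemma simple_approx (th : Borel X -> R) (vals : seq R) (k : R) : compact [set: X] ->
  hausdorff_space X -> @regular_measure R X mu -> measurable_fun setT th -> 0 < k ->
  exists (g : X -> R) (F : set (Borel X)), [/\ continuous g, measurable F,
    fine (mu F) <= k & forall x, ~ F x -> g x = \sum_(v <- vals) v * \1_[set y | th y = v] x].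
Proof.
move=> cX hX reg mth; elim: vals k => [|v vals IH] k k0.
  exists (fun=> 0), set0; split => //; first by move=> x; exact: cvg_cst.
    by rewrite measure0 ltW.
  by move=> x _; rewrite big_nil.
have k2 : 0 < k / 2 by rewrite divr_gt0.
have mv_ : measurable [set y | th y = v].
  by have := mth measurableT [set v] (measurable_set1 v); rewrite setTI.
have [g1 [F1 [c1 m1 f1 h1]]] := indicator_approx cX hX reg mv_ k2.
have [g2 [F2 [c2 m2 f2 h2]]] := IH _ k2.
exists (fun x => v * g1 x + g2 x), (F1 `|` F2); split.
- move=> x; apply: cvgD; last exact: c2.
  by apply: cvgM; [exact: cvg_cst|exact: c1].
- exact: measurableU.
- have : fine (mu (F1 `|` F2)) <= fine (mu F1) + fine (mu F2).
    by apply: fmu_leU => //; [exact: measurableU|apply: aeW => x []; [left|right]].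
  lra.
- by move=> x /not_orP[n1 n2]; rewrite big_cons h1// h2.
Qed.

(** Clamping to [-e, e] keeps the bound on the angles without changing the function where it is
    already exact; [undup] makes each value count once. *)
Lemma angle_approx (th : Borel X -> R) (vals : seq R) (e k : R) : compact [set: X] ->
  hausdorff_space X -> @regular_measure R X mu -> measurable_fun setT th ->
  (forall x, th x \in vals) -> (forall x, `|th x| <= e) -> 0 < k ->
  exists (g : X -> R) (F : set (Borel X)), [/\ continuous g, forall x, `|g x| <= e,
    measurable F, fine (mu F) <= k & forall x, ~ F x -> g x = th x].
Proof.
move=> cX hX reg mth tv te k0.
have e0 : 0 <= e by exact: le_trans (normr_ge0 _) (te point).
have [g [F [cg mF Fk gF]]] := simple_approx (undup vals) cX hX reg mth k0.
exists (fun x => Num.max (- e) (Num.min e (g x))), F; split => //.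
- move=> x.
  have c1 : (fun y => Num.min e (g y)) y @[y --> x] --> Num.min e (g x).
    by apply: continuous_min; [exact: cvg_cst|exact: cg].
  exact: (continuous_max (f := fun=> - e) (g := fun y => Num.min e (g y)) (cvg_cst _) c1).
- move=> x; rewrite ler_norml le_max lexx /= ge_max ge_min lexx /= andbT.
  by rewrite (le_trans _ e0)// oppr_le0.
- move=> x nF; rewrite gF//.
  have -> : \sum_(v <- undup vals) v * \1_[set y | th y = v] x = th x.
    rewrite (big_rem (th x)) ?mem_undup//= indicE mem_set// mulr1.
    rewrite big_seq big1 ?addr0// => v; rewrite (rem_filter _ (undup_uniq _)).
    rewrite mem_filter /= => /andP[vt _]; rewrite indicE memNset ?mulr0//= => h.
    by move: vt; rewrite h eqxx.
  have := te x; rewrite ler_norml => /andP[h1 h2].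
  by rewrite (min_idPr h2) (max_idPr h1).
Qed.

End Borel.

(** * The dichotomy *)

Section Dichotomy.
Context {R : realType} {X : ptopologicalType}.
Variables (mu : probability (Borel X) R) (T Tinv : X -> X).
Implicit Types (A B : X -> 'M[R]_2).
Hypotheses (cX : compact [set: X]) (hX : hausdorff_space X).
Hypotheses (reg : @regular_measure R X mu) (eT : @ergodic_aut R _ (Borel X) mu T Tinv).

Let mT : measurable_fun setT (T : Borel X -> Borel X). Proof. by case: eT. Qed.

Definition lrate A : R := @rate R _ (Borel X) mu (lnN (A : Borel X -> _) T).

Lemma mx_norm22 (M : 'M[R]_2) : `|M| =
  Num.max (Num.max `|M 0 0| `|M 0 1|) (Num.max `|M 1 0| `|M 1 1|).
Proof.
apply/eqP; rewrite eq_le; apply/andP; split; last first.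
  by rewrite !ge_max !mx_entry_le.
apply: mx_norm_le; first by rewrite !le_max normr_ge0.
by apply: ord2P; apply: ord2P; rewrite !le_max lexx ?orbT.
Qed.

(** The two norms differ by a bounded factor, so the logarithms differ by a constant that disappears
    after division by n. *)
Lemma ln_norm_lnN A n x : (forall x, \det (A x) = 1) ->
  (lnN (A : Borel X -> _) T n x - ln 4) / 2 <= ln `|cocycle_pos A T n x|
    <= lnN (A : Borel X -> _) T n x / 2.
Proof.
move=> dA; rewrite (cocycle_posE (A : Borel X -> _) T) /lnN.
have n2 := nsq_ge2 (det_cocyc (T : Borel X -> Borel X) n x dA).
have h1 := nsq_le_norm (cocyc (A : Borel X -> _) T n x).
have h2 := norm_le_nsq (cocyc (A : Borel X -> _) T n x).
move: (nsq _) (`|_|) (normr_ge0 (cocyc (A : Borel X -> _) T n x)) n2 h1 h2 => N m m0 n2 h1 h2.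
have mp : 0 < m.
  rewrite lt_def m0 andbT; apply/eqP => h; move: h1; rewrite h expr0n mulr0; lra.
have e : ln (m ^+ 2) = 2 * ln m by rewrite lnXn// mulr_natl.
have h1' : ln N <= ln 4 + 2 * ln m.
  by rewrite -e -lnM ?posrE ?exprn_gt0// ler_ln ?posrE ?mulr_gt0 ?exprn_gt0//; lra.
have h2' : 2 * ln m <= ln N by rewrite -e ler_ln ?posrE ?exprn_gt0//; lra.
by apply/andP; split; lra.
Qed.

Lemma LE_rate A : @SL2C R X A -> LE mu T A = (lrate A / 2)%:E.
Proof.
move=> sA; have [K slA] := SL2C_slc cX sA; have [mA dA _] := slA.
rewrite /LE.
have -> : (\int[mu]_(x in [set: Borel X]) lyap_plus A T x =
           \int[mu]_(x in [set: Borel X]) (cst (lrate A / 2)%:E) x)%E; last first.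
  by rewrite integral_cst//= probability_setT mule1.
apply: ae_eq_integral => //.
  apply: measurable_fun_limn_esup => n; apply/measurable_EFinP.
  apply: measurable_funM => //; apply: measurableT_comp; first exact: measurable_ln.
  have mc := mmat_cocyc n mT mA.
  have mn i j : measurable_fun setT (fun x : Borel X => `|cocyc (A : Borel X -> _) T n x i j|).
    exact: measurableT_comp.
  rewrite (_ : (fun x => _) = (fun x : Borel X => Num.max
    (Num.max `|cocyc (A : Borel X -> _) T n x 0 0| `|cocyc (A : Borel X -> _) T n x 0 1|)
    (Num.max `|cocyc (A : Borel X -> _) T n x 1 0| `|cocyc (A : Borel X -> _) T n x 1 1|))).
    by apply: measurable_maxr; apply: measurable_maxr; exact: mn.
  by apply/funext => x; rewrite (cocycle_posE (A : Borel X -> _) T) mx_norm22.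
apply: filterS (kingman eT (lnN_process mT slA)) => x kx _; rewrite -/(lrate A) in kx.
have cv : (fun n : nat => (n%:R)^-1 * ln `|cocycle_pos A T n x|) @ \oo --> lrate A / 2.
  apply/cvgrPdist_le => e e0.
  have [N hN] := kx e e0; have [M M0 hM] := natr_big (ln 4) e0.
  exists (N + M)%N => // n /= nn.
  have n0 : 0 < n%:R :> R by rewrite ltr0n; lia.
  have /andP[h1 h2] := hN n (leq_trans (leq_addr _ _) nn).
  have /andP[h3 h4] := ln_norm_lnN n x dA.
  have h5 : e * M%:R <= e * n%:R by rewrite ler_wpM2l ?(ltW e0)// ler_nat; lia.
  rewrite distrC ler_distl -[_^-1 * _]mulrC; apply/andP; split.
    rewrite ler_pdivlMr//; lra.
  rewrite ler_pdivrMr//; have : 0 <= e * n%:R by rewrite mulr_ge0// ltW.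
  lra.
have cvE : (fun n : nat => ((n%:R)^-1 * ln `|cocycle_pos A T n x|)%:E) @ \oo --> (lrate A / 2)%:E.
  by apply/fine_cvgP; split; [exact: nearW|exact: cv].
rewrite /lyap_plus is_cvg_limn_esupE; first exact/cvg_lim.
by apply/cvg_ex; exists (lrate A / 2)%:E.
Qed.

Lemma unif_close_refl A (e : R) : 0 < e -> unif_close A A e.
Proof. by move=> e0; exists 0 => // x; rewrite subrr normr0. Qed.

Lemma unif_close_trans A B (C : X -> 'M[R]_2) (e : R) :
  unif_close A B (e / 2) -> unif_close B C (e / 2) -> unif_close A C e.
Proof.
move=> [d1 h1 H1] [d2 h2 H2]; exists (d1 + d2); first by lra.
move=> x; have -> : A x - C x = (A x - B x) + (B x - C x) by rewrite addrA subrK.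
by rewrite (le_trans (ler_normD _ _))// lerD.
Qed.

Lemma add_half_lt (a z : R) : a < z -> a + (z - a) / 2 < z.
Proof. by lra. Qed.

(** The rate is an infimum, so a single n witnesses the strict inequality, and for that n the
    average of [lnN] changes little under uniform perturbation. *)
Lemma lrate_usc A (c : R) : @SL2C R X A -> lrate A < c ->
  exists2 h : R, 0 < h & forall B, @SL2C R X B -> unif_close A B h -> lrate B < c.
Proof.
move=> sA rc; have [K slA] := SL2C_slc cX sA; have [_ dA AK] := slA.
have pA := lnN_process mT slA.
have [n n0 an] := rate_lt pA rc.
set a := avg mu _ in an.
have n0' : 0 < n%:R :> R by rewrite ltr0n.
have bA x i j : `|A x i j| <= expR K.
  have h := le_trans (norm_le_nsq (A x)) (AK x).
  rewrite (le_trans (mx_entry_le _ _ _))//.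
  rewrite -(@ler_pXn2r _ 2) ?nnegrE ?expR_ge0// (le_trans h)//.
  have h2 : 1 <= expR K by have := le_trans (nsq_ge2 (dA x)) (AK x); lra.
  by rewrite expr2 ler_peMl// expR_ge0.
have d0 : 0 < (c * n%:R - a) / 2 by rewrite divr_gt0// subr_gt0.
have [h h0 hh] := lnN_close T n bA dA d0.
exists h; first exact: h0.
move=> B sB [d dh hd].
have [K' slB] := SL2C_slc cX sB; have [_ dB _] := slB.
have pB := lnN_process mT slB.
have := hh B dB (fun x => le_trans (hd x) (ltW dh)) => cl.
have le1 : avg mu (lnN (B : Borel X -> _) T n) <= a + (c * n%:R - a) / 2.
  rewrite -[X in _ + X](avg_cst mu) -avgD; [|exact: subadd_bmf pA|exact: bmf_cst].
  apply: avg_le_ae; first exact: subadd_bmf pB.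
    by apply: bmfD; [exact: subadd_bmf pA|exact: bmf_cst].
  exact: aeW.
have := rate_le mu pB n; rewrite -/(lrate B) => le2.
by rewrite -(ltr_pM2r n0') (le_lt_trans le2)// (le_lt_trans le1)// add_half_lt.
Qed.

Lemma small_rate_nearby A (e c : R) : @SL2C R X A ->
  ~ @uniformly_hyperbolic R X mu T Tinv A -> 0 < e -> 0 < c ->
  exists B, [/\ @SL2C R X B, unif_close A B e & lrate B < c].
Proof.
move=> sA nUH e0 c0.
have [rc|cr] := ltP (lrate A) c.
  by exists A; split => //; exact: unif_close_refl.
have [K slA] := SL2C_slc cX sA; have [mA dA AK] := slA.
have L0 : 0 < lrate A by exact: lt_le_trans cr.
have [s [u [ms mu_ fr]]] := oseledets eT slA L0.
(* Uniform hyperbolicity is excluded here, so the measure cannot be bounded below on sets of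
   positive measure. *)
have small k : 0 < k -> exists E : set (Borel X), [/\ measurable E, mu E != 0%E & fine (mu E) < k].
  move=> k0; apply: contrapT => h; apply: nUH.
  apply: (uniformly_hyperbolic_of_atomic eT slA ms mu_ fr L0 k0) => E mE E0.
  by rewrite leNgt; apply/negP => hk; apply: h; exists E.
have K1 : 1 <= expR K by have := le_trans (nsq_ge2 (dA point)) (AK point); lra.
have bA x i j : `|A x i j| <= expR K.
  have h := le_trans (norm_le_nsq (A x)) (AK x).
  rewrite (le_trans (mx_entry_le _ _ _))//.
  rewrite -(@ler_pXn2r _ 2) ?nnegrE ?expR_ge0// (le_trans h)//.
  by rewrite expr2 ler_peMl// expR_ge0.
(* With entries bounded by exp K, rotating by at most e1 moves A by at most 2 exp(K) e1 = e/2. *)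
pose e1 := e / (4 * expR K).
have e10 : 0 < e1 by rewrite divr_gt0//; lra.
have [q0] := rat_in_itvoo e10; rewrite in_itv /= => /andP[q00 q01].
have [[C [tau [c1 [C0 t01 c10 bd]]]]|[D [m [mD D0 hD]]]] :=
  reach_or_uniform eT slA ms mu_ q00 fr.
  by exfalso; apply: nUH; exact: (uniformly_hyperbolic_of_stable eT slA ms mu_ fr C0 t01 c10 bd).
(* The measurable perturbation uses 6 del and its continuous replacement one more, which stays below
   c = 8 del. *)
pose del := c / 8.
have del0 : 0 < del by rewrite divr_gt0.
have rw := reach_words eT slA ms mu_ fr mD D0 hD del0.
have rr := reach_rational_words erefl q00 q01 del0 rw.
have [th [vals [mth tv te [n n0 an]]]] := small_rate_perturbation eT slA e10 del0 rr small.
have n0' : 0 < n%:R :> R by rewrite ltr0n.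
have K0 : 0 <= K by rewrite -ler_expR expR0.
have K10 : 0 < K + 1 by rewrite ltr_wpDl.
pose k := del / ((K + 1) * n.+1%:R).
have k0 : 0 < k by rewrite divr_gt0// mulr_gt0.
have [g [F [cg ge mF Fk gF]]] := angle_approx cX hX reg mth tv te k0.
pose B x := A x *m rotm (g x); pose B0 x := A x *m rotm (th x).
have sB : @SL2C R X B by exact: SL2C_rotm.
have slB : slc K (B : Borel X -> _).
  split.
  - have [k' [h _ _]] := SL2C_slc cX sB; exact: h.
  - by case: sB.
  - by move=> x; rewrite nsq_mul_rotm.
have slB0 : slc K (B0 : Borel X -> _).
  split.
  - apply: mmat_mul => // i j.
    have mr := measurableT_comp (f := fun t : R => rotm t i j) _ mth.
    apply: mr; apply: continuous_measurable_fun.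
    (* Continuity of the rotation entries is read off from [SL2C_rotm] for the constant identity
       cocycle on the real line. *)
    have cr' : @SL2C R R (fun t : R => 1%:M *m rotm t).
      apply: SL2C_rotm; last by move=> t; exact: cvg_id.
      by split => [t|t]; [exact: cvg_cst|rewrite det1].
    have := continuous_entry (i := i) (j := j) cr'.1.
    by rewrite (_ : (fun x => (1%:M *m rotm x) i j) = (fun t => rotm t i j))//; apply/funext => t; rewrite mul1mx.
  - by move=> x; rewrite det_mulmx dA det_rotm mulr1.
  - by move=> x; rewrite nsq_mul_rotm.
exists B; split => //.
  exists (e / 2); first by lra.
  move=> x; rewrite (le_trans (rotm_close _ (bA x)))//.
  apply: (@le_trans _ _ (2 * expR K * e1)).
    by rewrite ler_wpM2l ?mulr_ge0 ?expR_ge0.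
  have -> : 2 * expR K * e1 = e / 2 by rewrite /e1; field; rewrite gt_eqF ?expR_gt0.
  by [].
have pB := lnN_process mT slB; have pB0 := lnN_process mT slB0.
(* The two cocycles have the same n-th product unless one of the first n orbit points lies in F; on
   that set the bound K(n + 1) is used. *)
have [mBad bad] := @fmu_bigcup_le _ _ _ mu (fun i => iter i (T : Borel X -> Borel X) @^-1` F) k n
  (fun i => measurable_preim (measurable_iter i mT) mF)
  (fun i => eq_ind_r (fun z => fine z <= _) Fk (preserved_iter i eT mF)).
set Bad := (\bigcup_(_ in _) _) in mBad bad.
have cmp x : lnN (B : Borel X -> _) T n x <= lnN (B0 : Borel X -> _) T n x + K * n.+1%:R * \1_Bad x.
  have [bx|nb] := pselect (Bad x).
    rewrite indicE mem_set// mulr1; have [_ _ h] := pB.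
    have := le_trans (ler_norm _) (h n x); have := lnN_ge0 (T : Borel X -> Borel X) n x (_ : forall x, \det (B0 x) = 1).
    by move=> h1 h2; have := h1 (let: And3 _ dd _ := slB0 in dd); lra.
  rewrite indicE memNset// mulr0 addr0 /lnN (_ : cocyc _ _ _ _ = cocyc (B0 : Borel X -> _) T n x)//.
  have : forall i, (i < n)%N -> ~ F (iter i T x) by move=> i ilt h; apply: nb; exists i.
  elim: (n) => [//|j IH] h /=; rewrite IH; last by move=> i ij; apply: h; exact: leqW.
  by rewrite /B /B0 gF//; apply: h.
have bI : bmf (\1_Bad : Borel X -> R) by exact: bmf_indic.
have av : avg mu (lnN (B : Borel X -> _) T n) <= 6 * del * n%:R + K * n.+1%:R * fine (mu Bad).
  apply: (@le_trans _ _ (avg mu (lnN (B0 : Borel X -> _) T n) + K * n.+1%:R * fine (mu Bad))).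
    rewrite -avg_indic// -avgZ// -avgD; [|exact: subadd_bmf pB0|exact: bmfZ].
    apply: avg_le_ae; first exact: subadd_bmf pB.
      by apply: bmfD; [exact: subadd_bmf pB0|exact: bmfZ].
    exact: aeW.
  by rewrite lerD2r.
have small2 : K * n.+1%:R * fine (mu Bad) <= del * n%:R.
  apply: (@le_trans _ _ (K * n.+1%:R * (n%:R * k))).
    by rewrite ler_wpM2l ?mulr_ge0.
  have Kk : K * n.+1%:R * k <= del.
    have np : 0 < n.+1%:R :> R by rewrite ltr0n.
    rewrite /k mulrA ler_pdivrMr; last exact: mulr_gt0.
    have -> : del * ((K + 1) * n.+1%:R) = K * n.+1%:R * del + del * n.+1%:R by ring.
    by rewrite lerDl mulr_ge0// ltW.
  have -> : K * n.+1%:R * (n%:R * k) = K * n.+1%:R * k * n%:R by ring.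
  by rewrite ler_wpM2r.
have := rate_le mu pB n; rewrite -/(lrate B) => le2.
have d8 : c * n%:R = 8 * del * n%:R by rewrite /del; field.
have dn : 0 < del * n%:R by rewrite mulr_gt0.
rewrite -(ltr_pM2r n0') (le_lt_trans le2)// (le_lt_trans av)// d8.
apply: (@le_lt_trans _ _ (6 * del * n%:R + del * n%:R)); first by rewrite lerD2l.
have -> : 8 * del * n%:R = 6 * del * n%:R + del * n%:R + del * n%:R by ring.
by rewrite ltrDl.
Qed.

End Dichotomy.

Theorem theoremC (R : realType) (X : ptopologicalType)
    (mu : probability (Borel X) R) (T Tinv : X -> X) :
  compact [set: X] -> hausdorff_space X ->
  regular_measure mu ->
  ergodic_automorphism mu T Tinv ->
  exists Rs : set (X -> 'M[R]_2),
    residual_in (@SL2C R X) Rs /\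
    forall A, Rs A -> uniformly_hyperbolic mu T Tinv A \/ LE mu T A = 0%E.
Proof.
move=> cX hX reg eT.
have {}eT : @ergodic_aut R _ (Borel X) mu T Tinv by exact: eT.
pose S := @SL2C R X.
pose UH := @uniformly_hyperbolic R X mu T Tinv.
pose inner A := exists2 e : R, 0 < e & forall B, S B -> unif_close A B e -> UH B.
pose U (n : nat) : set (X -> 'M[R]_2) :=
  [set A | S A /\ (inner A \/ lrate mu T A < n.+1%:R^-1)].
exists (\bigcap_n U n); split.
  split; first by move=> A /(_ 0%N I) [].
  exists U; split => //; move=> n; split.
    split; first by move=> A [].
    move=> A [SA [[e e0 he]|hl]].
      exists (e / 2); first by rewrite divr_gt0.
      move=> B SB AB; split => //; left; exists (e / 2); first by rewrite divr_gt0.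
      by move=> C SC BC; apply: he => //; exact: unif_close_trans BC.
    have [h h0 hh] := lrate_usc cX eT SA hl.
    by exists h => // B SB AB; split => //; right; exact: hh.
  move=> A SA e e0.
  have [iA|nA] := pselect (inner A).
    by exists A; split; [split => //; left|exact: unif_close_refl].
  (* A is not interior to the uniformly hyperbolic cocycles, so one within e/2 fails to be uniformly
     hyperbolic; the other e/2 is spent on lowering its rate. *)
  have [A' [SA' AA' nUH]] : exists A', [/\ S A', unif_close A A' (e / 2) & ~ UH A'].
    apply: contrapT => h; apply: nA; exists (e / 2); first by rewrite divr_gt0.
    by move=> B SB AB; apply: contrapT => nB; apply: h; exists B.
  have e20 : 0 < e / 2 by rewrite divr_gt0.
  have n0 : 0 < n.+1%:R^-1 :> R by rewrite invr_gt0.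
  have [B [SB AB rB]] := small_rate_nearby cX hX reg eT SA' nUH e20 n0.
  exists B; split; last exact: unif_close_trans AA' AB.
  by split => //; right.
move=> A hA; have [SA _] := hA 0%N I.
(* [inner] does not depend on n, so outside it the bound on the rate holds for every n. *)
have [iA|nA] := pselect (inner A).
  by left; case: iA => e e0 he; apply: he => //; exact: unif_close_refl.
right; rewrite (LE_rate cX eT SA).
have [K slA] := SL2C_slc cX SA; have [_ dA _] := slA.
have mT : measurable_fun setT (T : Borel X -> Borel X) by case: eT.
have pA := lnN_process mT slA.
have r0 : 0 <= lrate mu T A.
  rewrite leNgt; apply/negP => h; have [n n0] := rate_lt pA h.
  rewrite mul0r; apply/negP; rewrite -leNgt -[leLHS](avg_cst mu).
  apply: avg_le_ae; [exact: bmf_cst|exact: subadd_bmf pA|].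
  by apply: aeW => x; exact: lnN_ge0.
suff -> : lrate mu T A = 0 by rewrite mul0r.
apply/eqP; rewrite eq_le r0 andbT leNgt; apply/negP => h.
have [n n0 hn] := natr_big 1 h.
have [_ [//|hl]] := hA n I.
have : lrate mu T A * n%:R < 1.
  rewrite (@le_lt_trans _ _ (lrate mu T A * n.+1%:R))//.
    by rewrite ler_wpM2l// ler_nat.
  by rewrite -ltr_pdivlMr ?ltr0n// mul1r.
lra.
Qed.
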